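(* Let $\Phi=\{\varphi_\nu\}_{\nu=1}^\infty\subset\mathcal A(\mathbb R^n)$ be a family satisfying the following conditions: (i$_0$) for each $\nu\in\mathbb N$ and each $A>0$ there is a constant $C_{\nu,A}>0$ such that $\varphi_\nu(x)+A\ln(1+\|x\|)\le\varphi_{\nu+1}(x)+C_{\nu,A}$ for all $x\in\mathbb R^n$; (i$_2$) for each $\nu\in\mathbb N$ there is a constant $K_\nu>0$ such that $\varphi_\nu(x+\xi)\le\varphi_{\nu+1}(x)+K_\nu$ for all $x\in[0,\infty)^n$, $\xi\in[0,1]^n$; (i$_3$) for each $\nu\in\mathbb N$ there is a constant $a_\nu>0$ such that $\varphi_\nu(2x)\le\varphi_{\nu+1}(x)+a_\nu$ for all $x\in\mathbb R^n$; (i$_4$) for each $\nu\in\mathbb N$ there is a constant $l_\nu>0$ such that $2\varphi_\nu(x)\le\varphi_{\nu+1}(x)+l_\nu$ for all $x\in\mathbb R^n$. Then the Fourier transform $\mathcal F: f\in E(\Phi)\mapsto\hat f$ is an isomorphism of topological vector spaces from $E(\Phi)$ onto $G(\Psi^* )$.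
   Context: Let $n\in\mathbb N$; $\mathbb Z_+=\{0,1,2,\dots\}$; $\|\cdot\|$ is the Euclidean norm on $\mathbb R^n$ and $\mathbb C^n$; $\langle u,v\rangle=u_1v_1+\cdots+u_nv_n$; for $z\in\mathbb C^n$, $\operatorname{Im}z=(\operatorname{Im}z_1,\dots,\operatorname{Im}z_n)$; $H(\mathbb C^n)$ is the space of entire functions on $\mathbb C^n$. Standard multi-index notation is used ($|\alpha|=\alpha_1+\cdots+\alpha_n$, $\alpha!=\alpha_1!\cdots\alpha_n!$, $x^\beta=x_1^{\beta_1}\cdots x_n^{\beta_n}$, $D^\alpha=\partial^{|\alpha|}/\partial x_1^{\alpha_1}\cdots\partial x_n^{\alpha_n}$). $\mathcal A(\mathbb R^n)$ is the set of all real-valued $g\in C(\mathbb R^n)$ such that: 1) $g(x)=g(|x_1|,\dots,|x_n|)$ for all $x\in\mathbb R^n$; 2) the restriction of $g$ to $[0,\infty)^n$ is nondecreasing in each variable; 3) $\lim_{x\to\infty}g(x)/\|x\|=+\infty$. For $g:\mathbb R^n\to[-\infty,+\infty]$ the Young-Fenchel conjugate is $g^*(x)=\sup_{y\in\mathbb R^n}(\langle x,y\rangle-g(y))$, $x\in\mathbb R^n$. Put $\psi_\nu(x)=\varphi_\nu(e^{x_1},\dots,e^{x_n})$ for $x\in\mathbb R^n$. $E(\varphi_\nu)$ is the space of all $f\in H(\mathbb C^n)$ such that for every $m\in\mathbb Z_+$ $$p_{\nu,m}(f)=\sup_{z\in\mathbb C^n}\frac{|f(z)|(1+\|z\|)^m}{e^{\varphi_\nu(\operatorname{Im}z)}}<\infty,$$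 with the topology defined by the norms $p_{\nu,m}$, $m\in\mathbb Z_+$. $E(\Phi)=\bigcup_{\nu\ge1}E(\varphi_\nu)$ is equipped with the (locally convex) inductive limit topology of the spaces $E(\varphi_\nu)$. $G(\psi_\nu^* )$ is the space of all (complex-valued) $f\in C^\infty(\mathbb R^n)$ such that for every $m\in\mathbb Z_+$ $$\|f\|_{m,\psi_\nu^*}=\sup_{x\in\mathbb R^n,\ |\alpha|\le m,\ \beta\in\mathbb Z_+^n}\frac{|x^\beta(D^\alpha f)(x)|}{\beta!\,e^{-\psi_\nu^*(\beta)}}<\infty,$$ with the topology defined by the norms $\|\cdot\|_{m,\psi_\nu^*}$, $m\in\mathbb Z_+$. $G(\Psi^* )=\bigcup_{\nu\ge1}G(\psi_\nu^* )$ is equipped with the (locally convex) inductive limit topology of the spaces $G(\psi_\nu^* )$. For $f\in E(\Phi)$, $\hat f(x)=\int_{\mathbb R^n}f(\xi)e^{-i\langle x,\xi\rangle}\,d\xi$, $x\in\mathbb R^n$. *)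

(* Defs.v *)
From HB Require Import structures.
From mathcomp Require Import all_boot all_order all_algebra complex.
From mathcomp Require Import all_classical all_reals all_analysis.

Set Implicit Arguments.
Unset Strict Implicit.
Unset Printing Implicit Defensive.
Import Order.TTheory GRing.Theory Num.Theory numFieldNormedType.Exports.

Local Open Scope classical_set_scope.
Local Open Scope ring_scope.

Section LocallyConvexInductiveLimit.
Variables (K : numFieldType) (R : realFieldType) (V : lmodType K).
Variables (E : nat -> set V) (p : nat -> nat -> V -> \bar R).

(* E nu is a vector space topologized by the seminorms p nu m, m : nat; the
   E nu are meant to be nested.  The locally convex inductive limit topology on
   their union (the finest locally convex topology making all the inclusions
   continuous) has as base of neighborhoods of 0 the absolutely convex sets
   whose trace on each E nu is a neighborhood of 0 in E nu.  Only the trace of A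
   on the union matters below, so A may be any absolutely convex subset of V. *)
Definition seminorm_nbhs0 (nu : nat) (U : set V) : Prop :=
  exists s : seq nat, exists2 e : R, 0 < e &
    forall f, E nu f -> (forall m, m \in s -> (p nu m f < e%:E)%E) -> U f.

Definition absolutely_convex (A : set V) : Prop :=
  forall (a b : K) f g, `|a| + `|b| <= 1 -> A f -> A g -> A (a *: f + b *: g).

Definition indlim_nbhs0 (A : set V) : Prop :=
  absolutely_convex A /\ forall nu, seminorm_nbhs0 nu A.

(* The seminorms are a phantom parameter, from which the topology is inferred. *)
Record indlim (q : nat -> nat -> V -> \bar R) : Type := Indlim
  { indlim_val : V; indlim_valP : (\bigcup_nu E nu) indlim_val }.

HB.instance Definition _ := gen_eqMixin (indlim p).
HB.instance Definition _ := gen_choiceMixin (indlim p).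

Definition indlim_open (U : set (indlim p)) : Prop :=
  forall f, U f -> exists2 A, indlim_nbhs0 A &
    forall g : indlim p, A (indlim_val g - indlim_val f) -> U g.

Fact indlim_openT : indlim_open setT.
Proof.
move=> f _; exists setT => //; split=> // nu.
by exists [::]; exists 1.
Qed.

Fact indlim_openI : setI_closed indlim_open.
Proof.
move=> U W oU oW f [/oU[A [cA nA] AU] /oW[B [cB nB] BW]].
exists (A `&` B); last by move=> g [/AU ? /BW].
split=> [a b g h ab [Ag Bg] [Ah Bh]|nu]; first by split; [exact: cA|exact: cB].
have [s [e e0 He]] := nA nu; have [t [d d0 Hd]] := nB nu.
exists (s ++ t); exists (Order.min e d); first by rewrite lt_min e0.
move=> g Eg Hg; split.
  apply: He => // m ms; have := Hg m; rewrite mem_cat ms => /(_ isT).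
  by move=> /lt_le_trans; apply; rewrite lee_fin ge_min lexx.
apply: Hd => // m mt; have := Hg m; rewrite mem_cat mt orbT => /(_ isT).
by move=> /lt_le_trans; apply; rewrite lee_fin ge_min lexx orbT.
Qed.

Fact indlim_open_bigU (I : Type) (U : I -> set (indlim p)) :
  (forall i, indlim_open (U i)) -> indlim_open (\bigcup_i U i).
Proof.
move=> oU f [i _ /oU[A nA AU]]; exists A => // g /AU Ug; by exists i.
Qed.

HB.instance Definition _ := isOpenTopological.Build (indlim p)
  indlim_openT indlim_openI indlim_open_bigU.

End LocallyConvexInductiveLimit.


(* Linearity is stated on representatives; when the E nu are nested vector
   spaces their union is a vector space and h always exists. *)
Definition tvs_isomorphism (K : numFieldType) (R : realFieldType)
    (V V' : lmodType K) (E : nat -> set V) (E' : nat -> set V')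
    (p : nat -> nat -> V -> \bar R) (p' : nat -> nat -> V' -> \bar R)
    (F : indlim E p -> indlim E' p') : Prop :=
  [/\ forall (a : K) (f g h : indlim E p),
        indlim_val h = a *: indlim_val f + indlim_val g ->
        indlim_val (F h) = a *: indlim_val (F f) + indlim_val (F g),
      continuous F &
      exists G : indlim E' p' -> indlim E p,
        [/\ cancel F G, cancel G F & continuous G]].

Section LebesgueTuple.
Variable R : realType.
Local Notation T n := (n.-tuple (measurableTypeR R)).

Definition tcons n (z : measurableTypeR R * T n) : T n.+1 :=
  [the n.+1.-tuple _ of z.1 :: z.2].

Fact measurable_tcons n : measurable_fun setT (@tcons n).
Proof. by apply: measurable_cons. Qed.

Section Step.
Variables (n : nat) (m : {sigma_finite_measure set (T n) -> \bar R}).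

Definition lebesgue_cons : set (T n.+1) -> \bar R :=
  pushforward (lebesgue_measure \x m)%E (@tcons n).


Fact lebesgue_cons0 : lebesgue_cons set0 = 0%E.
Proof. by rewrite /lebesgue_cons /pushforward preimage_set0 measure0. Qed.

Fact lebesgue_cons_ge0 A : (0 <= lebesgue_cons A)%E.
Proof. by rewrite /lebesgue_cons /pushforward; exact: measure_ge0. Qed.

Fact lebesgue_cons_sigma_additive : semi_sigma_additive lebesgue_cons.
Proof.
move=> F mF tF mUF; rewrite /lebesgue_cons /pushforward preimage_bigcup.
have mpre A : measurable A -> measurable (@tcons n @^-1` A).
  by move=> mA; rewrite -[X in measurable X]setTI; exact: measurable_tcons.
apply: measure_semi_sigma_additive.
- by move=> k; exact: mpre.
- apply/trivIsetP => /= i j _ _ ij; rewrite -preimage_setI.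
  by move/trivIsetP : tF => /(_ _ _ _ _ ij) ->//; rewrite preimage_set0.
- by rewrite -preimage_bigcup; exact: mpre.
Qed.

HB.instance Definition _ := isMeasure.Build _ _ _ lebesgue_cons
  lebesgue_cons0 lebesgue_cons_ge0 lebesgue_cons_sigma_additive.

Fact lebesgue_cons_sigma_finite : sigma_finite setT lebesgue_cons.
Proof.
have /sigma_finiteP[F [TF ndF Foo]] :=
  sigma_finiteT (@lebesgue_measure R : {sigma_finite_measure set _ -> \bar R}).
have /sigma_finiteP[G [TG ndG Goo]] := sigma_finiteT m.
pose uncons (t : T n.+1) : measurableTypeR R * T n :=
  (thead t, [tuple of behead t]).
have unconsK : cancel (@tcons n) uncons.
  by case=> x t; congr pair; apply: val_inj.
have tconsK : cancel uncons (@tcons n).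
  by move=> t; rewrite [RHS]tuple_eta; exact: val_inj.
have muncons : measurable_fun setT uncons.
  apply/measurable_fun_pairP; split.
    exact: measurable_tnth.
  exact: measurable_behead.
exists (fun k => uncons @^-1` (F k `*` G k)).
  rewrite -preimage_bigcup predeqE => t; split=> // _.
  have [k _ Fk] : (\bigcup_k F k) (uncons t).1 by rewrite -TF.
  have [j _ Gj] : (\bigcup_k G k) (uncons t).2 by rewrite -TG.
  exists (maxn k j) => //; split.
    by move: Fk; exact/subsetPset/ndF/leq_maxl.
  by move: Gj; exact/subsetPset/ndG/leq_maxr.
move=> k; have [mF Fk] := Foo k; have [mG Gk] := Goo k; split.
  by rewrite -[X in measurable X]setTI; apply: muncons => //; exact: measurableX.
rewrite /lebesgue_cons /pushforward -comp_preimage.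
rewrite (_ : uncons \o _ = id); last by apply/funext => z; exact: unconsK.
by rewrite preimage_id product_measure1E// lte_mul_pinfty// ge0_fin_numE.
Qed.

HB.instance Definition _ := Measure_isSigmaFinite.Build _ _ _ lebesgue_cons
  lebesgue_cons_sigma_finite.
End Step.

Definition lebesgue0 : set (T 0) -> \bar R := @dirac _ (T 0) [tuple] R.
HB.instance Definition _ := Measure.on lebesgue0.

Fact lebesgue0_sigma_finite : sigma_finite setT lebesgue0.
Proof.
apply: fin_num_fun_sigma_finite; first by rewrite measure0.
by move=> A mA; rewrite /lebesgue0 diracE.
Qed.
HB.instance Definition _ := Measure_isSigmaFinite.Build _ _ _ lebesgue0
  lebesgue0_sigma_finite.

Fixpoint lebesgue_tuple n : {sigma_finite_measure set (T n) -> \bar R} :=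
  if n is n'.+1 then lebesgue_cons (lebesgue_tuple n') else lebesgue0.

(* lebesgue_tuple is the Lebesgue measure of R^n, carried by n-tuples because
   row vectors have no sigma-algebra in the library: it is determined by its
   values on boxes. *)
Fact lebesgue_tuple_box n (A : 'I_n -> set (measurableTypeR R)) :
  (forall i, measurable (A i)) ->
  lebesgue_tuple n [set t | forall i, A i (tnth t i)] =
    (\prod_(i < n) lebesgue_measure (A i))%E.
Proof.
elim: n A => [|n IH] A mA.
  by rewrite big_ord0 /= /lebesgue0 diracE mem_set// => -[].
rewrite big_ord_recl /= -IH//.
rewrite /lebesgue_cons /pushforward.
rewrite -product_measure1E//.
  congr ((_ \x _)%E _); apply/seteqP; split=> -[x t] /=.
    move=> H; split; first exact: (H ord0).
    by move=> i; have := H (lift ord0 i); rewrite tnthS.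
  move=> [Ax At] i; case: (unliftP ord0 i) => [j|] ->; last by [].
  by rewrite tnthS; exact: At.
rewrite (_ : [set t | _] =
   \bigcap_(i in [set: 'I_n]) ((fun t : T n => tnth t i) @^-1` A (lift ord0 i))).
  apply: fin_bigcap_measurable => // i _.
  by rewrite -[X in measurable X]setTI; exact: measurable_tnth.
by apply/seteqP; split=> t /= H i; [move=> _|]; exact: H.
Qed.
End LebesgueTuple.

Section Spaces.
Variables (R : realType) (n : nat).

(* R[i]^o rather than R[i] as codomain: it carries the structure of normed
   module over R[i]. *)
Local Notation C := (R[i]^o).

Definition dot (x y : 'rV[R]_n) : R := \sum_i x 0 i * y 0 i.
Definition enorm (x : 'rV[R]_n) : R := Num.sqrt (\sum_i x 0 i ^+ 2).
Definition cabs (c : R[i]) : R := Normc.normc c.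
Definition cenorm (z : 'rV[R[i]]_n) : R := Num.sqrt (\sum_i cabs (z 0 i) ^+ 2).

Definition orthant (x : 'rV[R]_n) : Prop := forall i, 0 <= x 0 i.

Definition weight (g : 'rV[R]_n -> R) : Prop :=
  [/\ continuous g,
      forall x, g x = g (map_mx Num.norm x),
      forall i x y, orthant x -> orthant y ->
        (forall j, j != i -> x 0 j = y 0 j) -> x 0 i <= y 0 i -> g x <= g y &
      forall M : R, exists r : R, forall x, r < enorm x -> M < g x / enorm x].

Definition young_conj (g : 'rV[R]_n -> \bar R) (x : 'rV[R]_n) : \bar R :=
  ereal_sup [set ((dot x y)%:E - g y)%E | y in setT].

Definition entire (f : 'rV[R[i]]_n -> C) : Prop := forall z, differentiable f z.

(* The sequence of weights is indexed from 0: phi nu is the (nu+1)-st weight. *)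
Definition pE (phi : nat -> 'rV[R]_n -> R) (nu m : nat)
    (f : 'rV[R[i]]_n -> C) : \bar R :=
  ereal_sup [set (cabs (f z) * (1 + cenorm z) ^+ m /
                  expR (phi nu (map_mx (@complex.Im R) z)))%:E | z in setT].

Definition E_ (phi : nat -> 'rV[R]_n -> R) (nu : nat) :
    set ('rV[R[i]]_n -> C) :=
  [set f | entire f /\ forall m, (pE phi nu m f < +oo)%E].

Definition EPhi (phi : nat -> 'rV[R]_n -> R) := indlim (E_ phi) (pE phi).

(* Derivatives and integrals of complex-valued functions of real variables are
   taken on the real and imaginary parts. *)
Definition partials (s : seq 'I_n) (h : 'rV[R]_n -> R) : 'rV[R]_n -> R :=
  foldr (fun j k x => 'D_(delta_mx 0 j) k x) h s.

Definition smooth (h : 'rV[R]_n -> R) : Prop :=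
  forall s, continuous (partials s h) /\
    forall j x, derivable (partials s h) x (delta_mx 0 j).

Definition re (f : 'rV[R]_n -> C) (x : 'rV[R]_n) : R := complex.Re (f x).
Definition im (f : 'rV[R]_n -> C) (x : 'rV[R]_n) : R := complex.Im (f x).

Definition multiindex := {ffun 'I_n -> nat}.
Definition mlength (a : multiindex) : nat := (\sum_i a i)%N.
Definition mfact (a : multiindex) : nat := (\prod_i (a i)`!)%N.
Definition mpow (x : 'rV[R]_n) (b : multiindex) : R := \prod_i x 0 i ^+ b i.
Definition mvec (b : multiindex) : 'rV[R]_n := \row_i (b i)%:R.

Definition mD (a : multiindex) (f : 'rV[R]_n -> C) (x : 'rV[R]_n) : R[i] :=
  let s := flatten [seq nseq (a j) j | j <- enum 'I_n] in
  (partials s (re f) x +i* partials s (im f) x)%C.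

Definition psi (phi : nat -> 'rV[R]_n -> R) (nu : nat) (x : 'rV[R]_n) : \bar R :=
  (phi nu (map_mx expR x))%:E.

Definition pG (phi : nat -> 'rV[R]_n -> R) (nu m : nat)
    (f : 'rV[R]_n -> C) : \bar R :=
  ereal_sup [set u | exists x a b, (mlength a <= m)%N /\
    u = ((cabs ((mpow x b)%:C%C * mD a f x))%:E /
         ((mfact b)%:R%:E * expeR (- young_conj (psi phi nu) (mvec b))))%E].

Definition G_ (phi : nat -> 'rV[R]_n -> R) (nu : nat) :
    set ('rV[R]_n -> C) :=
  [set f | [/\ smooth (re f), smooth (im f) &
               forall m, (pG phi nu m f < +oo)%E]].

Definition GPsi (phi : nat -> 'rV[R]_n -> R) := indlim (G_ phi) (pG phi).

(* cis t is e^(it). *)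
Definition cis (t : R) : R[i] := (cos t +i* sin t)%C.

Definition cintegral (f : 'rV[R]_n -> C) : R[i] :=
  (\int[lebesgue_tuple R n]_t re f (\row_i tnth t i) +i*
   \int[lebesgue_tuple R n]_t im f (\row_i tnth t i))%C.

Definition fourier (f : 'rV[R[i]]_n -> C) (x : 'rV[R]_n) : C :=
  cintegral (fun xi => f (map_mx (real_complex R) xi) * cis (- dot x xi)).

End Spaces.

(* Main.v *)
Require Import Defs.
From HB Require Import structures.
From mathcomp Require Import all_boot all_order all_algebra complex.
From mathcomp Require Import all_classical all_reals all_analysis measurable_realfun.
From mathcomp Require Import ring lra.

(** The proof follows the Paley-Wiener pattern: decay of f in the real directions
and growth in the imaginary ones are traded against smoothness and decay of its
Fourier transform.

From E to G ([pG_transform]).  Cauchy's theorem moves the domain of integration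
of the transform of f from R^n to R^n + i eta ([cint_shift], which rests on
Goursat's theorem, applied to one coordinate at a time).  This gives
<<
  |D^alpha fhat (x)| <= C p_(nu, |alpha| + 2n)(f) exp (phi_nu (eta) + <x, eta>)
>>
for every real eta.  The choice eta_i = - sgn(x_i) r_i turns the exponent into
phi_nu (r) - <|x|, r>, with r = e^y any point of the open orthant.  Since
a^b / b! <= e^a, multiplication by x^beta / beta! costs at most the factor
exp (<|x|, r> - <beta, y>), and the infimum over y is exp (- psi_nu^* (beta)).
Hence E(phi_nu) is mapped continuously into G(psi_nu^* ), with the same index.

From G to E ([pE_inversion]).  Conversely e^a <= 3 (2a)^b / b! for a suitable b
([exp_coeff_large]), so that the bounds on all the x^beta D^alpha g add up to
<<
  |D^alpha g (x)| <= 3^n ||g|| exp (phi_nu (2r) - <|x|, r>)    for all r > 0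
>>
([G_decay]).  The inverse Fourier integral of g therefore converges on C^n to an
entire function.  At a point with imaginary part eta one takes
r = |eta| + (1, ..., 1): the growth exp (<|x|, |eta|>) of the kernel is absorbed,
exp (- |x_1| - ... - |x_n|) remains and makes the integral converge, and
phi_nu (2r) is at most phi_(nu+2) (eta) up to a constant, by the conditions on
phi_nu (2x) and on phi_nu (x + xi).  Integration by parts produces the powers of
z ([inverse_parts]).

The two maps are inverse to each other.  In dimension one, Fourier inversion is
proved by Abel summation ([inversion1]); Fubini's theorem extends it to any
dimension ([fourier_inversion]).  On R^n + i eta it is applied to the
translate of f by i eta, whose transform is exp (- <x, eta>) fhat (x)
([transform_shift], [inversion_transform]).

Finally a linear map between inductive limits that satisfies estimates between
the seminorms of the steps is continuous ([indlim_continuous]).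

Throughout, functions on R^n are dominated by multiples of the product of the
1 / (1 + t_i^2): this weight is integrable, and so are its restrictions to
lines, which makes dominated convergence and Fubini's theorem applicable
everywhere. *)

Set Implicit Arguments.
Unset Strict Implicit.
Unset Printing Implicit Defensive.
Import Order.TTheory GRing.Theory Num.Theory numFieldNormedType.Exports.

Local Open Scope classical_set_scope.
Local Open Scope ring_scope.

(** * Complex modulus and exponential *)

Local Notation ReC := complex.Re.
Local Notation ImC := complex.Im.

Section ComplexModulus.
Variable R : realType.
Implicit Types (c d : R[i]) (r t : R).

Lemma cabsE c : `|c| = (cabs c)%:C%C. Proof. by []. Qed.

Lemma cabs_ge0 c : 0 <= cabs c.
Proof. by case: c => a b; exact: sqrtr_ge0. Qed.

Lemma cabs0 : cabs (0 : R[i]) = 0. Proof. exact: Normc.normc0. Qed.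

Lemma cabs1 : cabs (1 : R[i]) = 1. Proof. exact: Normc.normc1. Qed.

Lemma cabsM c d : cabs (c * d) = cabs c * cabs d.
Proof. exact: Normc.normcM. Qed.

Lemma cabsD c d : cabs (c + d) <= cabs c + cabs d.
Proof. by have := ler_normD c d; rewrite -lecR rmorphD. Qed.

Lemma cabsN c : cabs (- c) = cabs c.
Proof. by case: c => a b; rewrite /cabs /= !sqrrN. Qed.

Lemma cabsB c d : cabs (c - d) <= cabs c + cabs d.
Proof. by rewrite -(cabsN d) cabsD. Qed.

Lemma cabs_distC c d : cabs (c - d) = cabs (d - c).
Proof. by rewrite -cabsN opprB. Qed.

Lemma cabs_real r : cabs r%:C%C = `|r|.
Proof. by rewrite /cabs /= expr0n addr0 sqrtr_sqr. Qed.

Lemma cabsX c k : cabs (c ^+ k) = cabs c ^+ k.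
Proof. by elim: k => [|k IH]; rewrite ?expr0 ?cabs1// !exprS cabsM IH. Qed.

Lemma cabs_eq0 c : cabs c = 0 -> c = 0.
Proof. exact: Normc.eq0_normc. Qed.

Lemma cabs_i : cabs ('i%C : R[i]) = 1.
Proof. by rewrite /cabs /= expr0n expr1n add0r sqrtr1. Qed.

Lemma Re_le_cabs c : `|ReC c| <= cabs c.
Proof.
case: c => a b; rewrite /cabs /= -sqrtr_sqr; apply: ler_wsqrtr.
by rewrite lerDl sqr_ge0.
Qed.

Lemma Im_le_cabs c : `|ImC c| <= cabs c.
Proof.
case: c => a b; rewrite /cabs /= -sqrtr_sqr; apply: ler_wsqrtr.
by rewrite lerDr sqr_ge0.
Qed.

Lemma cabs_le_ReIm c : cabs c <= `|ReC c| + `|ImC c|.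
Proof.
have -> : c = (ReC c)%:C%C + 'i%C * (ImC c)%:C%C by exact: complexE.
apply: (le_trans (cabsD _ _)); rewrite cabsM cabs_i mul1r !cabs_real.
by case: c => a b /=; rewrite !(mul0r,mulr0,mul1r,mulr1,addr0,subr0,add0r).
Qed.

Lemma ReCD c d : ReC (c + d) = ReC c + ReC d. Proof. by case: c; case: d. Qed.
Lemma ImCD c d : ImC (c + d) = ImC c + ImC d. Proof. by case: c; case: d. Qed.
Lemma ReCN c : ReC (- c) = - ReC c. Proof. by case: c. Qed.
Lemma ImCN c : ImC (- c) = - ImC c. Proof. by case: c. Qed.
Lemma ReCB c d : ReC (c - d) = ReC c - ReC d. Proof. by rewrite ReCD ReCN. Qed.
Lemma ImCB c d : ImC (c - d) = ImC c - ImC d. Proof. by rewrite ImCD ImCN. Qed.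
Lemma ReCM c d : ReC (c * d) = ReC c * ReC d - ImC c * ImC d.
Proof. by case: c; case: d. Qed.
Lemma ImCM c d : ImC (c * d) = ReC c * ImC d + ImC c * ReC d.
Proof. by case: c; case: d. Qed.

Lemma gt0_real c : 0 < c -> exists2 r : R, c = r%:C%C & 0 < r.
Proof.
by case: c => a b; rewrite ltcE /= => /andP[/eqP -> a0]; exists a.
Qed.

Lemma complexP c d : ReC c = ReC d -> ImC c = ImC d -> c = d.
Proof. by case: c; case: d => /= ? ? ? ? -> ->. Qed.

Lemma cisD r t : cis (r + t) = cis r * cis t.
Proof. by apply: complexP; rewrite /= ?cosD ?sinD//; ring. Qed.

Lemma cis0 : cis (0 : R) = 1.
Proof. by apply: complexP; rewrite /= ?cos0 ?sin0. Qed.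

Lemma cabs_cis t : cabs (cis t) = 1.
Proof. by rewrite /cabs /cis /= cos2Dsin2 sqrtr1. Qed.

Definition cexp c : R[i] := (expR (ReC c))%:C%C * cis (ImC c).

Lemma cexpD c d : cexp (c + d) = cexp c * cexp d.
Proof. rewrite /cexp ReCD ImCD cisD expRD rmorphM/=; ring. Qed.

Lemma cabs_cexp c : cabs (cexp c) = expR (ReC c).
Proof. by rewrite /cexp cabsM cabs_cis mulr1 cabs_real ger0_norm// expR_ge0. Qed.

Lemma cexp_im t : cexp ('i%C * t%:C%C) = cis t.
Proof. by rewrite /cexp /= !(mul0r,mulr0,mul1r,add0r,addr0,subr0,oppr0) expR0 mul1r. Qed.

Lemma is_derive_continuous (q q' : R -> R) :
  (forall t, is_derive t 1 q (q' t)) -> continuous q.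
Proof.
move=> dq t; apply: differentiable_continuous; apply/derivable1_diffP.
by have := dq t; case.
Qed.

(** The second-order Taylor remainder, by two applications of the mean value
theorem. *)
Lemma taylor2_le (p p1 p2 : R -> R) (M : R) :
  (forall t, is_derive t 1 p (p1 t)) -> (forall t, is_derive t 1 p1 (p2 t)) ->
  (forall t, 0 <= t <= 1 -> `|p2 t| <= M) -> `|p 1 - p 0 - p1 0| <= M.
Proof.
move=> dp dp1 Mp2.
have [c c01 ->] := @MVT R p p1 0 1 ltr01 (fun x _ => dp x)
  (continuous_subspaceT (is_derive_continuous dp)).
move: c01; rewrite in_itv/= => /andP[c_gt0 c_lt1].
have [d d01 E] := @MVT R p1 p2 0 c c_gt0 (fun x _ => dp1 x)
  (continuous_subspaceT (is_derive_continuous dp1)).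
move: d01; rewrite in_itv/= => /andP[d_gt0 d_lt1].
rewrite subr0 mulr1 E subr0 normrM (gtr0_norm c_gt0).
have p2M : `|p2 d| <= M by apply: Mp2; rewrite !ltW//= (lt_trans d_lt1).
by apply: le_trans p2M; rewrite ler_piMr// ltW.
Qed.

(** Real and imaginary part of exp (t c) are functions of t with second derivative
bounded by 2 |c|^2 exp |Re c| on [0, 1]. *)
Lemma cexp_taylor2 c :
  cabs (cexp c - 1 - c) <= 4 * cabs c ^+ 2 * expR `|ReC c|.
Proof.
have [a [b ->]] : exists a b, c = (a +i* b)%C by case: c => a b; exists a, b.
set C := (a +i* b)%C.
have bnd (x y t : R) : 0 <= t <= 1 -> `|x| <= 1 -> `|y| <= 1 ->
    `|expR (t * a) * ((a ^+ 2 - b ^+ 2) * x + 2 * a * b * y)|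
    <= 2 * cabs C ^+ 2 * expR `|ReC C|.
  move=> /andP[t0 t1] x1 y1; rewrite normrM (ger0_norm (expR_ge0 _)) mulrC.
  rewrite ler_pM ?expR_ge0//; last first.
    rewrite ler_expR /=; have := ler_norm a; have := lerNnormlW (lexx `|a|).
    have := normr_ge0 a; nra.
  rewrite /cabs /= sqr_sqrtr ?addr_ge0 ?sqr_ge0//.
  apply: (le_trans (ler_normD _ _)); rewrite !normrM.
  have A0 : `|a ^+ 2 - b ^+ 2| <= a ^+ 2 + b ^+ 2.
    by rewrite ler_norml; have := sqr_ge0 a; have := sqr_ge0 b; nra.
  have B0 : `|2| * `|a| * `|b| <= a ^+ 2 + b ^+ 2.
    rewrite ger0_norm// -(real_normK (num_real a)) -(real_normK (num_real b)).
    by have := sqr_ge0 (`|a| - `|b|); nra.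
  have := ler_pM (normr_ge0 _) (normr_ge0 _) A0 x1.
  have := ler_pM _ (normr_ge0 y) B0 y1.
  by rewrite !mulr_ge0// !mulr1 => /(_ isT); lra.
apply: (le_trans (cabs_le_ReIm _)).
have -> : 4 * cabs C ^+ 2 * expR `|ReC C| =
  2 * cabs C ^+ 2 * expR `|ReC C| + 2 * cabs C ^+ 2 * expR `|ReC C| by ring.
apply: lerD.
- pose p t := expR (t * a) * cos (t * b).
  pose p1 t := expR (t * a) * (a * cos (t * b) - b * sin (t * b)).
  pose p2 t := expR (t * a) * ((a ^+ 2 - b ^+ 2) * cos (t * b)
                  + 2 * a * b * (- sin (t * b))).
  have c1 t : `|cos (t * b)| <= 1 by rewrite ler_norml cos_geN1 cos_le1.
  have s1 t : `|- sin (t * b)| <= 1 by rewrite normrN ler_norml sin_geN1 sin_le1.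
  have := @taylor2_le p p1 p2 _ _ _ (fun t t01 => bnd _ _ t t01 (c1 t) (s1 t)).
  rewrite /p /p1 !mul0r !mul1r expR0 cos0 sin0 !mulr0 !mulr1 !subr0 !mul1r.
  have -> : expR a * cos b - 1 - a = ReC (cexp C - 1 - C).
    by rewrite /cexp /= mul0r subr0.
  apply.
  + move=> t; apply: is_derive_eq; rewrite /GRing.scale /= /p1; ring.
  + move=> t; apply: is_derive_eq; rewrite /GRing.scale /= /p2; ring.
- pose p t := expR (t * a) * sin (t * b).
  pose p1 t := expR (t * a) * (a * sin (t * b) + b * cos (t * b)).
  pose p2 t := expR (t * a) * ((a ^+ 2 - b ^+ 2) * sin (t * b)
                  + 2 * a * b * cos (t * b)).
  have c1 t : `|cos (t * b)| <= 1 by rewrite ler_norml cos_geN1 cos_le1.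
  have s1 t : `|sin (t * b)| <= 1 by rewrite ler_norml sin_geN1 sin_le1.
  have := @taylor2_le p p1 p2 _ _ _ (fun t t01 => bnd _ _ t t01 (s1 t) (c1 t)).
  rewrite /p /p1 !mul0r !mul1r expR0 cos0 sin0 !mulr0 !mulr1 !subr0 add0r !mul1r.
  have -> : expR a * sin b - b = ImC (cexp C - 1 - C).
    by rewrite /cexp /= mul0r addr0 subr0.
  apply.
  + move=> t; apply: is_derive_eq; rewrite /GRing.scale /= /p1; ring.
  + move=> t; apply: is_derive_eq; rewrite /GRing.scale /= /p2; ring.
Qed.

Lemma cis_taylor2 t : cabs (cis t - 1 - 'i%C * t%:C%C) <= 4 * t ^+ 2.
Proof.
have := cexp_taylor2 ('i%C * t%:C%C); rewrite cexp_im cabsM cabs_i mul1r cabs_real.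
by rewrite /= mulr0 mul0r subr0 normr0 expR0 mulr1 real_normK ?num_real.
Qed.

Lemma cis_lipschitz t : cabs (cis t - 1) <= 2 * `|t|.
Proof.
have c1 (q q' : R -> R) : (forall t, is_derive t 1 q (q' t)) ->
   (forall t, `|q' t| <= 1) -> `|q t - q 0| <= `|t|.
  move=> dq dq1; have cq := is_derive_continuous dq.
  have [t0|t0|->] := ltgtP 0 t; last by rewrite subrr !normr0.
  - have [c _ ->] := @MVT R q q' 0 t t0 (fun x _ => dq x) (continuous_subspaceT cq).
    by rewrite subr0 normrM ler_piMl.
  - have [c _ E] := @MVT R q q' t 0 t0 (fun x _ => dq x) (continuous_subspaceT cq).
    by rewrite distrC E sub0r normrM normrN ler_piMl.
apply: (le_trans (cabs_le_ReIm _)); rewrite mulr_natl mulr2n; apply: lerD => /=.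
- have := @c1 cos (fun t => - sin t) _ _; rewrite cos0; apply => x.
    by rewrite normrN ler_norml sin_geN1 sin_le1.
- have := @c1 sin cos _ _; rewrite sin0 !subr0; apply => x.
  by rewrite ler_norml cos_geN1 cos_le1.
Qed.

End ComplexModulus.

(** * Integration of complex-valued functions *)

Section ComplexIntegral.
Context d (T : measurableType d) (R : realType).
Implicit Types (f g : T -> R[i]) (c : R[i]) (D : set T).

Definition cmeas D f :=
  measurable_fun D (fun t => ReC (f t)) /\ measurable_fun D (fun t => ImC (f t)).

Lemma cmeas_eq D f g : f =1 g -> cmeas D f -> cmeas D g.
Proof. by move=> /funext ->. Qed.

Lemma cmeas_cst D c : cmeas D (fun=> c).
Proof. by split; exact: measurable_cst. Qed.

Lemma cmeasD D f g : cmeas D f -> cmeas D g -> cmeas D (fun t => f t + g t).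
Proof.
move=> [f1 f2] [g1 g2]; split.
- by under eq_fun do rewrite ReCD; exact: measurable_funD.
- by under eq_fun do rewrite ImCD; exact: measurable_funD.
Qed.

Lemma cmeasM D f g : cmeas D f -> cmeas D g -> cmeas D (fun t => f t * g t).
Proof.
move=> [f1 f2] [g1 g2]; split.
- under eq_fun do rewrite ReCM; apply: measurable_funB; exact: measurable_funM.
- under eq_fun do rewrite ImCM; apply: measurable_funD; exact: measurable_funM.
Qed.

Lemma cmeasN D f : cmeas D f -> cmeas D (fun t => - f t).
Proof.
move=> mf; apply: (@cmeas_eq D (fun t => (-1) * f t)).
  by move=> t; rewrite mulN1r.
by apply: cmeasM => //; exact: cmeas_cst.
Qed.

Lemma cmeasB D f g : cmeas D f -> cmeas D g -> cmeas D (fun t => f t - g t).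
Proof. by move=> mf mg; apply: cmeasD => //; exact: cmeasN. Qed.

Lemma cmeas_real D (h : T -> R) : measurable_fun D h -> cmeas D (fun t => (h t)%:C%C).
Proof. by move=> mh; split=> //=; exact: measurable_cst. Qed.

Lemma cmeas_cis D (h : T -> R) : measurable_fun D h -> cmeas D (fun t => cis (h t)).
Proof.
by move=> mh; split => /=; apply: measurableT_comp => //;
  apply: continuous_measurable_fun; [exact: continuous_cos|exact: continuous_sin].
Qed.

Definition cint (mu : {measure set T -> \bar R}) D f : R[i] :=
  (\int[mu]_(t in D) ReC (f t) +i* \int[mu]_(t in D) ImC (f t))%C.

Variable mu : {measure set T -> \bar R}.

Definition rintegrable D (g : T -> R) := mu.-integrable D (EFin \o g).

Definition cintegrable D f :=
  rintegrable D (fun t => ReC (f t)) /\ rintegrable D (fun t => ImC (f t)).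

Variables (D : set T) (mD : measurable D).

Lemma eq_cint f g : (forall t, D t -> f t = g t) -> cint mu D f = cint mu D g.
Proof.
move=> fg; apply: complexP; rewrite /=; apply: eq_Rintegral => t; rewrite inE => Dt;
  by rewrite fg.
Qed.

Lemma rintegrableZ k (g : T -> R) : rintegrable D g -> rintegrable D (fun t => k * g t).
Proof. by move=> gi; exact: (integrableZl mD k gi). Qed.

Lemma rintegrableD (g h : T -> R) : rintegrable D g -> rintegrable D h ->
  rintegrable D (fun t => g t + h t).
Proof. by move=> gi hi; exact: (integrableD mD gi hi). Qed.

Lemma rintegrable_le (g h : T -> R) : measurable_fun D g -> rintegrable D h ->
  (forall t, D t -> `|g t| <= h t) -> rintegrable D g.
Proof.
move=> mg hi gh; apply: (le_integrable mD _ _ hi).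
  exact/measurable_EFinP.
by move=> t Dt; rewrite /= lee_fin (le_trans (gh _ Dt))// ler_norm.
Qed.

Lemma dominated_cintegrable f (g : T -> R) : cmeas D f -> rintegrable D g ->
  (forall t, D t -> cabs (f t) <= g t) -> cintegrable D f.
Proof.
move=> [f1 f2] gi fg; split; apply: rintegrable_le gi _ => // t Dt.
- exact: le_trans (Re_le_cabs _) (fg _ Dt).
- exact: le_trans (Im_le_cabs _) (fg _ Dt).
Qed.

Lemma cintD f g : cintegrable D f -> cintegrable D g ->
  cint mu D (fun t => f t + g t) = cint mu D f + cint mu D g.
Proof.
move=> [f1 f2] [g1 g2]; apply: complexP; rewrite /=.
- by under eq_Rintegral do rewrite ReCD; rewrite RintegralD.
- by under eq_Rintegral do rewrite ImCD; rewrite RintegralD.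
Qed.

Lemma cintegrableM c f : cintegrable D f -> cintegrable D (fun t => c * f t).
Proof.
move=> [f1 f2]; split.
- rewrite /rintegrable; under [X in EFin \o X]eq_fun do rewrite ReCM -mulNr.
  by apply: rintegrableD; exact: rintegrableZ.
- rewrite /rintegrable; under [X in EFin \o X]eq_fun do rewrite ImCM.
  by apply: rintegrableD; exact: rintegrableZ.
Qed.

Lemma cintegrableD f g : cintegrable D f -> cintegrable D g ->
  cintegrable D (fun t => f t + g t).
Proof.
move=> [f1 f2] [g1 g2]; split.
- rewrite /rintegrable; under [X in EFin \o X]eq_fun do rewrite ReCD.
  exact: rintegrableD.
- rewrite /rintegrable; under [X in EFin \o X]eq_fun do rewrite ImCD.
  exact: rintegrableD.
Qed.

Lemma cintM c f : cintegrable D f ->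
  cint mu D (fun t => c * f t) = c * cint mu D f.
Proof.
move=> [f1 f2]; apply: complexP; rewrite /= ?ReCM ?ImCM /=.
- under eq_Rintegral do rewrite ReCM.
  by rewrite RintegralB ?RintegralZl//; exact: rintegrableZ.
- under eq_Rintegral do rewrite ImCM.
  by rewrite RintegralD ?RintegralZl//; exact: rintegrableZ.
Qed.

Lemma cintN f : cintegrable D f -> cint mu D (fun t => - f t) = - cint mu D f.
Proof.
move=> fi; rewrite -mulN1r -cintM//.
by apply: eq_cint => t _; rewrite mulN1r.
Qed.

Lemma cintegrableN f : cintegrable D f -> cintegrable D (fun t => - f t).
Proof.
move=> fi; have := cintegrableM (-1) fi.
by under [X in cintegrable D X]eq_fun do rewrite mulN1r.
Qed.

Lemma cintB f g : cintegrable D f -> cintegrable D g ->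
  cint mu D (fun t => f t - g t) = cint mu D f - cint mu D g.
Proof. by move=> fi gi; rewrite cintD ?cintN//; exact: cintegrableN. Qed.

Lemma cintegrableB f g : cintegrable D f -> cintegrable D g ->
  cintegrable D (fun t => f t - g t).
Proof. by move=> fi gi; apply: cintegrableD => //; exact: cintegrableN. Qed.

Lemma cint0 : cint mu D (fun=> 0) = 0.
Proof. by apply: complexP; rewrite /= Rintegral_cst// mul0r. Qed.

(** The factor 2 comes from separate estimates of the real and imaginary parts;
sharp constants are irrelevant to the topologies. *)
Lemma le_cint f (g : T -> R) : cmeas D f -> rintegrable D g ->
  (forall t, D t -> cabs (f t) <= g t) ->
  cabs (cint mu D f) <= 2 * \int[mu]_(t in D) g t.
Proof.
move=> mf gi fg; have [f1 f2] := dominated_cintegrable mf gi fg.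
apply: (le_trans (cabs_le_ReIm _)); rewrite mulr_natl mulr2n /=.
have nf h : rintegrable D h -> (forall t, D t -> `|h t| <= g t) ->
    `|\int[mu]_(t in D) h t| <= \int[mu]_(t in D) g t.
  move=> hi hg; apply: (le_trans (le_normr_Rintegral mD hi)).
  apply: le_Rintegral => //.
  exact: (integrable_norm hi).
apply: lerD; apply: nf => // t Dt.
- exact: le_trans (Re_le_cabs _) (fg _ Dt).
- exact: le_trans (Im_le_cabs _) (fg _ Dt).
Qed.

End ComplexIntegral.

Section ComplexConvergence.
Variable R : realType.

Lemma cvg_dist_le (a b : nat -> R) (l : R) :
  (forall k, `|a k - l| <= b k) -> b @ \oo --> (0 : R) -> a @ \oo --> l.
Proof.
move=> ab b0; apply/cvgrPdist_le => e e0.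
have /cvgrPdist_le/(_ _ e0) := b0; apply: filterS => k.
rewrite sub0r normrN distrC => /(le_trans (ler_norm _)); exact: le_trans.
Qed.

(** The norm of R[i] takes values in R[i]; convergence of the real modulus gives
access to the limit theorems for real sequences. *)
Definition ccvg (u : nat -> R[i]) (l : R[i]) :=
  (fun k => cabs (u k - l)) @ \oo --> (0 : R).

Lemma ccvgP u l : ccvg u l <->
  (fun k => ReC (u k)) @ \oo --> ReC l /\ (fun k => ImC (u k)) @ \oo --> ImC l.
Proof.
split=> [ul|[u1 u2]].
- split; apply: cvg_dist_le ul => k.
    by rewrite -ReCB Re_le_cabs.
  by rewrite -ImCB Im_le_cabs.
- apply: (@cvg_dist_le _ (fun k => `|ReC (u k) - ReC l| + `|ImC (u k) - ImC l|)).
    move=> k; rewrite subr0 ger0_norm ?cabs_ge0// -ReCB -ImCB.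
    exact: cabs_le_ReIm.
  rewrite -[X in _ --> X](addr0 (0 : R)); apply: cvgD.
    by rewrite -(normr0 R); apply: cvg_norm; apply/subr_cvg0.
  by rewrite -(normr0 R); apply: cvg_norm; apply/subr_cvg0.
Qed.

Lemma ccvg_unique u l l' : ccvg u l -> ccvg u l' -> l = l'.
Proof.
move=> /ccvgP[u1 u2] /ccvgP[v1 v2].
apply: complexP.
- by rewrite -(cvg_lim _ u1)// -(cvg_lim _ v1).
- by rewrite -(cvg_lim _ u2)// -(cvg_lim _ v2).
Qed.

Lemma ccvg_cst l : ccvg (fun=> l) l.
Proof. by rewrite /ccvg subrr cabs0; exact: cvg_cst. Qed.

Lemma ccvg_le (u : nat -> R[i]) l (b : nat -> R) :
  (forall k, cabs (u k - l) <= b k) -> b @ \oo --> (0 : R) -> ccvg u l.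
Proof.
move=> ub; apply: cvg_dist_le => k.
by rewrite subr0 ger0_norm ?cabs_ge0.
Qed.

Lemma ccvgD u v l m : ccvg u l -> ccvg v m -> ccvg (fun k => u k + v k) (l + m).
Proof.
move=> /ccvgP[u1 u2] /ccvgP[v1 v2]; apply/ccvgP; split.
- by under eq_fun do rewrite ReCD; rewrite ReCD; exact: cvgD.
- by under eq_fun do rewrite ImCD; rewrite ImCD; exact: cvgD.
Qed.

Lemma ccvgM u v l m : ccvg u l -> ccvg v m -> ccvg (fun k => u k * v k) (l * m).
Proof.
move=> /ccvgP[u1 u2] /ccvgP[v1 v2]; apply/ccvgP; split.
- under eq_fun do rewrite ReCM; rewrite ReCM; apply: cvgB; exact: cvgM.
- under eq_fun do rewrite ImCM; rewrite ImCM; apply: cvgD; exact: cvgM.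
Qed.

Lemma ccvg_real (h : nat -> R) (x : R) : h @ \oo --> x -> ccvg (fun k => (h k)%:C%C) x%:C%C.
Proof. by move=> hx; apply/ccvgP; split => //=; exact: cvg_cst. Qed.

Lemma ccvg_cis (h : nat -> R) (x : R) : h @ \oo --> x -> ccvg (fun k => cis (h k)) (cis x).
Proof.
move=> hx; apply/ccvgP; split => /=.
- by apply: continuous_cvg hx; exact: continuous_cos.
- by apply: continuous_cvg hx; exact: continuous_sin.
Qed.

Lemma ccvg_cexp u l : ccvg u l -> ccvg (fun k => cexp (u k)) (cexp l).
Proof.
move=> /ccvgP[u1 u2]; apply: ccvgM; last exact: ccvg_cis.
by apply: ccvg_real; apply: continuous_cvg u1; exact: continuous_expR.
Qed.

End ComplexConvergence.

Section ComplexDominated.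
Context d (T : measurableType d) (R : realType).
Variables (mu : {measure set T -> \bar R}) (D : set T) (mD : measurable D).

Lemma cmeas_ccvg (f_ : nat -> T -> R[i]) (f : T -> R[i]) :
  (forall k, cmeas D (f_ k)) -> (forall t, D t -> ccvg (f_ ^~ t) (f t)) ->
  cmeas D f.
Proof.
move=> mf ff; split.
- apply: (@measurable_fun_cvg _ _ _ D (fun k t => ReC (f_ k t))).
    by move=> k; case: (mf k).
  by move=> t Dt; have /ccvgP[] := ff _ Dt.
- apply: (@measurable_fun_cvg _ _ _ D (fun k t => ImC (f_ k t))).
    by move=> k; case: (mf k).
  by move=> t Dt; have /ccvgP[] := ff _ Dt.
Qed.

Lemma rdominated (h_ : nat -> T -> R) (h g : T -> R) :
  (forall k, measurable_fun D (h_ k)) -> measurable_fun D h ->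
  (forall t, D t -> h_ ^~ t @ \oo --> h t) ->
  rintegrable mu D g -> (forall k t, D t -> `|h_ k t| <= g t) ->
  (fun k => \int[mu]_(t in D) h_ k t) @ \oo --> \int[mu]_(t in D) h t.
Proof.
move=> mh_ mh hh gi hg; apply: fine_cvg.
have := @dominated_convergence _ _ _ mu D mD (fun k t => (h_ k t)%:E) (EFin \o h) (EFin \o g) _ _ _ gi _.
case.
- by move=> k; exact/measurable_EFinP.
- exact/measurable_EFinP.
- apply: aeW => t Dt; apply: cvg_EFin; last exact: hh.
  by apply: nearW => k.
- by apply: aeW => t k Dt; rewrite lee_fin; exact: hg.
- move=> hi _ hc; rewrite /Rintegral fineK; first exact: hc.
  exact: integrable_fin_num.
Qed.

Lemma cdominated (f_ : nat -> T -> R[i]) (f : T -> R[i]) (g : T -> R) :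
  (forall k, cmeas D (f_ k)) -> (forall t, D t -> ccvg (f_ ^~ t) (f t)) ->
  rintegrable mu D g -> (forall k t, D t -> cabs (f_ k t) <= g t) ->
  ccvg (fun k => cint mu D (f_ k)) (cint mu D f).
Proof.
move=> mf ff gi fg; have [mf1 mf2] := cmeas_ccvg mf ff.
apply/ccvgP; split => /=; apply: (rdominated (g := g)) => //.
- by move=> k; case: (mf k).
- by move=> t Dt; have /ccvgP[] := ff _ Dt.
- by move=> k t Dt; exact: le_trans (Re_le_cabs _) (fg _ _ Dt).
- by move=> k; case: (mf k).
- by move=> t Dt; have /ccvgP[] := ff _ Dt.
- by move=> k t Dt; exact: le_trans (Im_le_cabs _) (fg _ _ Dt).
Qed.

End ComplexDominated.

Section ComplexFubini.
Context d1 d2 (T1 : measurableType d1) (T2 : measurableType d2) (R : realType).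
Variables (m1 : {sigma_finite_measure set T1 -> \bar R}).
Variables (m2 : {sigma_finite_measure set T2 -> \bar R}).
Variables (a : T1 -> R) (b : T2 -> R).
Hypotheses (a0 : forall x, 0 <= a x) (b0 : forall y, 0 <= b y).
Hypotheses (ai : rintegrable m1 setT a) (bi : rintegrable m2 setT b).

Lemma rintegrable_prod :
  rintegrable (m1 \x m2)%E setT (fun p => a p.1 * b p.2).
Proof.
have ma : measurable_fun setT a by apply/measurable_EFinP; case/integrableP: ai.
have mb : measurable_fun setT b by apply/measurable_EFinP; case/integrableP: bi.
have mab : measurable_fun setT (fun p : T1 * T2 => (a p.1 * b p.2)%:E).
  apply/measurable_EFinP/measurable_funM.
    by apply: measurableT_comp => //.
  by apply: measurableT_comp => //.
apply/integrable12ltyP => //=.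
have -> : (fun x => \int[m2]_y `|(a x * b y)%:E|)%E =
          (fun x => (a x * \int[m2]_y b y)%R%:E).
  apply/funext => x; rewrite EFinM /Rintegral fineK; last exact: integrable_fin_num.
  rewrite -ge0_integralZl//; last 3 first.
  - exact/measurable_EFinP.
  - by move=> y _; rewrite lee_fin.
  - by rewrite lee_fin.
  by apply: eq_integral => y _; rewrite /= ger0_norm// mulr_ge0.
have : rintegrable m1 setT (fun x => a x * \int[m2]_y b y).
  have -> : (fun x => a x * \int[m2]_y b y) = (fun x => (\int[m2]_y b y) * a x).
    by apply/funext => x; rewrite mulrC.
  exact: rintegrableZ.
by move=> /integrable_lty; apply.
Qed.

Variables (F : T1 * T2 -> R[i]) (mF : cmeas setT F).
Hypothesis Fab : forall x y, cabs (F (x, y)) <= a x * b y.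

Lemma cmeas_pair1 y : cmeas setT (fun x => F (x, y)).
Proof.
case: mF => F1 F2; split.
- exact: (measurable_fun_pair1 y F1).
- exact: (measurable_fun_pair1 y F2).
Qed.

Lemma cmeas_pair2 x : cmeas setT (fun y => F (x, y)).
Proof.
case: mF => F1 F2; split.
- exact: (measurable_fun_pair2 x F1).
- exact: (measurable_fun_pair2 x F2).
Qed.

Lemma cintegrable_prod : cintegrable (m1 \x m2)%E setT F.
Proof.
by apply: (dominated_cintegrable measurableT mF rintegrable_prod) => -[x y] _; exact: Fab.
Qed.

Lemma cintegrable_pair1 y : cintegrable m1 setT (fun x => F (x, y)).
Proof.
apply: (dominated_cintegrable measurableT (cmeas_pair1 y) (rintegrableZ measurableT (b y) ai)) => // x _.
by rewrite mulrC.
Qed.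

Lemma cintegrable_pair2 x : cintegrable m2 setT (fun y => F (x, y)).
Proof.
exact: (dominated_cintegrable measurableT (cmeas_pair2 x) (rintegrableZ measurableT (a x) bi)).
Qed.

Let fubini1 (h : T1 * T2 -> R) : rintegrable (m1 \x m2)%E setT h ->
  (forall x, rintegrable m2 setT (fun y => h (x, y))) ->
  measurable_fun setT (fun x => \int[m2]_y h (x, y)) /\
  \int[(m1 \x m2)%E]_p h p = \int[m1]_x \int[m2]_y h (x, y).
Proof.
move=> hi h2; have E x : (\int[m2]_y h (x, y))%:E = fubini_F m2 (EFin \o h) x.
  by rewrite /Rintegral fineK//; apply: integrable_fin_num => //; exact: h2.
split.
  apply/measurable_EFinP; apply: (eq_measurable_fun (fubini_F m2 (EFin \o h))).
    by move=> x _; rewrite -E.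
  exact: (measurable_fubini_F hi).
rewrite /Rintegral -(integral12_prod_meas1 hi); congr fine.
by apply: eq_integral => x _; rewrite -E.
Qed.

Let fubini2 (h : T1 * T2 -> R) : rintegrable (m1 \x m2)%E setT h ->
  (forall y, rintegrable m1 setT (fun x => h (x, y))) ->
  measurable_fun setT (fun y => \int[m1]_x h (x, y)) /\
  \int[(m1 \x m2)%E]_p h p = \int[m2]_y \int[m1]_x h (x, y).
Proof.
move=> hi h1; have E y : (\int[m1]_x h (x, y))%:E = fubini_G m1 (EFin \o h) y.
  by rewrite /Rintegral fineK//; apply: integrable_fin_num => //; exact: h1.
split.
  apply/measurable_EFinP; apply: (eq_measurable_fun (fubini_G m1 (EFin \o h))).
    by move=> y _; rewrite -E.
  exact: (measurable_fubini_G hi).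
rewrite /Rintegral -(integral21_prod_meas1 hi); congr fine.
by apply: eq_integral => y _; rewrite -E.
Qed.

Let fubini1C := (fubini1 cintegrable_prod.1 (fun x => (cintegrable_pair2 x).1),
                 fubini1 cintegrable_prod.2 (fun x => (cintegrable_pair2 x).2)).
Let fubini2C := (fubini2 cintegrable_prod.1 (fun y => (cintegrable_pair1 y).1),
                 fubini2 cintegrable_prod.2 (fun y => (cintegrable_pair1 y).2)).

Lemma cmeas_fubini1 : cmeas setT (fun x => cint m2 setT (fun y => F (x, y))).
Proof. by split; [exact: fubini1C.1.1|exact: fubini1C.2.1]. Qed.

Lemma cmeas_fubini2 : cmeas setT (fun y => cint m1 setT (fun x => F (x, y))).
Proof. by split; [exact: fubini2C.1.1|exact: fubini2C.2.1]. Qed.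

Lemma cint_prod12 : cint (m1 \x m2)%E setT F =
  cint m1 setT (fun x => cint m2 setT (fun y => F (x, y))).
Proof. by apply: complexP; [exact: fubini1C.1.2|exact: fubini1C.2.2]. Qed.

Lemma cint_prod21 : cint (m1 \x m2)%E setT F =
  cint m2 setT (fun y => cint m1 setT (fun x => F (x, y))).
Proof. by apply: complexP; [exact: fubini2C.1.2|exact: fubini2C.2.2]. Qed.

End ComplexFubini.

(** * Lebesgue integrals over n-space *)

Section TupleIntegral.
Variable R : realType.
Local Notation RT := (measurableTypeR R).
Local Notation T n := (n.-tuple RT).
Local Notation lambda := (@lebesgue_measure R).

Definition wgt (s : R) : R := (1 + s ^+ 2)^-1.

Lemma wgt_gt0 s : 0 < wgt s.
Proof. by rewrite invr_gt0 ltr_pwDl ?sqr_ge0. Qed.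

Lemma wgt_ge0 s : 0 <= wgt s. Proof. exact: ltW (wgt_gt0 s). Qed.

Lemma wgt_le1 s : wgt s <= 1.
Proof. by rewrite /wgt invf_le1 ?lerDl ?sqr_ge0// ltr_pwDl ?sqr_ge0. Qed.

Lemma continuous_wgt : continuous wgt. Proof. exact: continuous_oneDsqrV. Qed.

Lemma measurable_wgt : measurable_fun setT wgt.
Proof. exact: (continuous_measurable_fun continuous_wgt). Qed.

Lemma integral_wgt : (\int[lambda]_s (wgt s)%:E = pi%:E)%E.
Proof.
rewrite (ge0_symfun_integralT wgt_ge0 continuous_wgt); last first.
  by move=> s; rewrite /wgt /= sqrrN.
rewrite -set_itvcy integral0y_oneDsqr -EFinM; congr EFin.
by rewrite mulrC divfK ?pnatr_eq0.
Qed.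

Lemma rintegrable_wgt : rintegrable lambda setT wgt.
Proof.
apply/integrableP; split; first by apply/measurable_EFinP; exact: measurable_wgt.
under eq_integral do rewrite /= ger0_norm ?wgt_ge0//.
by rewrite integral_wgt ltry.
Qed.

Lemma rintegrable_wgtZ k : rintegrable lambda setT (fun s => k * wgt s).
Proof. exact: (rintegrableZ measurableT k rintegrable_wgt). Qed.

(** An integrable product dominating all the integrals below; its factors
dominate the integrals over lines. *)
Definition Wgt n (t : T n) : R := \prod_(i < n) wgt (tnth t i).

Lemma Wgt_gt0 n (t : T n) : 0 < Wgt t.
Proof. by apply: prodr_gt0 => i _; exact: wgt_gt0. Qed.

Lemma Wgt_ge0 n (t : T n) : 0 <= Wgt t. Proof. exact: ltW (Wgt_gt0 t). Qed.

Lemma Wgt_le1 n (t : T n) : Wgt t <= 1.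
Proof.
suff /andP[] : 0 <= Wgt t <= 1 by [].
rewrite /Wgt; elim/big_ind: _ => [|a b /andP[a0 a1] /andP[b0 b1]|i _].
- by rewrite ler01 lexx.
- by rewrite mulr_ge0// mulr_ile1.
- by rewrite wgt_ge0 wgt_le1.
Qed.

Lemma Wgt_cons n x (t : T n) : Wgt (tcons (x, t)) = wgt x * Wgt t.
Proof.
rewrite /Wgt big_ord_recl; congr (_ * _).
by apply: eq_bigr => i _; rewrite tnthS.
Qed.

Lemma measurable_Wgt n : measurable_fun setT (@Wgt n).
Proof.
apply: measurable_prod => i _; apply: measurableT_comp; first exact: measurable_wgt.
exact: measurable_tnth.
Qed.

Lemma measurableT_tcons n (h : T n.+1 -> R) : measurable_fun setT h ->
  measurable_fun setT (h \o (@tcons R n)).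
Proof. by move=> mh; apply: measurableT_comp => //; exact: measurable_tcons. Qed.

Lemma rintegrable_Wgt n : rintegrable (lebesgue_tuple R n) setT (@Wgt n).
Proof.
elim: n => [|n IH].
  apply/integrableP; split; first by apply/measurable_EFinP; exact: measurable_Wgt.
  rewrite /= /lebesgue0 integral_dirac//; last first.
    by apply/measurable_EFinP; apply: measurableT_comp => //; exact: measurable_Wgt.
  by rewrite diracT mul1e ltry.
rewrite /rintegrable /= /lebesgue_cons; apply: integrable_pushforward => //.
- exact: measurable_tcons.
- apply/measurable_EFinP; exact: measurable_Wgt.
- have := rintegrable_prod (T1 := RT) (m1 := lambda) wgt_ge0 (@Wgt_ge0 n) rintegrable_wgt IH.
  apply: eq_integrable => // -[x t] _ /=.
  by rewrite -Wgt_cons.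
Qed.

Lemma rintegrable_WgtZ n k : rintegrable (lebesgue_tuple R n) setT (fun t => k * Wgt t).
Proof. exact: (rintegrableZ measurableT k (rintegrable_Wgt n)). Qed.

(** Such functions are integrable together with their sections, so that Fubini's
theorem applies to them without further conditions. *)
Definition wdom n (u : T n -> R[i]) :=
  cmeas setT u /\ exists C, forall t, cabs (u t) <= C * Wgt t.

Lemma wdom_ge0 n (u : T n -> R[i]) C :
  (forall t, cabs (u t) <= C * Wgt t) -> 0 <= C.
Proof.
move=> uC; have t0 : T n := [tuple of nseq n 0].
have := le_trans (cabs_ge0 _) (uC t0).
by rewrite pmulr_lge0 ?Wgt_gt0.
Qed.

Lemma wdom_integrable n (u : T n -> R[i]) :
  wdom u -> cintegrable (lebesgue_tuple R n) setT u.
Proof.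
move=> [mu [C uC]]; apply: (dominated_cintegrable measurableT mu) => [|t _].
  exact: (rintegrable_WgtZ n C).
exact: uC.
Qed.

Lemma wdom_tcons n (u : T n.+1 -> R[i]) : wdom u ->
  exists C, [/\ cmeas setT (u \o (@tcons R n)), 0 <= C &
    forall x t, cabs (u (tcons (x, t))) <= C * wgt x * Wgt t].
Proof.
move=> [[mu1 mu2] [C uC]]; exists C; split; last 2 first.
- exact: wdom_ge0 uC.
- by move=> x t; rewrite -mulrA -Wgt_cons.
- split; [exact: (measurableT_tcons mu1)|exact: (measurableT_tcons mu2)].
Qed.

Lemma cint_pushforward n (u : T n.+1 -> R[i]) : wdom u ->
  cint (lebesgue_tuple R n.+1) setT u =
  cint (lambda \x lebesgue_tuple R n)%E setT (u \o (@tcons R n)).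
Proof.
move=> /[dup] /wdom_integrable[u1 u2] /wdom_tcons[C [mu C0 uC]].
have bi := rintegrable_wgtZ C.
have b0 (x : RT) : 0 <= C * wgt x by rewrite mulr_ge0 ?wgt_ge0.
have [i1 i2] := cintegrable_prod b0 (@Wgt_ge0 n) bi (rintegrable_Wgt n) mu uC.
apply: complexP => /=; rewrite /Rintegral /= /lebesgue_cons integral_pushforward//.
- exact: measurable_tcons.
- exact: (measurable_int _ u1).
- exact: measurable_tcons.
- exact: (measurable_int _ u2).
Qed.

Section Cons.
Variables (n : nat) (u : T n.+1 -> R[i]) (du : wdom u).

Lemma cint_tcons12 : cint (lebesgue_tuple R n.+1) setT u =
  cint lambda setT (fun x => cint (lebesgue_tuple R n) setT (fun t => u (tcons (x, t)))).
Proof.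
have [C [mu C0 uC]] := wdom_tcons du.
rewrite cint_pushforward// (cint_prod12 (a := fun x : RT => C * wgt x) _ (@Wgt_ge0 n) _ _ mu)//.
- by move=> x; rewrite mulr_ge0 ?wgt_ge0.
- exact: rintegrable_wgtZ.
- exact: rintegrable_Wgt.
Qed.

Lemma cint_tcons21 : cint (lebesgue_tuple R n.+1) setT u =
  cint (lebesgue_tuple R n) setT (fun t => cint lambda setT (fun x => u (tcons (x, t)))).
Proof.
have [C [mu C0 uC]] := wdom_tcons du.
rewrite cint_pushforward// (cint_prod21 (a := fun x : RT => C * wgt x) _ (@Wgt_ge0 n) _ _ mu)//.
- by move=> x; rewrite mulr_ge0 ?wgt_ge0.
- exact: rintegrable_wgtZ.
- exact: rintegrable_Wgt.
Qed.

Lemma wdom_section x : wdom (fun t => u (tcons (x, t))).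
Proof.
have [C [mu C0 uC]] := wdom_tcons du; split; last by exists (C * wgt x).
exact: (cmeas_pair2 (F := u \o (@tcons R n)) mu x).
Qed.

Lemma cmeas_section t : cmeas setT (fun x => u (tcons (x, t))).
Proof.
have [C [mu C0 uC]] := wdom_tcons du.
exact: (cmeas_pair1 (F := u \o (@tcons R n)) mu t).
Qed.

Lemma wdom_cint_section : wdom (fun t => cint lambda setT (fun x => u (tcons (x, t)))).
Proof.
have [C [mu C0 uC]] := wdom_tcons du.
have bi := rintegrable_wgtZ C.
have b0 (x : RT) : 0 <= C * wgt x by rewrite mulr_ge0 ?wgt_ge0.
split; first exact: (cmeas_fubini2 b0 (@Wgt_ge0 n) bi (rintegrable_Wgt n) mu uC).
exists (2 * (C * \int[lambda]_x wgt x)) => t.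
have := @le_cint _ _ _ lambda setT measurableT _ (fun x => (C * Wgt t) * wgt x) (cmeas_section t).
rewrite RintegralZl//; last exact: rintegrable_wgt.
move=> H; apply: (le_trans (H _ _)).
- exact: rintegrable_wgtZ.
- by move=> x _; apply: (le_trans (uC x t)); rewrite mulrAC.
- by rewrite !mulrA mulrAC.
Qed.

Lemma cmeas_cint_section :
  cmeas setT (fun x => cint (lebesgue_tuple R n) setT (fun t => u (tcons (x, t)))).
Proof.
have [C [mu C0 uC]] := wdom_tcons du.
have bi := rintegrable_wgtZ C.
have b0 (x : RT) : 0 <= C * wgt x by rewrite mulr_ge0 ?wgt_ge0.
exact: (cmeas_fubini1 b0 (@Wgt_ge0 n) bi (rintegrable_Wgt n) mu uC).
Qed.

End Cons.

Definition upd n (t : T n) (j : 'I_n) (s : R) : T n :=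
  [tuple if i == j then s else tnth t i | i < n].

Lemma upd_tcons0 n x (t : T n) s : upd (tcons (x, t)) ord0 s = tcons (s, t).
Proof.
apply: eq_from_tnth => i; rewrite tnth_mktuple.
case: (unliftP ord0 i) => [j|] -> /=; last by [].
by rewrite !tnthS.
Qed.

Lemma upd_tconsS n x (t : T n) j s :
  upd (tcons (x, t)) (lift ord0 j) s = tcons (x, upd t j s).
Proof.
apply: eq_from_tnth => i; rewrite tnth_mktuple.
case: (unliftP ord0 i) => [k|] -> //=.
by rewrite (inj_eq lift_inj) !tnthS tnth_mktuple.
Qed.

(** By Fubini's theorem, integrals over the space are compared line by line, along
one coordinate axis: this is how one-variable arguments (contour shift,
integration by parts) enter. *)
Lemma cint_slice n (u v : T n -> R[i]) (j : 'I_n) : wdom u -> wdom v ->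
  (forall t, cint lambda setT (fun s => u (upd t j s)) =
             cint lambda setT (fun s => v (upd t j s))) ->
  cint (lebesgue_tuple R n) setT u = cint (lebesgue_tuple R n) setT v.
Proof.
elim: n u v j => [|n IH] u v j du dv uv; first by case: j uv.
case: (unliftP ord0 j) uv => [k|] -> uv.
- rewrite (cint_tcons12 du) (cint_tcons12 dv); apply: eq_cint => x _.
  apply: (IH _ _ k); [exact: wdom_section|exact: wdom_section|].
  move=> t; have := uv (tcons (x, t)).
  by under eq_fun do rewrite upd_tconsS; under [in X in _ = X -> _]eq_fun do rewrite upd_tconsS.
- rewrite (cint_tcons21 du) (cint_tcons21 dv); apply: eq_cint => t _.
  have := uv (tcons (0, t)).
  by under eq_fun do rewrite upd_tcons0; under [in X in _ = X -> _]eq_fun do rewrite upd_tcons0.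
Qed.

(** Tuples carry a sigma-algebra and no topology, so continuity is expressed
through sequences, coordinate by coordinate. *)
Definition tcvg n (t_ : nat -> T n) (t : T n) :=
  forall i, (fun k => tnth (t_ k) i : R) @ \oo --> (tnth t i : R).

Definition scont n (u : T n -> R[i]) :=
  forall t_ t, tcvg t_ t -> ccvg (fun k => u (t_ k)) (u t).

Lemma measurable_lattice n (G : n.-tuple int -> R) k :
  measurable_fun setT (fun t : T n => G [tuple Num.floor (k * tnth t i : R) | i < n]).
Proof.
move=> _ Y _; rewrite setTI.
rewrite (_ : _ @^-1` Y = \bigcup_q (if G q \in Y then
   \bigcap_(i in [set: 'I_n]) [set t : T n | (tnth q i)%:~R <= k * tnth t i :> R
       /\ k * tnth t i < (tnth q i + 1)%:~R :> R] else set0)).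
  apply: countable_bigcupT_measurable; first exact: countableP.
  move=> q; case: ifP => // _; apply: fin_bigcap_measurable => // i _.
  have mk : measurable_fun setT (fun t : T n => k * tnth t i : R).
    by apply: measurable_funM => //; exact: measurable_tnth.
  rewrite (_ : [set t | _] = (fun t : T n => k * tnth t i : R) @^-1`
            `[(tnth q i)%:~R, (tnth q i + 1)%:~R[).
    by rewrite -[X in measurable X]setTI; exact: mk.
  apply/seteqP; split=> t /=; rewrite in_itv /=; first by move=> [-> ->].
  by move=> /andP[].
apply/seteqP; split=> [t /= Gt|t [q _]].
  exists [tuple Num.floor (k * tnth t i : R) | i < n] => //.
  rewrite mem_set// => i _ /=; rewrite tnth_mktuple.
  by have /andP[] := floor_itv (k * tnth t i : R).
case: ifP => // /set_mem Gq H /=.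
rewrite (_ : [tuple _ | _ < _] = q)//.
apply: eq_from_tnth => i; rewrite tnth_mktuple; have /= [H1 H2] := H i I.
by apply: floor_def; rewrite H1.
Qed.

(** A continuous function is the pointwise limit of step functions on finer
and finer lattices. *)
Lemma scont_cmeas n (u : T n -> R[i]) : scont u -> cmeas setT u.
Proof.
move=> cu; pose q (k : nat) (t : T n) : n.-tuple int :=
  [tuple Num.floor (k.+1%:R * tnth t i : R) | i < n].
pose p (k : nat) (z : n.-tuple int) : T n := [tuple (tnth z i)%:~R / k.+1%:R : R | i < n].
apply: (@cmeas_ccvg _ _ _ setT (fun k t => u (p k (q k t)))).
  move=> k; split.
  - exact: (measurable_lattice (fun z => ReC (u (p k z)))).
  - exact: (measurable_lattice (fun z => ImC (u (p k z)))).
move=> t _; apply: cu => i.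
apply: (@cvg_dist_le _ _ (fun k => k.+1%:R^-1)); last exact: cvg_harmonic.
move=> k; rewrite !tnth_mktuple; set s := tnth t i : R.
have k0 : 0 < k.+1%:R :> R by rewrite ltr0n.
have /andP[f1 f2] := floor_itv (k.+1%:R * s).
have -> : (Num.floor (k.+1%:R * s))%:~R / k.+1%:R - s =
   ((Num.floor (k.+1%:R * s))%:~R - k.+1%:R * s) / k.+1%:R.
  by rewrite mulrBl mulrAC divff ?mul1r ?gt_eqF.
have kV : 0 <= k.+1%:R^-1 :> R by rewrite invr_ge0 ltW.
rewrite normrM (ger0_norm kV) ler_piMl//.
move: f2; rewrite intrD => f2.
by rewrite distrC ger0_norm ?subr_ge0//; lra.
Qed.

End TupleIntegral.

(** * Goursat's theorem *)

Section Truncation.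
Variable R : realType.
Local Notation lambda := (@lebesgue_measure R).

Lemma Rintegral_trunc (h : R -> R) : rintegrable lambda setT h ->
  (fun k : nat => \int[lambda]_(t in `[- k%:R, k%:R]) h t) @ \oo -->
  \int[lambda]_t h t.
Proof.
move=> hi; under eq_fun do rewrite Rintegral_mkcond.
have mh : measurable_fun setT h by apply/measurable_EFinP; case/integrableP: hi.
apply: (@rdominated _ _ _ lambda setT measurableT _ _ (fun t => `|h t|)) => //.
- move=> k; apply/(measurable_restrictT h) => //.
  exact: measurable_funTS.
- move=> t _; apply: cvg_near_cst; have [k tk] : exists k : nat, `|t| <= k%:R.
    by exists (Num.truncn `|t|).+1; rewrite ltW// truncnS_gt.
  exists k => // j /= kj; rewrite patchE mem_set//= in_itv /=.
  by rewrite -ler_norml (le_trans tk)// ler_nat.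
- exact: (integrable_norm hi).
- by move=> k t _; rewrite patchE; case: ifP => //; rewrite normr0.
Qed.

Lemma cint_trunc (f : R -> R[i]) : cintegrable lambda setT f ->
  ccvg (fun k : nat => cint lambda `[- k%:R, k%:R] f) (cint lambda setT f).
Proof. by move=> [f1 f2]; apply/ccvgP; split => /=; exact: Rintegral_trunc. Qed.

Lemma continuous_itv_rintegrable (f : R -> R) a b :
  continuous f -> rintegrable lambda `[a, b] f.
Proof.
move=> cf; apply: continuous_compact_integrable; first exact: segment_compact.
exact: continuous_subspaceT.
Qed.

Lemma Rintegral_itv_chasles (f : R -> R) a m b : continuous f -> a <= m -> m <= b ->
  \int[lambda]_(t in `[a, b]) f t =
  \int[lambda]_(t in `[a, m]) f t + \int[lambda]_(t in `[m, b]) f t.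
Proof.
move=> cf am mb.
have := @Rintegral_itvB R f (BLeft a) (BRight b) m (continuous_itv_rintegrable a b cf).
rewrite !bnd_simp => /(_ am mb) E.
rewrite -[X in _ = _ + X]Rintegral_itv_obnd_cbnd.
  by rewrite -E addrC subrK.
apply: integrableS (continuous_itv_rintegrable m b cf) => //.
exact: subset_itv_oc_cc.
Qed.

Lemma wgt_cvg0 : (fun k : nat => wgt (k%:R : R)) @ \oo --> (0 : R).
Proof.
apply: (@cvg_dist_le _ _ (fun k => k.+1%:R^-1 *+ 2)); last first.
  by rewrite -[X in _ --> X](mul0rn _ 2); apply: cvgMn; exact: cvg_harmonic.
move=> k; rewrite subr0 ger0_norm ?wgt_ge0// /wgt -[leRHS]mulr_natr.
rewrite -ler_pdivrMr// -invfM lef_pV2 ?posrE.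
- by rewrite -natr1; have := sqr_ge0 (k%:R - 1 : R); nra.
- by rewrite mulr_gt0// ltr_pwDl ?sqr_ge0.
- by rewrite ltr0n.
Qed.

Lemma FTC_itv (f F : R -> R) a b : a < b -> continuous f ->
  (forall t : R, is_derive t (1 : R) F (f t)) ->
  \int[lambda]_(t in `[a, b]) f t = F b - F a.
Proof.
move=> ab cf dF; have cF := is_derive_continuous dF.
rewrite /Rintegral (@continuous_FTC2 R f F)// -?EFinB//.
- exact: continuous_subspaceT.
- split.
  + by move=> x _; have := dF x; case.
  + by apply: cvg_at_right_filter; exact: cF.
  + by apply: cvg_at_left_filter; exact: cF.
- by move=> x _; rewrite derive1E; have := dF x; case.
Qed.

(** The boundary terms on [-k, k] tend to 0. *)
Lemma Rintegral_derive0 (G g : R -> R) (C : R) :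
  (forall t : R, is_derive t (1 : R) G (g t)) -> continuous g ->
  rintegrable lambda setT g -> (forall t, `|G t| <= C * wgt t) ->
  \int[lambda]_t g t = 0.
Proof.
move=> dG cg gi GC.
have c0 : (fun k : nat => \int[lambda]_(t in `[- k.+1%:R, k.+1%:R]) g t) @ \oo --> (0 : R).
  apply: (@cvg_dist_le _ _ (fun k => (C *+ 2) * wgt k.+1%:R)); last first.
    rewrite -[X in _ --> X](mulr0 (C *+ 2)); apply: cvgM; first exact: cvg_cst.
    by have := wgt_cvg0; rewrite -cvg_shiftS.
  move=> k; rewrite subr0 (FTC_itv _ cg dG) ?gtrN ?ltr0n//.
  rewrite (le_trans (ler_normB _ _))// mulr2n mulrDl lerD//.
  by rewrite (le_trans (GC _))// /wgt sqrrN.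
have := Rintegral_trunc gi; rewrite -cvg_shiftS => c1.
by rewrite -(cvg_lim _ c1)// (cvg_lim _ c0).
Qed.

End Truncation.

Section Goursat.
Variable R : realType.
Local Notation lambda := (@lebesgue_measure R).
Local Open Scope complex_scope.

Lemma cint_itv_chasles (f : R -> R[i]) a m b :
  continuous (fun t => ReC (f t)) -> continuous (fun t => ImC (f t)) ->
  a <= m -> m <= b ->
  cint lambda `[a, b] f = cint lambda `[a, m] f + cint lambda `[m, b] f.
Proof.
move=> c1 c2 am mb; apply: complexP; rewrite /=.
- exact: Rintegral_itv_chasles.
- exact: Rintegral_itv_chasles.
Qed.

Lemma fine_lebesgue_itv (a b : R) : a <= b -> fine (lambda `[a, b]) = b - a.
Proof.
by rewrite le_eqVlt lebesgue_measure_itv /= lte_fin => /predU1P[->|->]//; rewrite ltxx subrr.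
Qed.

Lemma cint_itv_cst (a b : R) (c : R[i]) : a <= b ->
  cint lambda `[a, b] (fun=> c) = (b - a)%:C * c.
Proof.
move=> ab; apply: complexP; rewrite /= Rintegral_cst//= fine_lebesgue_itv//; case: c => x y /=;
by rewrite mul0r ?subr0 ?addr0 mulrC.
Qed.

(** Holomorphy at a point, stated between real numbers since the norm of R[i] is
complex-valued. *)
Definition cderiv (h : R[i] -> R[i]) (z l : R[i]) :=
  forall e : R, 0 < e -> exists2 d : R, 0 < d &
    forall y, cabs (y - z) < d -> cabs (h y - h z - l * (y - z)) <= e * cabs (y - z).

Variable h : R[i] -> R[i].
Hypothesis dh : forall z, exists l, cderiv h z l.

Let pt (a c : R) : R[i] := a +i* c.

Lemma cderiv_line (p v : R[i]) :
  continuous (fun t : R => ReC (h (p + t%:C * v))) /\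
  continuous (fun t : R => ImC (h (p + t%:C * v))).
Proof.
have nearlt (t e : R) : 0 < e -> \forall t' \near t, `|t - t'| < e.
  by move=> e0; apply/nbhs_ballP; exists e.
have K (t e : R) : 0 < e -> \forall t' \near t,
    cabs (h (p + t'%:C * v) - h (p + t%:C * v)) <= e.
  move=> e0; have [l] := dh (p + t%:C * v).
  move=> /(_ _ ltr01)[d d0 H].
  pose M := 1 + cabs v; pose L := 1 + cabs l.
  have M0 : 0 < M by rewrite ltr_pwDl ?cabs_ge0.
  have L0 : 0 < L by rewrite ltr_pwDl ?cabs_ge0.
  near=> t'.
  have E : p + t'%:C * v - (p + t%:C * v) = (t' - t)%:C * v.
    by rewrite rmorphB /=; ring.
  have tt : cabs (p + t'%:C * v - (p + t%:C * v)) <= `|t - t'| * M.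
    by rewrite E cabsM cabs_real distrC ler_wpM2l// lerDr.
  have tt1 : `|t - t'| * M < d by rewrite -ltr_pdivlMr//; near: t'; apply: nearlt; rewrite divr_gt0.
  have tt2 : `|t - t'| * M * L <= e.
    rewrite -mulrA -ler_pdivlMr ?mulr_gt0//; apply: ltW; near: t'.
    by apply: nearlt; rewrite divr_gt0 ?mulr_gt0.
  have := H _ (le_lt_trans tt tt1); rewrite mul1r => Hy.
  rewrite -[X in cabs X](subrK (l * (p + t'%:C * v - (p + t%:C * v)))).
  rewrite (le_trans (cabsD _ _))// cabsM; apply: le_trans tt2.
  rewrite /L (mulrDr (`|t - t'| * M)) mulr1 lerD//; first exact: le_trans Hy tt.
  by rewrite mulrC ler_wpM2r ?cabs_ge0.
split=> t; apply/cvgrPdist_le => e /(K t); apply: filterS => t' tt'.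
- by rewrite -ReCB (le_trans (Re_le_cabs _))// cabs_distC.
- by rewrite -ImCB (le_trans (Im_le_cabs _))// cabs_distC.
Unshelve. all: by end_near.
Qed.

(** The integral of h along the boundary of the rectangle with sides r and s whose
lower left corner is a + i c, counterclockwise. *)
Definition rect (a c r s : R) : R[i] :=
  cint lambda `[a, a + r] (fun x => h (pt x c) - h (pt x (c + s))) +
  'i%C * cint lambda `[c, c + s] (fun y => h (pt (a + r) y) - h (pt a y)).

Lemma ptDh x c : pt x c = pt 0 c + x%:C * 1.
Proof. by apply: complexP; rewrite /= ?mulr1 ?mul0r ?mulr0 ?subr0 ?add0r ?addr0. Qed.

Lemma ptDv x c : pt x c = pt x 0 + c%:C * 'i%C.
Proof. by apply: complexP; rewrite /= ?mulr1 ?mul0r ?mulr0 ?subr0 ?add0r ?addr0. Qed.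

Lemma ptB a c a' c' : pt a c - pt a' c' = pt (a - a') (c - c').
Proof. by []. Qed.

Lemma cabs_pt a c : cabs (pt a c) <= `|a| + `|c|.
Proof. exact: cabs_le_ReIm. Qed.

Lemma cont_hline c : continuous (fun x => ReC (h (pt x c))) /\
  continuous (fun x => ImC (h (pt x c))).
Proof.
have [c1 c2] := cderiv_line (pt 0 c) 1; split.
- rewrite (_ : (fun _ => _) = (fun t : R => ReC (h (pt 0 c + t%:C * 1))))//.
  by apply/funext => x; rewrite -ptDh.
- rewrite (_ : (fun _ => _) = (fun t : R => ImC (h (pt 0 c + t%:C * 1))))//.
  by apply/funext => x; rewrite -ptDh.
Qed.

Lemma cont_vline x : continuous (fun c => ReC (h (pt x c))) /\
  continuous (fun c => ImC (h (pt x c))).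
Proof.
have [c1 c2] := cderiv_line (pt x 0) 'i%C; split.
- rewrite (_ : (fun _ => _) = (fun t : R => ReC (h (pt x 0 + t%:C * 'i%C))))//.
  by apply/funext => y; rewrite -ptDv.
- rewrite (_ : (fun _ => _) = (fun t : R => ImC (h (pt x 0 + t%:C * 'i%C))))//.
  by apply/funext => y; rewrite -ptDv.
Qed.

Let H x0 x1 y := cint lambda `[x0, x1] (fun x => h (pt x y)).
Let V y0 y1 x := cint lambda `[y0, y1] (fun y => h (pt x y)).

Lemma cintegrable_hline x0 x1 y : cintegrable lambda `[x0, x1] (fun x => h (pt x y)).
Proof. by have [c1 c2] := cont_hline y; split; exact: continuous_itv_rintegrable. Qed.

Lemma cintegrable_vline y0 y1 x : cintegrable lambda `[y0, y1] (fun y => h (pt x y)).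
Proof. by have [c1 c2] := cont_vline x; split; exact: continuous_itv_rintegrable. Qed.

Let rectE a c r s : rect a c r s =
  H a (a + r) c - H a (a + r) (c + s) + 'i%C * (V c (c + s) (a + r) - V c (c + s) a).
Proof.
by rewrite /rect !cintB//; first [exact: cintegrable_hline|exact: cintegrable_vline].
Qed.

Lemma rect_split a c r s : 0 <= r -> 0 <= s ->
  rect a c r s = rect a c (r / 2) (s / 2) + rect (a + r / 2) c (r / 2) (s / 2) +
    rect a (c + s / 2) (r / 2) (s / 2) + rect (a + r / 2) (c + s / 2) (r / 2) (s / 2).
Proof.
move=> r0 s0.
have HC y : H a (a + r) y = H a (a + r / 2) y + H (a + r / 2) (a + r) y.
  by apply: cint_itv_chasles; [apply: (cont_hline y).1|apply: (cont_hline y).2|lra|lra].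
have VC x : V c (c + s) x = V c (c + s / 2) x + V (c + s / 2) (c + s) x.
  by apply: cint_itv_chasles; [apply: (cont_vline x).1|apply: (cont_vline x).2|lra|lra].
have hr t : t / 2 + t / 2 = t :> R by lra.
rewrite !rectE -!addrA !hr HC (HC (c + s)) !VC; ring.
Qed.

Lemma rect_small a c r s (al ga d e : R) l : 0 <= r -> 0 <= s -> 0 <= e ->
  a <= al <= a + r -> c <= ga <= c + s -> r + s < d ->
  (forall y, cabs (y - pt al ga) < d ->
     cabs (h y - h (pt al ga) - l * (y - pt al ga)) <= e * cabs (y - pt al ga)) ->
  cabs (rect a c r s) <= 4 * e * (r + s) ^+ 2.
Proof.
move=> r0 s0 e0 aal cga rsd Hd.
pose g y := h y - h (pt al ga) - l * (y - pt al ga).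
have gb x y : a <= x <= a + r -> c <= y <= c + s -> cabs (g (pt x y)) <= e * (r + s).
  move=> ax cy; have D : cabs (pt x y - pt al ga) <= r + s.
    rewrite ptB (le_trans (cabs_pt _ _))// lerD// ler_norml; lra.
  by apply: (le_trans (Hd _ _)); [exact: le_lt_trans rsd|rewrite ler_wpM2l].
have E y1 y2 : h y1 - h y2 = (g y1 - g y2) + l * (y1 - y2) by rewrite /g; ring.
(* h is compared with its affine approximation at the point (al, ga), for which
   the horizontal sides contribute - i r s l and the vertical ones i r s l; part
   bounds the remainder on a pair of opposite sides *)
have part (f : R -> R[i]) (t0 t : R) (k : R[i]) : 0 <= t ->
    cintegrable lambda `[t0, t0 + t] f ->
    (forall x, t0 <= x <= t0 + t -> cabs (f x - k) <= 2 * e * (r + s)) ->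
    cabs (cint lambda `[t0, t0 + t] f - t%:C * k) <= 4 * e * (r + s) * t.
  move=> t_ge0 fi fk.
  have kt : cint lambda `[t0, t0 + t] (fun=> k) = t%:C * k.
    by rewrite cint_itv_cst ?lerDl// addrC addKr.
  have ki : cintegrable lambda `[t0, t0 + t] (fun=> k).
    by split; apply: continuous_itv_rintegrable => ?; exact: cvg_cst.
  rewrite -kt -cintB//; apply: (@le_trans _ _ (2 * \int[lambda]_(x in `[t0, t0 + t]) (2 * e * (r + s)))).
    apply: le_cint => //.
    - case: fi => f1 f2; apply: cmeasB; last exact: cmeas_cst.
      by split; apply/measurable_EFinP; [case/integrableP: f1|case/integrableP: f2].
    - by apply: continuous_itv_rintegrable => ?; exact: cvg_cst.
  rewrite Rintegral_cst//= fine_lebesgue_itv ?lerDl//; lra.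
have P1 := part (fun x => h (pt x c) - h (pt x (c + s))) a r (l * pt 0 (- s)) r0 _ _.
have P2 := part (fun y => h (pt (a + r) y) - h (pt a y)) c s (l * pt r 0) s0 _ _.
have -> : rect a c r s =
  (cint lambda `[a, a + r] (fun x => h (pt x c) - h (pt x (c + s))) - r%:C * (l * pt 0 (- s)))
 + 'i%C * (cint lambda `[c, c + s] (fun y => h (pt (a + r) y) - h (pt a y)) - s%:C * (l * pt r 0)).
  rewrite /rect.
  have -> : 'i%C * (cint lambda `[c, c + s] (fun y => h (pt (a + r) y) - h (pt a y))
    - s%:C * (l * pt r 0)) = 'i%C * cint lambda `[c, c + s] (fun y => h (pt (a + r) y) - h (pt a y))
     + r%:C * (l * pt 0 (- s)).
    have K : 'i%C * s%:C * pt r 0 = - (r%:C * pt 0 (- s)) by apply: complexP => /=; ring.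
    move: (cint _ _ _) => X.
    have -> : 'i%C * (X - s%:C * (l * pt r 0)) = 'i%C * X - l * ('i%C * s%:C * pt r 0) by ring.
    rewrite K; ring.
  ring.
apply: (le_trans (cabsD _ _)); rewrite cabsM cabs_i mul1r.
have -> : 4 * e * (r + s) ^+ 2 = 4 * e * (r + s) * r + 4 * e * (r + s) * s by ring.
apply: lerD; [apply: P1|apply: P2].
- by apply: cintegrableB => //; exact: cintegrable_hline.
- move=> x ax; rewrite E ptB subrr (_ : c - (c + s) = - s); last by ring.
  rewrite addrK (le_trans (cabsB _ _))// mulrAC mulr_natl mulr2n mulrDl.
  have cs : c <= c <= c + s by lra.
  have cs' : c <= c + s <= c + s by lra.
  by have := gb x c ax cs; have := gb x (c + s) ax cs'; lra.
- by apply: cintegrableB => //; exact: cintegrable_vline.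
- move=> y cy; rewrite E ptB subrr (_ : a + r - a = r); last by ring.
  rewrite addrK (le_trans (cabsB _ _))//.
  have cs : a <= a <= a + r by lra.
  have cs' : a <= a + r <= a + r by lra.
  by have := gb a y cs cy; have := gb (a + r) y cs' cy; lra.
Qed.

Lemma nested_itv (a_ : nat -> R) (r : R) : 0 <= r ->
  (forall k, a_ k <= a_ k.+1 <= a_ k + r / 2 ^+ k / 2) ->
  exists al, forall k, a_ k <= al <= a_ k + r / 2 ^+ k.
Proof.
move=> r0 step.
have ndk k j : a_ k <= a_ (k + j)%N.
  elim: j => [|j IH]; first by rewrite addn0.
  by rewrite addnS (le_trans IH)//; case/andP: (step (k + j)%N).
have nib k j : a_ (k + j)%N + r / 2 ^+ (k + j)%N <= a_ k + r / 2 ^+ k.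
  elim: j => [|j IH]; first by rewrite addn0.
  apply: le_trans IH; rewrite addnS exprSr invfM mulrA.
  by have /andP[_] := step (k + j)%N; lra.
have rk k : 0 <= r / 2 ^+ k by rewrite divr_ge0// exprn_ge0.
have ub j k : a_ j <= a_ k + r / 2 ^+ k.
  have [jk|/ltnW kj] := leqP j k.
    by rewrite -(subnKC jk) (le_trans (ndk j (k - j)%N))// lerDl.
  by rewrite -(subnKC kj) (le_trans _ (nib k (j - k)%N))// lerDl.
have hs : has_sup (range a_).
  split; first by exists (a_ 0%N), 0%N.
  by exists (a_ 0%N + r / 2 ^+ 0) => _ [j _ <-].
exists (sup (range a_)) => k; apply/andP; split.
  by apply: ub_le_sup; [case: hs|exists k].
by apply: ge_sup; [case: hs|move=> _ [j _ <-]].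
Qed.

(** Goursat's argument: one of the four quarters of a rectangle carries at
least a quarter of the boundary integral; the quarters chosen one after the
other shrink to a point, near which the function is almost affine. *)
Lemma goursat a c r s : 0 <= r -> 0 <= s -> rect a c r s = 0.
Proof.
move=> r0 s0; apply: cabs_eq0; apply/eqP; rewrite eq_le cabs_ge0 andbT.
set K := cabs _; suff Ke e : 0 < e -> K <= 4 * e * (r + s) ^+ 2.
  apply/ler_addgt0Pl => e e0; rewrite addr0.
  have X0 : 0 < 4 * ((r + s) ^+ 2 + 1) by have := sqr_ge0 (r + s); lra.
  have := Ke (e / (4 * ((r + s) ^+ 2 + 1))); rewrite divr_gt0// => /(_ isT) /le_trans; apply.
  rewrite mulrAC mulrCA ler_piMr ?(ltW e0)// ler_pdivrMr// mul1r.
  by have := sqr_ge0 (r + s); lra.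
move=> e0.
pose rk k : R := r / 2 ^+ k; pose sk k : R := s / 2 ^+ k.
have rk0 k : 0 <= rk k by rewrite divr_ge0// exprn_ge0.
have sk0 k : 0 <= sk k by rewrite divr_ge0// exprn_ge0.
have rkS k : rk k.+1 = rk k / 2 by rewrite /rk exprSr invfM mulrA.
have skS k : sk k.+1 = sk k / 2 by rewrite /sk exprSr invfM mulrA.
have next (pk : (R * R) * nat) : exists q : R * R,
    [/\ pk.1.1 <= q.1 <= pk.1.1 + rk pk.2 / 2, pk.1.2 <= q.2 <= pk.1.2 + sk pk.2 / 2 &
     cabs (rect pk.1.1 pk.1.2 (rk pk.2) (sk pk.2)) <=
       4 * cabs (rect q.1 q.2 (rk pk.2.+1) (sk pk.2.+1))].
  case: pk => -[x y] k /=; rewrite rkS skS.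
  have x1 : x <= x <= x + rk k / 2 by have := rk0 k; lra.
  have x2 : x <= x + rk k / 2 <= x + rk k / 2 by have := rk0 k; lra.
  have y1 : y <= y <= y + sk k / 2 by have := sk0 k; lra.
  have y2 : y <= y + sk k / 2 <= y + sk k / 2 by have := sk0 k; lra.
  apply: contrapT => nq.
  have lt u v : x <= u <= x + rk k / 2 -> y <= v <= y + sk k / 2 ->
     4 * cabs (rect u v (rk k / 2) (sk k / 2)) < cabs (rect x y (rk k) (sk k)).
    by move=> q1 q2; rewrite ltNge; apply/negP => q3; apply: nq; exists (u, v).
  move: (lt _ _ x1 y1) (lt _ _ x2 y1) (lt _ _ x1 y2) (lt _ _ x2 y2).
  rewrite [in cabs (rect x y (rk k) (sk k))]rect_split//.
  set q1 := rect _ _ _ _; set q2 := rect _ _ _ _; set q3 := rect _ _ _ _; set q4 := rect _ _ _ _.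
  have arith (A B C c1 c2 c3 c4 : R) : 4 * c1 < A -> 4 * c2 < A -> 4 * c3 < A ->
      4 * c4 < A -> A <= B + c4 -> B <= C + c3 -> C <= c1 + c2 -> False by lra.
  move=> A1 A2 A3 A4.
  exact: (arith _ _ _ _ _ _ _ A1 A2 A3 A4 (cabsD _ _) (cabsD _ _) (cabsD _ _)).
have [f fP] := choice next.
(* lower left corners of the nested rectangles *)
pose sq := fix sq k := if k is k'.+1 then f (sq k', k') else (a, c).
have [al alP] : exists al, forall k, (sq k).1 <= al <= (sq k).1 + rk k.
  by apply: nested_itv => // k; have [] := fP (sq k, k).
have [ga gaP] : exists ga, forall k, (sq k).2 <= ga <= (sq k).2 + sk k.
  by apply: nested_itv => // k; have [] := fP (sq k, k).
have KP k : K <= 4 ^+ k * cabs (rect (sq k).1 (sq k).2 (rk k) (sk k)).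
  elim: k => [|k IH]; first by rewrite expr0 mul1r /rk /sk expr0 !divr1.
  apply: (le_trans IH); rewrite exprSr -mulrA ler_wpM2l ?exprn_ge0//.
  by have [] := fP (sq k, k).
have [l lP] := dh (pt al ga); have [d d0 dP] := lP _ e0.
have [k kd] : exists k, rk k + sk k < d.
  have : (fun k => geometric (r + s) (2^-1 : R) k) @ \oo --> (0 : R).
    by apply: cvg_geometric; rewrite ger0_norm; lra.
  move=> /cvgrPdist_lt/(_ _ d0)[k _ /(_ k (leqnn k))].
  rewrite sub0r normrN /geometric /= => /(le_lt_trans (ler_norm _)) H0.
  by exists k; rewrite /rk /sk -mulrDl -exprVn.
have := rect_small (rk0 k) (sk0 k) (ltW e0) (alP k) (gaP k) kd dP.
move=> /(ler_wpM2l (exprn_ge0 k (ler0n R 4))) /(le_trans (KP k)) /le_trans; apply.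
rewrite /rk /sk -mulrDl.
have E : ((r + s) / 2 ^+ k) ^+ 2 * 4 ^+ k = (r + s) ^+ 2.
  rewrite expr_div_n -exprM mulnC exprM (_ : 2 ^+ 2 = 4 :> R); last by ring.
  by rewrite divfK// expf_neq0// pnatr_eq0.
rewrite -E le_eqVlt; apply/orP; left; apply/eqP; ring.
Qed.

End Goursat.

(** * Horizontal lines, affine substitutions, the Poisson kernel *)

Section Strip.
Variable R : realType.
Local Notation lambda := (@lebesgue_measure R).
Local Open Scope complex_scope.

Lemma continuous_cmeas (f : R -> R[i]) :
  continuous (fun t => ReC (f t)) -> continuous (fun t => ImC (f t)) ->
  cmeas [set: measurableTypeR R] f.
Proof. by move=> c1 c2; split; exact: continuous_measurable_fun. Qed.

Lemma wgt_dominated (f : R -> R[i]) (C : R) : cmeas [set: measurableTypeR R] f ->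
  (forall t, cabs (f t) <= C * wgt t) -> cintegrable lambda setT f.
Proof.
move=> mf fC.
exact: (dominated_cintegrable measurableT mf
  (@rintegrable_wgtZ R C) (fun t _ => fC t)).
Qed.

(** The vertical sides of long rectangles contribute nothing in the limit, so
Goursat's theorem leaves the two horizontal lines. *)
Lemma cint_strip (h : R[i] -> R[i]) (C c d : R) :
  (forall z, exists l, cderiv h z l) -> c <= d ->
  (forall x y, c <= y <= d -> cabs (h (x +i* y)) <= C * wgt x) ->
  cint lambda setT (fun x => h (x +i* c)) = cint lambda setT (fun x => h (x +i* d)).
Proof.
move=> dh cd hC.
have hi y : c <= y <= d -> cintegrable lambda setT (fun x => h (x +i* y)).
  move=> cyd; apply: (@wgt_dominated _ C); last by move=> t; exact: hC.
  by have [c1 c2] := cont_hline dh y; exact: continuous_cmeas.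
have ci : c <= c <= d by rewrite lexx.
have di : c <= d <= d by rewrite lexx andbT.
apply/eqP; rewrite -subr_eq0 -cintB//; [|exact: hi|exact: hi].
apply/eqP; have ui := cintegrableB measurableT (hi _ ci) (hi _ di).
apply: (ccvg_unique (cint_trunc ui)).
apply: (@ccvg_le _ _ _ (fun k => (4 * C * (d - c)) * wgt k%:R)); last first.
  by rewrite -[X in _ --> X](mulr0 (4 * C * (d - c))); apply: cvgM; [exact: cvg_cst|exact: wgt_cvg0].
move=> k; rewrite subr0.
have := goursat dh (- k%:R) c (r := k%:R + k%:R) (s := d - c).
rewrite subr_ge0 addr_ge0// => /(_ isT cd); rewrite /rect.
rewrite addKr (addrC c (d - c)) subrK => /eqP; rewrite addr_eq0 => /eqP ->.
rewrite cabsN cabsM cabs_i mul1r.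
have -> : 4 * C * (d - c) * wgt k%:R = 2 * \int[lambda]_(y in `[c, d]) (2 * C * wgt k%:R).
  rewrite Rintegral_cst; last exact: measurable_itv.
  by rewrite fine_lebesgue_itv//; ring.
apply: le_cint => //.
- have [c1 c2] := cont_vline dh k%:R; have [c3 c4] := cont_vline dh (- k%:R).
  by apply: cmeasB; split; apply: measurable_funTS; exact: continuous_measurable_fun.
- by apply: continuous_itv_rintegrable => ?; exact: cvg_cst.
- move=> y; rewrite /= in_itv /= => cyd; apply: (le_trans (cabsB _ _)).
  have := hC k%:R y cyd; have := hC (- k%:R) y cyd.
  by rewrite [wgt (- _)]/wgt sqrrN -/(wgt _); lra.
Qed.

End Strip.

Section Affine.
Variable R : realType.
Local Notation RT := (measurableTypeR R).
Local Notation lambda := (@lebesgue_measure R).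
Variables (y e : R).
Hypothesis e0 : 0 < e.

Let phi : RT -> RT := fun s => y + e * s.

Let mphi : measurable_fun setT phi.
Proof. by apply: measurable_funD => //; apply: measurable_funM. Qed.

Let push : {measure set RT -> \bar R}.
Proof. by unshelve refine (pushforward lambda phi : measure _ _); exact: mphi. Defined.

(** Lebesgue measure is determined by its values on half-open intervals. *)
Lemma lebesgue_measure_affine (A : set RT) : measurable A ->
  lambda A = mscale (NngNum (ltW e0)) push A.
Proof.
move=> mA; apply: lebesgue_measure_unique => // _ [[a b] _ <-] /=.
rewrite /mscale /= /pushforward (_ : phi @^-1` `]a, b] = `](a - y) / e, (b - y) / e]%classic).
  rewrite !lebesgue_measure_itv /= !lte_fin ltr_pM2r ?invr_gt0// ltrD2r.
  case: ifP => _; rewrite ?mule0// -!EFinD -EFinM; congr EFin.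
  by rewrite -mulrBl mulrC divfK ?gt_eqF//; ring.
apply/seteqP; split=> s /=; rewrite !in_itv/= /phi ltr_pdivrMr// ler_pdivlMr// => /andP[s1 s2];
  apply/andP; split; lra.
Qed.

Lemma ge0_integral_affine (f : RT -> \bar R) : measurable_fun setT f ->
  (forall x, 0 <= f x)%E ->
  (\int[lambda]_x f x = e%:E * \int[lambda]_s f (phi s))%E.
Proof.
move=> mf f0; rewrite (eq_measure_integral (mscale (NngNum (ltW e0)) push)); last first.
  by move=> A mA _; exact: lebesgue_measure_affine.
rewrite ge0_integral_mscale//=.
by rewrite ge0_integral_pushforward// => x; rewrite inE.
Qed.

Lemma Rintegral_affine (f : RT -> R) : rintegrable lambda setT f ->
  \int[lambda]_x f x = e * \int[lambda]_s f (phi s).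
Proof.
move=> fi; have mf : measurable_fun setT (EFin \o f) by case/integrableP: fi.
have i1 := integrable_fin_num measurableT (integrable_funepos measurableT fi).
have i2 := integrable_fin_num measurableT (integrable_funeneg measurableT fi).
have E1 := ge0_integral_affine (measurable_funepos mf) (fun x => funepos_ge0 _ _).
have E2 := ge0_integral_affine (measurable_funeneg mf) (fun x => funeneg_ge0 _ _).
have eF : e%:E \is a fin_num by [].
have fin (X : \bar R) : (e%:E * X)%E \is a fin_num -> X \is a fin_num.
  by case: X => //=; rewrite ?gt0_muley ?gt0_muleNy ?lte_fin.
rewrite /Rintegral integralE [X in _ = _ * fine X]integralE E1 E2.
move: i1 i2; rewrite E1 E2 => /fin j1 /fin j2.
rewrite -muleBr ?fin_num_adde_defr// fineM//; last by rewrite fin_numB j1.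
by congr (_ * fine (_ - _)); apply: eq_integral => x _; rewrite ?funeposE ?funenegE.
Qed.

Lemma cint_affine (f : RT -> R[i]) : cintegrable lambda setT f ->
  cint lambda setT f = (e%:C * cint lambda setT (fun s => f (phi s)))%C.
Proof.
move=> [f1 f2]; apply: complexP; rewrite /= mul0r ?subr0 ?addr0.
- exact: (Rintegral_affine f1).
- exact: (Rintegral_affine f2).
Qed.

End Affine.

Section AbelKernel.
Variable R : realType.
Local Notation RT := (measurableTypeR R).
Local Notation lambda := (@lebesgue_measure R).
Local Open Scope complex_scope.

Lemma expRN_le (t : R) : 0 <= t -> expR (- t) <= 4 * wgt t.
Proof.
move=> t0; rewrite /wgt expRN -[leRHS]invrK lef_pV2 ?posrE ?expR_gt0//; last first.
  by rewrite invr_gt0 mulr_gt0// wgt_gt0.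
rewrite invfM invrK; have -> : t = t / 2 + t / 2 by lra.
rewrite expRD; have := expR_ge1Dx (t / 2); nra.
Qed.

Lemma expRN_abs_le (e x : R) : 0 < e <= 1 -> expR (- (e * `|x|)) <= 4 / e ^+ 2 * wgt x.
Proof.
move=> /andP[e0 e1]; have ex : 0 <= e * `|x| by rewrite mulr_ge0 ?(ltW e0).
apply: (le_trans (expRN_le ex)); rewrite -mulrA ler_wpM2l//.
rewrite /wgt exprMn real_normK ?num_real// -invfM lef_pV2 ?posrE; last 2 first.
- by rewrite ltr_pwDl// mulr_ge0 ?sqr_ge0.
- by rewrite mulr_gt0 ?exprn_gt0// ltr_pwDl ?sqr_ge0.
- rewrite mulrDr mulr1 lerD2r; nra.
Qed.

(** Meant for the kernel exp (- e |x|): a separate antiderivative is available on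
each side of 0, and both vanish at infinity. *)
Lemma Rintegral_two_sided (f fp fm Fp Fm : R -> R) (C : R) :
  rintegrable lambda setT f -> continuous f -> continuous fp -> continuous fm ->
  (forall t, 0 <= t -> f t = fp t) -> (forall t, t <= 0 -> f t = fm t) ->
  (forall t : R, is_derive t (1 : R) Fp (fp t)) ->
  (forall t : R, is_derive t (1 : R) Fm (fm t)) ->
  (forall t, 0 <= t -> `|Fp t| <= C * wgt t) ->
  (forall t, t <= 0 -> `|Fm t| <= C * wgt t) ->
  \int[lambda]_t f t = Fm 0 - Fp 0.
Proof.
move=> fi cf cfp cfm ffp ffm dFp dFm FpC FmC.
have := Rintegral_trunc fi; rewrite -cvg_shiftS => c1.
have c0 : (fun k : nat => \int[lambda]_(t in `[- k.+1%:R, k.+1%:R]) f t) @ \oo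
    --> (Fm 0 - Fp 0).
  apply: (@cvg_dist_le _ _ (fun k => (C *+ 2) * wgt k.+1%:R)); last first.
    rewrite -[X in _ --> X](mulr0 (C *+ 2)); apply: cvgM; first exact: cvg_cst.
    by have := @wgt_cvg0 R; rewrite -cvg_shiftS.
  move=> k; have k0 : 0 < k.+1%:R :> R by rewrite ltr0n.
  rewrite (@Rintegral_itv_chasles _ _ _ 0)// ?oppr_le0 ?(ltW k0)//.
  rewrite (@eq_Rintegral _ RT R lambda _ fm); last first.
    by move=> x; rewrite inE/= in_itv/= => /andP[_ x0]; rewrite ffm.
  rewrite (@eq_Rintegral _ RT R lambda `[0, k.+1%:R] fp); last first.
    by move=> x; rewrite inE/= in_itv/= => /andP[x0 _]; rewrite ffp.
  rewrite (FTC_itv _ cfm dFm) ?oppr_lt0// (FTC_itv k0 cfp dFp).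
  rewrite (_ : _ - _ = Fp k.+1%:R - Fm (- k.+1%:R)); last by ring.
  rewrite (le_trans (ler_normB _ _))// mulr2n mulrDl lerD ?FpC ?(ltW k0)//.
  by rewrite (le_trans (FmC _ _)) ?oppr_le0 ?(ltW k0)// /wgt sqrrN.
by rewrite -(cvg_lim _ c1)// (cvg_lim _ c0).
Qed.

Definition abel (e x : R) : R := expR (- (e * `|x|)).

Lemma continuous_abel e : continuous (abel e).
Proof.
move=> x; apply: continuous_comp; last exact: continuous_expR.
by apply: cvgN; apply: cvgM; [exact: cvg_cst|exact: cvg_norm].
Qed.

Lemma abel_ge0 e x : 0 <= abel e x. Proof. exact: expR_ge0. Qed.

Lemma abel_le1 e x : 0 <= e -> abel e x <= 1.
Proof. by move=> e0; rewrite -expR0 ler_expR oppr_le0 mulr_ge0. Qed.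

(** The Poisson kernel, from explicit antiderivatives on either side of 0. *)
Lemma cint_abel (e s : R) : 0 < e <= 1 ->
  cint lambda setT (fun x => (abel e x)%:C * cis (x * s)) =
  (2 * e / (e ^+ 2 + s ^+ 2))%:C.
Proof.
move=> e01; have /andP[e0 e1] := e01; set D := e ^+ 2 + s ^+ 2.
have D0 : 0 < D by rewrite ltr_pwDl ?exprn_gt0 ?sqr_ge0.
have bnd x (a c : R) : `|a| <= e + `|s| -> expR c = abel e x -> `|expR c * (a / D)| <= (e + `|s|) / D * (4 / e ^+ 2) * wgt x.
  move=> ae ->; rewrite normrM mulrC -mulrA ler_pM//.
    by rewrite normrM normfV (gtr0_norm D0) ler_wpM2r// invr_ge0 ltW.
  by rewrite ger0_norm ?expRN_abs_le// abel_ge0.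
have ap x : 0 <= x -> abel e x = expR (- e * x) by move=> x0; rewrite /abel ger0_norm// mulNr.
have am x : x <= 0 -> abel e x = expR (e * x) by move=> x0; rewrite /abel ler0_norm// mulrN opprK.
have tri (a b : R) : `|a| <= 1 -> `|b| <= 1 -> `|s * a + e * b| <= e + `|s|.
  move=> a1 b1; rewrite (le_trans (ler_normD _ _))// addrC !normrM (gtr0_norm e0) lerD//.
    by rewrite ler_piMr// ltW.
  by rewrite ler_piMr.
have s1 x : `|sin (x * s)| <= 1 by rewrite ler_norml sin_geN1 sin_le1.
have c1 x : `|cos (x * s)| <= 1 by rewrite ler_norml cos_geN1 cos_le1.
have s1N x : `|- sin (x * s)| <= 1 by rewrite normrN.
have c1N x : `|- cos (x * s)| <= 1 by rewrite normrN.
have cs : continuous (fun x : R => sin (x * s)).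
  by move=> x; apply: continuous_comp; [apply: cvgM; [exact: cvg_id|exact: cvg_cst]|exact: continuous_sin].
have cc : continuous (fun x : R => cos (x * s)).
  by move=> x; apply: continuous_comp; [apply: cvgM; [exact: cvg_id|exact: cvg_cst]|exact: continuous_cos].
have ce (a : R) : continuous (fun x : R => expR (a * x)).
  by move=> x; apply: continuous_comp; [apply: cvgM; [exact: cvg_cst|exact: cvg_id]|exact: continuous_expR].
have cM (f g : R -> R) : continuous f -> continuous g -> continuous (fun x => f x * g x).
  by move=> cf cg x; apply: cvgM; [exact: cf|exact: cg].
have fi (f : R -> R) : continuous f -> (forall x, `|f x| <= 1) ->
    rintegrable lambda setT (fun x => abel e x * f x).
  move=> cf f1; apply: (rintegrable_le measurableT (h := fun x : RT => 4 / e ^+ 2 * wgt x)).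
  - apply: continuous_measurable_fun; apply: cM => //; exact: continuous_abel.
  - exact: rintegrable_wgtZ.
  - move=> x _; rewrite normrM (ger0_norm (abel_ge0 _ _)).
    by rewrite (le_trans _ (expRN_abs_le x e01))// ler_piMr// abel_ge0.
have ReE : (fun x => ReC ((abel e x)%:C * cis (x * s))) = (fun x => abel e x * cos (x * s)).
  by apply/funext => x; rewrite /= mul0r subr0.
have ImE : (fun x => ImC ((abel e x)%:C * cis (x * s))) = (fun x => abel e x * sin (x * s)).
  by apply/funext => x; rewrite /= mul0r addr0.
have kernel (f np nm : R -> R) : continuous f -> (forall x, `|f x| <= 1) ->
    (forall x, `|np x| <= e + `|s|) -> (forall x, `|nm x| <= e + `|s|) ->
    (forall x : R, is_derive x 1 (fun x => expR (- e * x) * (np x / D)) (expR (- e * x) * f x)) ->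
    (forall x : R, is_derive x 1 (fun x => expR (e * x) * (nm x / D)) (expR (e * x) * f x)) ->
    \int[lambda]_x (abel e x * f x) = (nm 0 - np 0) / D.
  move=> cf f1 np1 nm1 dp dm.
  rewrite (Rintegral_two_sided (C := (e + `|s|) / D * (4 / e ^+ 2)) (fi _ cf f1) _ _ _ _ _ dp dm).
  - by rewrite !mulr0 expR0 !mul1r mulrBl.
  - by apply: cM => //; exact: continuous_abel.
  - exact: cM.
  - exact: cM.
  - by move=> t t0; rewrite ap.
  - by move=> t t0; rewrite am.
  - by move=> t t0; apply: bnd; rewrite ?np1// -ap.
  - by move=> t t0; apply: bnd; rewrite ?nm1// -am.
have D0' : D != 0 by exact: lt0r_neq0.
apply: complexP; rewrite /= ?ReE ?ImE.
- etransitivity; [eapply (@kernel _ (fun x => s * sin (x * s) + e * (- cos (x * s)))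
      (fun x => s * sin (x * s) + e * cos (x * s)))|] => // [x|x|x|x|].
  + exact: tri.
  + exact: tri.
  + by apply: is_derive_eq; rewrite /GRing.scale /= /D; field.
  + by apply: is_derive_eq; rewrite /GRing.scale /= /D; field.
  + by rewrite !mul0r sin0 cos0; congr (_ / _); ring.
- etransitivity; [eapply (@kernel _ (fun x => s * (- cos (x * s)) + e * (- sin (x * s)))
      (fun x => s * (- cos (x * s)) + e * sin (x * s)))|] => // [x|x|x|x|].
  + exact: tri.
  + exact: tri.
  + by apply: is_derive_eq; rewrite /GRing.scale /= /D; field.
  + by apply: is_derive_eq; rewrite /GRing.scale /= /D; field.
  + by rewrite !mul0r sin0 cos0 oppr0 !mulr0 subrr mul0r.
Qed.

End AbelKernel.

(** * Fourier inversion *)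

Section Inversion1.
Variable R : realType.
Local Notation RT := (measurableTypeR R).
Local Notation lambda := (@lebesgue_measure R).
Local Open Scope complex_scope.

Lemma cint_wgt2 : cint lambda setT (fun s : RT => (2 * wgt s)%:C) = (2 * pi)%:C.
Proof.
apply: complexP; rewrite /=; last by rewrite Rintegral_cst// mul0r.
rewrite RintegralZl//; last exact: rintegrable_wgt.
by rewrite /Rintegral integral_wgt.
Qed.

Variables (u : RT -> R[i]) (C C' sg : R).
Hypothesis sg2 : sg ^+ 2 = 1.
Hypothesis cu : forall (x_ : nat -> R) (x : R), x_ @ \oo --> x -> ccvg (fun k => u (x_ k)) (u x).
Hypothesis mu : cmeas setT u.
Hypothesis uC : forall x, cabs (u x) <= C * wgt x.
Let uhat (x : RT) := cint lambda setT (fun xi : RT => u xi * cis (- (sg * (x * xi)))).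
Hypothesis uhatC : forall x, cabs (uhat x) <= C' * wgt x.

Let C0 : 0 <= C.
Proof. by have := le_trans (cabs_ge0 _) (uC 0); rewrite pmulr_lge0// wgt_gt0. Qed.

Let uxi (x : RT) : cmeas setT (fun xi : RT => u xi * cis (- (sg * (x * xi)))).
Proof.
apply: cmeasM => //; apply: cmeas_cis.
by apply: measurableT_comp => //; do 2 apply: measurable_funM => //.
Qed.

Let iuxi (x : RT) : cintegrable lambda setT (fun xi : RT => u xi * cis (- (sg * (x * xi)))).
Proof.
by apply: (@wgt_dominated _ _ C) => // xi; rewrite cabsM cabs_cis mulr1.
Qed.

Let A (e y : R) := cint lambda setT (fun x : RT =>
   (abel e x)%:C * cis (sg * (x * y)) * uhat x).

Let F (e y : R) (p : RT * RT) : R[i] :=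
  (abel e p.1)%:C * cis (sg * (p.1 * y)) * (u p.2 * cis (- (sg * (p.1 * p.2)))).

Let mF e y : cmeas setT (F e y).
Proof.
have m1 : measurable_fun setT (fun p : RT * RT => p.1) by exact: measurable_fst.
have m2 : measurable_fun setT (fun p : RT * RT => p.2) by exact: measurable_snd.
apply: cmeasM; apply: cmeasM.
- apply: cmeas_real; apply: measurableT_comp => //.
  by apply: continuous_measurable_fun; exact: continuous_abel.
- by apply: cmeas_cis; do 2 apply: measurable_funM => //.
- by case: mu => mu1 mu2; split; [exact: (measurableT_comp mu1)|exact: (measurableT_comp mu2)].
- apply: cmeas_cis; apply: measurableT_comp => //; apply: measurable_funM => //.
  exact: measurable_funM.
Qed.

Let FC e y : 0 < e <= 1 -> forall x xi, cabs (F e y (x, xi)) <= (4 / e ^+ 2 * wgt x) * (C * wgt xi).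
Proof.
move=> e01 x xi; rewrite /F !cabsM !cabs_cis !mulr1 cabs_real ger0_norm ?abel_ge0//.
by rewrite ler_pM ?abel_ge0 ?cabs_ge0// expRN_abs_le.
Qed.

Let ae0 e : 0 < e <= 1 -> forall x : RT, 0 <= 4 / e ^+ 2 * wgt x.
Proof. by move=> /andP[e0 _] x; rewrite mulr_ge0 ?wgt_ge0// divr_ge0// exprn_ge0// ltW. Qed.

Let Cw0 : forall x : RT, 0 <= C * wgt x.
Proof. by move=> x; rewrite mulr_ge0 ?wgt_ge0. Qed.

Let wi k : rintegrable lambda setT (fun x : RT => k * wgt x).
Proof. exact: rintegrable_wgtZ. Qed.

Let inner e y x : cint lambda setT (fun xi => F e y (x, xi)) =
  (abel e x)%:C * cis (sg * (x * y)) * uhat x.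
Proof. by rewrite -cintM//; exact: iuxi. Qed.

(** Inserting exp (- e |x|) makes the double integral absolutely convergent.
Integrating over the frequency x first leaves the Poisson kernel, which the
substitution xi = y + e s makes independent of e. *)
Lemma regularizedE e y : 0 < e <= 1 ->
  A e y = cint lambda setT (fun s : RT => u (y + e * s) * (2 * wgt s)%:C).
Proof.
move=> e01; have /andP[e0 e1] := e01.
transitivity (cint lambda setT (fun xi : RT => u xi * (2 * e / (e ^+ 2 + (y - xi) ^+ 2))%:C)).
  rewrite /A; transitivity (cint lambda setT (fun x => cint lambda setT (fun xi => F e y (x, xi)))).
    by apply: eq_cint => x _; rewrite inner.
  have i12 := cint_prod12 (ae0 e01) Cw0 (wi _) (wi C) (mF e y) (FC y e01).
  have i21 := cint_prod21 (ae0 e01) Cw0 (wi _) (wi C) (mF e y) (FC y e01).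
  rewrite -i12 i21; apply: eq_cint => xi _.
  transitivity (cint lambda setT (fun x : RT => u xi * ((abel e x)%:C * cis (x * (sg * (y - xi)))))).
    apply: eq_cint => x _; rewrite /F /=.
    have -> : x * (sg * (y - xi)) = sg * (x * y) + - (sg * (x * xi)) by ring.
    by rewrite cisD; ring.
  rewrite cintM//.
    by rewrite (cint_abel _ e01) exprMn sg2 mul1r.
  apply: (@wgt_dominated _ _ (4 / e ^+ 2)).
    apply: cmeasM; last by apply: cmeas_cis; apply: measurable_funM.
    by apply: cmeas_real; apply: continuous_measurable_fun; exact: continuous_abel.
  by move=> x; rewrite cabsM cabs_cis mulr1 cabs_real ger0_norm ?abel_ge0// expRN_abs_le.
have P0 (t : R) : 0 < e ^+ 2 + t ^+ 2 by rewrite ltr_pwDl ?exprn_gt0 ?sqr_ge0.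
have mP : measurable_fun setT (fun t : RT => 2 * e / (e ^+ 2 + (y - t) ^+ 2) : R).
  apply: continuous_measurable_fun => t.
  apply: cvgM; first exact: cvg_cst.
  apply: cvgV; first by rewrite gt_eqF.
  apply: cvgD; first exact: cvg_cst.
  rewrite expr2; under eq_fun do rewrite expr2.
  by apply: cvgM; apply: cvgB; (try exact: cvg_cst); exact: cvg_id.
rewrite (cint_affine y e0); last first.
  apply: (@wgt_dominated _ _ (C * (2 * e / e ^+ 2))).
    by apply: cmeasM => //; exact: cmeas_real.
  move=> t; rewrite cabsM cabs_real [leRHS]mulrAC ler_pM ?cabs_ge0//.
  rewrite ger0_norm; last by rewrite divr_ge0 ?mulr_ge0// ltW.
  rewrite ler_pM ?mulr_ge0 ?invr_ge0 ?(ltW e0) ?(ltW (P0 _))//.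
  by rewrite lef_pV2 ?posrE ?P0 ?exprn_gt0// lerDl sqr_ge0.
have mphi : measurable_fun setT (fun s : RT => (y + e * s : RT)).
  by apply: measurable_funD => //; apply: measurable_funM.
rewrite -cintM//.
  apply: eq_cint => s _; rewrite mulrCA -rmorphM/=; congr (_ * _%:C).
  rewrite opprD addNKr sqrrN exprMn /wgt.
  have -> : e ^+ 2 + e ^+ 2 * s ^+ 2 = e ^+ 2 * (1 + s ^+ 2) by ring.
  field; rewrite (gt_eqF e0) andbT.
  by rewrite gt_eqF// ltr_pwDl ?sqr_ge0.
apply: (@wgt_dominated _ _ (C * (2 / e))).
  apply: cmeasM.
    by case: mu => mu1 mu2; split; [exact: (measurableT_comp mu1)|exact: (measurableT_comp mu2)].
  by apply: cmeas_real; exact: (measurableT_comp mP mphi).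
move=> s; rewrite cabsM cabs_real -[leRHS]mulrA ler_pM ?cabs_ge0//.
  by rewrite (le_trans (uC _))// ler_piMr ?wgt_le1.
rewrite opprD addNKr sqrrN exprMn.
have -> : e ^+ 2 + e ^+ 2 * s ^+ 2 = e ^+ 2 * (1 + s ^+ 2) by ring.
have -> : 2 * e / (e ^+ 2 * (1 + s ^+ 2)) = 2 / e * wgt s.
  by rewrite /wgt; field; rewrite (gt_eqF e0) andbT gt_eqF// ltr_pwDl ?sqr_ge0.
by rewrite ger0_norm// mulr_ge0 ?wgt_ge0// divr_ge0// ltW.
Qed.

(** One-dimensional Fourier inversion, by Abel summation: the regularized
inverse transform is an average of u against a Poisson kernel that concentrates
at the point. *)
Lemma inversion1 (y : R) :
  cint lambda setT (fun x : RT => uhat x * cis (sg * (x * y))) = (2 * pi)%:C * u y.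
Proof.
pose ek (k : nat) : R := k.+1%:R^-1.
have ek01 k : 0 < ek k <= 1 by rewrite invr_gt0 ltr0n /= invf_le1 ?ltr0n// ler1n.
have ek0 : ek @ \oo --> (0 : R) by exact: cvg_harmonic.
have c1 : ccvg (fun k => A (ek k) y) (cint lambda setT (fun x : RT => uhat x * cis (sg * (x * y)))).
  apply: (@cdominated _ _ _ lambda setT measurableT _ _ (fun x : RT => C' * wgt x)).
  - move=> k; apply: (@cmeas_eq _ _ _ _ _ _ (inner (ek k) y)).
    exact: (cmeas_fubini1 (ae0 (ek01 k)) Cw0 (wi _) (wi C) (mF (ek k) y) (FC y (ek01 k))).
  - move=> x _; rewrite /= (_ : uhat x * _ = 1 * (cis (sg * (x * y)) * uhat x)); last first.
      by rewrite mul1r mulrC.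
    under eq_fun do rewrite -mulrA.
    apply: ccvgM; last exact: ccvg_cst.
    apply: ccvg_real; rewrite -[X in _ --> X]expR0.
    apply: continuous_cvg; first exact: continuous_expR.
    rewrite -oppr0 -(mul0r `|x|); apply: cvgN; apply: cvgM => //; exact: cvg_cst.
  - exact: wi.
  - move=> k x _; have /andP[e0 _] := ek01 k.
    rewrite !cabsM cabs_cis mulr1 cabs_real ger0_norm ?abel_ge0//.
    by rewrite (le_trans _ (uhatC x))// ler_piMl ?cabs_ge0// abel_le1 ?(ltW e0).
have c2 : ccvg (fun k => A (ek k) y) (cint lambda setT (fun s : RT => u y * (2 * wgt s)%:C)).
  under eq_fun do rewrite (regularizedE _ (ek01 _)).
  apply: (@cdominated _ _ _ lambda setT measurableT _ _ (fun x : RT => C * 2 * wgt x)).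
  - move=> k; apply: cmeasM.
      have mphi : measurable_fun setT (fun s : RT => (y + ek k * s : RT)).
        by apply: measurable_funD => //; apply: measurable_funM.
      by case: mu => mu1 mu2; split; [exact: (measurableT_comp mu1)|exact: (measurableT_comp mu2)].
    by apply: cmeas_real; apply: measurable_funM => //; exact: measurable_wgt.
  - move=> s _; apply: ccvgM; last exact: ccvg_cst.
    apply: cu; rewrite -[X in _ --> X]addr0 -(mul0r s).
    by apply: cvgD; [exact: cvg_cst|apply: cvgM; [exact: ek0|exact: cvg_cst]].
  - exact: wi.
  - move=> k s _; rewrite cabsM cabs_real (ger0_norm (mulr_ge0 _ (wgt_ge0 _)))// -mulrA.
    rewrite ler_pM ?cabs_ge0 ?mulr_ge0 ?wgt_ge0//.
    by rewrite (le_trans (uC _))// ler_piMr ?wgt_le1.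
rewrite (ccvg_unique c1 c2) cintM//; first by rewrite cint_wgt2 mulrC.
apply: (@wgt_dominated _ _ 2).
  by apply: cmeas_real; apply: measurable_funM => //; exact: measurable_wgt.
by move=> s; rewrite cabs_real ger0_norm// mulr_ge0 ?wgt_ge0.
Qed.

End Inversion1.

Section Inversion.
Variables (R : realType) (sg : R).
Hypothesis sg2 : sg ^+ 2 = 1.
Local Notation RT := (measurableTypeR R).
Local Notation T n := (n.-tuple RT).
Local Notation lambda := (@lebesgue_measure R).
Local Open Scope complex_scope.

Definition tdot n (x xi : T n) : R := \sum_(i < n) (tnth x i : R) * tnth xi i.

Lemma tdot_cons n x0 (x : T n) xi0 (xi : T n) :
  tdot (tcons (x0, x)) (tcons (xi0, xi)) = x0 * xi0 + tdot x xi.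
Proof.
rewrite /tdot big_ord_recl; congr (_ + _).
by apply: eq_bigr => i _; rewrite !tnthS.
Qed.

Lemma cvg_tdot n (x_ xi_ : nat -> T n) x xi : tcvg x_ x -> tcvg xi_ xi ->
  (fun k => tdot (x_ k) (xi_ k)) @ \oo --> tdot x xi.
Proof.
move=> cx cxi; rewrite /tdot; apply: cvg_big => [|i _].
  exact: add_continuous.
by apply: cvgM; [exact: cx|exact: cxi].
Qed.

Definition tfourier n (u : T n -> R[i]) (x : T n) :=
  cint (lebesgue_tuple R n) setT (fun xi => u xi * cis (- (sg * tdot x xi))).

Lemma tcvg_cst n (t : T n) : tcvg (fun=> t) t.
Proof. by move=> i; exact: cvg_cst. Qed.

Lemma scont_cis_tdot n (x : T n) k : scont (fun xi => cis (k * tdot x xi)).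
Proof.
move=> xi_ xi cxi; apply: ccvg_cis; apply: cvgM; first exact: cvg_cst.
exact: (cvg_tdot (@tcvg_cst _ x) cxi).
Qed.

Lemma wdom_cis n (u : T n -> R[i]) x : wdom u ->
  wdom (fun xi => u xi * cis (- (sg * tdot x xi))).
Proof.
move=> [mu [C uC]]; split; last by exists C => t; rewrite cabsM cabs_cis mulr1.
apply: cmeasM => //; apply: (@cmeas_eq _ _ _ _ (fun xi => cis ((- sg) * tdot x xi))).
  by move=> t; rewrite mulNr.
by apply: scont_cmeas; exact: scont_cis_tdot.
Qed.

Lemma scont_tfourier n (u : T n -> R[i]) : wdom u -> scont (tfourier u).
Proof.
move=> du x_ x cx; have [mu [C uC]] := du.
apply: (@cdominated _ _ _ _ setT measurableT _ _ (fun t => C * Wgt t)).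
- by move=> k; have [] := wdom_cis (x_ k) du.
- move=> t _; apply: ccvgM; first exact: ccvg_cst.
  apply: ccvg_cis; apply: cvgN; apply: cvgM; first exact: cvg_cst.
  exact: (cvg_tdot cx (@tcvg_cst _ t)).
- exact: (@rintegrable_WgtZ R n C).
- by move=> k t _; rewrite cabsM cabs_cis mulr1.
Qed.

Lemma tcvg_cons n (x_ : nat -> R) (x : R) (t_ : nat -> T n) t :
  x_ @ \oo --> x -> tcvg t_ t -> tcvg (fun k => tcons (x_ k, t_ k)) (tcons (x, t)).
Proof.
move=> cx ct i; case: (unliftP ord0 i) => [j|] -> //.
rewrite tnthS; under eq_fun do rewrite tnthS; exact: ct.
Qed.

Lemma scont0 (u : T 0 -> R[i]) : scont u.
Proof.
move=> t_ t _; rewrite (_ : (fun k => u (t_ k)) = (fun=> u t)); first exact: ccvg_cst.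
by apply/funext => k; rewrite (tuple0 t) (tuple0 (t_ k)).
Qed.

Lemma cint_lebesgue0 (u : T 0 -> R[i]) :
  cint (lebesgue_tuple R 0) setT u = u [tuple].
Proof.
have /scont_cmeas[m1 m2] := @scont0 u; apply: complexP; rewrite /= /Rintegral /= /lebesgue0.
- by rewrite integral_dirac// ?diracT ?mul1e//; exact/measurable_EFinP.
- by rewrite integral_dirac// ?diracT ?mul1e//; exact/measurable_EFinP.
Qed.

(** Induction on the dimension: the transform in n + 1 variables is the transform, in
the last n variables, of the partial transform v x0 in the first one.  The
induction hypothesis recovers v x0 at y', and one-dimensional inversion recovers
u from v. *)
Theorem fourier_inversion n (u : T n -> R[i]) (C C' : R) (y : T n) : scont u ->
  (forall t, cabs (u t) <= C * Wgt t) ->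
  (forall t, cabs (tfourier u t) <= C' * Wgt t) ->
  cint (lebesgue_tuple R n) setT (fun x => tfourier u x * cis (sg * tdot x y)) =
  (2 * pi)%:C ^+ n * u y.
Proof.
elim: n u C C' y => [|n IH] u C C' yy cu uC uhatC.
  rewrite cint_lebesgue0 /tfourier cint_lebesgue0 (tuple0 yy) /tdot !big_ord0.
  by rewrite mulr0 oppr0 cis0 !mulr1 expr0 mul1r.
have du : wdom u by split; [exact: scont_cmeas|exists C].
have [y0 [y' ->]] : exists y0 y', yy = tcons (y0, y').
  by case/tupleP: yy => y0 y'; exists y0, y'; exact: val_inj.
pose v (x0 : RT) (t : T n) : R[i] :=
  cint lambda setT (fun xi0 : RT => u (tcons (xi0, t)) * cis (- (sg * (x0 * xi0)))).
pose u0 (x0 : RT) (xi : T n.+1) := u xi * cis (- (sg * (x0 * tnth xi ord0))).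
have cu0 x0 : scont (u0 x0).
  move=> t_ t ct; apply: ccvgM; first exact: cu.
  apply: ccvg_cis; apply: cvgN; apply: cvgM; first exact: cvg_cst.
  by apply: cvgM; [exact: cvg_cst|exact: ct].
have du0 x0 : wdom (u0 x0).
  by split; [exact: scont_cmeas|exists C => t; rewrite cabsM cabs_cis mulr1].
have [cwd0 [Cv vC]] : (forall x0, cmeas setT (v x0)) /\ exists Cv, forall x0 t, cabs (v x0 t) <= Cv * Wgt t.
  split; first by move=> x0; have [] := wdom_cint_section (du0 x0).
  have [C1 [_ C10 uC1]] := wdom_tcons du.
  exists (2 * (C1 * \int[lambda]_x wgt x)) => x0 t.
  have := @le_cint _ _ _ lambda setT measurableT _ (fun x => (C1 * Wgt t) * wgt x) (cmeas_section (du0 x0) t).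
  rewrite RintegralZl//; last exact: rintegrable_wgt.
  move=> H; apply: (le_trans (H _ _)).
  - exact: rintegrable_wgtZ.
  - by move=> x _; rewrite /u0 cabsM cabs_cis mulr1 (le_trans (uC1 x t))// mulrAC.
  - by rewrite !mulrA mulrAC.
have cv x0 : scont (v x0).
  move=> t_ t ct.
  apply: (@cdominated _ _ _ lambda setT measurableT _ _ (fun xi0 : RT => C * wgt xi0)).
  - by move=> k; exact: (cmeas_section (du0 x0) (t_ k)).
  - move=> xi0 _; apply: ccvgM; last exact: ccvg_cst.
    by apply: cu; apply: tcvg_cons => //; exact: cvg_cst.
  - exact: rintegrable_wgtZ.
  - move=> k xi0 _; rewrite cabsM cabs_cis mulr1 (le_trans (uC _))// Wgt_cons mulrA.
    rewrite ler_piMr//.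
      by rewrite mulr_ge0 ?wgt_ge0//; exact: wdom_ge0 uC.
    exact: Wgt_le1.
have tfE x0 x' : tfourier u (tcons (x0, x')) = tfourier (v x0) x'.
  rewrite /tfourier (cint_tcons21 (wdom_cis (tcons (x0, x')) du)).
  apply: eq_cint => t _; rewrite /v mulrC -cintM//.
    apply: eq_cint => xi0 _; rewrite tdot_cons mulrDr opprD cisD; ring.
  apply: (@wgt_dominated _ _ (C * Wgt t)); first exact: (cmeas_section (du0 x0) t).
  by move=> s; rewrite cabsM cabs_cis mulr1 (le_trans (uC _))// Wgt_cons mulrA mulrAC.
pose y := tcons (y0, y').
have vhatC x0 x' : cabs (tfourier (v x0) x') <= (C' * wgt x0) * Wgt x'.
  by rewrite -tfE -mulrA -Wgt_cons.
have IHv x0 := IH (v x0) Cv (C' * wgt x0) y' (cv x0) (vC x0) (vhatC x0).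
have ctf : scont (fun x : T n.+1 => tfourier u x * cis (sg * tdot x y)).
  move=> x_ x cx; apply: ccvgM; first exact: (scont_tfourier du).
  apply: ccvg_cis; apply: cvgM; first exact: cvg_cst.
  exact: (cvg_tdot cx (@tcvg_cst _ y)).
have dtf : wdom (fun x : T n.+1 => tfourier u x * cis (sg * tdot x y)).
  by split; [exact: scont_cmeas|exists C' => t; rewrite cabsM cabs_cis mulr1].
have dvh x0 : wdom (fun x' => tfourier (v x0) x' * cis (sg * tdot x' y')).
  have dv : wdom (v x0) by split => //; exists Cv.
  split; last by exists (C' * wgt x0) => t; rewrite cabsM cabs_cis mulr1.
  apply: scont_cmeas => x_ x cx; apply: ccvgM; first exact: (scont_tfourier dv).
  apply: ccvg_cis; apply: cvgM; first exact: cvg_cst.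
  exact: (cvg_tdot cx (@tcvg_cst _ y')).
have pin : cabs ((2 * pi)%:C ^+ n : R[i]) = (2 * pi) ^+ n.
  by rewrite cabsX cabs_real ger0_norm// mulr_ge0// pi_ge0.
have pin0 : 0 < (2 * pi) ^+ n :> R by rewrite exprn_gt0// mulr_gt0// pi_gt0.
pose Cf := ((2 * pi) ^+ n)^-1 * (2 * (C' * \int[lebesgue_tuple R n]_t Wgt t)).
(* the decay of v x0 y' in x0, a hypothesis of the one-dimensional theorem, is
   read off the induction hypothesis *)
have vy' (x0 : RT) : cabs (v x0 y') <= Cf * wgt x0.
  rewrite /Cf -mulrA ler_pdivlMl// -pin -cabsM -IHv.
  apply: (le_trans (le_cint measurableT (dvh x0).1 (@rintegrable_WgtZ R n (C' * wgt x0)) _)).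
    by move=> t _; rewrite cabsM cabs_cis mulr1.
  rewrite RintegralZl//; last exact: rintegrable_Wgt.
  by rewrite -!mulrA (mulrC (wgt _)).
rewrite (cint_tcons12 dtf).
pose w (x0 : RT) := v x0 y' * cis (sg * (x0 * y0)).
have wE x0 : cint (lebesgue_tuple R n) setT (fun t => tfourier u (tcons (x0, t)) *
    cis (sg * tdot (tcons (x0, t)) y)) = (2 * pi)%:C ^+ n * w x0.
  rewrite /w mulrA -IHv mulrC -cintM//; last exact: wdom_integrable.
  by apply: eq_cint => x' _; rewrite tfE tdot_cons mulrDr cisD; ring.
have pi0 : (2 * pi)%:C ^+ n != 0 :> R[i].
  by apply/eqP => E; move: pin0; rewrite -pin E cabs0 ltxx.
have mw : cmeas setT w.
  apply: (@cmeas_eq _ _ _ _ (fun x0 => ((2 * pi)%:C ^+ n)^-1 * ((2 * pi)%:C ^+ n * w x0))).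
    by move=> x0; rewrite mulKf.
  apply: cmeasM; first exact: cmeas_cst.
  by apply: (@cmeas_eq _ _ _ _ _ _ wE); exact: (cmeas_cint_section dtf).
under eq_cint do rewrite wE.
rewrite cintM//; last first.
  by apply: (wgt_dominated mw (C := Cf)) => x0; rewrite /w cabsM cabs_cis mulr1.
have /= -> := @inversion1 R (fun xi0 : RT => u (tcons (xi0, y'))) C Cf sg sg2 _ _ _ vy' y0.
- by rewrite exprSr mulrA.
- by move=> x_ x cx; apply: cu; apply: tcvg_cons => //; exact: tcvg_cst.
- exact: (cmeas_section du y').
- move=> x; rewrite (le_trans (uC _))// Wgt_cons mulrA ler_piMr ?Wgt_le1//.
  by rewrite mulr_ge0 ?wgt_ge0//; exact: wdom_ge0 uC.
Qed.

End Inversion.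

(** * Entire functions and shifts of the domain of integration *)

Section ComplexDerivative.
Variable R : realType.
Local Open Scope complex_scope.
Implicit Types (h k : R[i] -> R[i]) (z l m : R[i]).

Lemma cderiv_ext h k z l : h =1 k -> cderiv h z l -> cderiv k z l.
Proof. by move=> /funext ->. Qed.

Lemma cderiv_cst z (c : R[i]) : cderiv (fun=> c) z 0.
Proof.
move=> e e0; exists 1 => // y _; rewrite subrr mul0r subrr cabs0.
by rewrite mulr_ge0 ?cabs_ge0// ltW.
Qed.

Lemma cderiv_id z : cderiv id z 1.
Proof.
move=> e e0; exists 1 => // y _; rewrite mul1r subrr cabs0.
by rewrite mulr_ge0 ?cabs_ge0// ltW.
Qed.

Lemma cderivM h k z l m : cderiv h z l -> cderiv k z m ->
  cderiv (fun y => h y * k y) z (l * k z + h z * m).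
Proof.
move=> dh dk e e0.
pose K := cabs (k z); pose L := cabs l; pose M := cabs m; pose H := cabs (h z).
have K0 : 0 <= K by exact: cabs_ge0. have L0 : 0 <= L by exact: cabs_ge0.
have M0 : 0 <= M by exact: cabs_ge0. have H0 : 0 <= H by exact: cabs_ge0.
pose S := K + M + H + 2; pose Q := (L + 1) * (M + 1).
have S0 : 0 < S by rewrite /S; lra.
have Q0 : 0 < Q by rewrite mulr_gt0//; lra.
pose e1 := Num.min 1 (e / (2 * S)).
have e10 : 0 < e1 by rewrite lt_min ltr01 divr_gt0// mulr_gt0.
have e1S : e1 * S <= e / 2.
  apply: (@le_trans _ _ (e / (2 * S) * S)).
    by rewrite ler_wpM2r ?(ltW S0)// ge_min lexx orbT.
  by rewrite invfM mulrA divfK// gt_eqF.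
have e11 : e1 <= 1 by rewrite ge_min lexx.
have [d1 d10 D1] := dh _ e10; have [d2 d20 D2] := dk _ e10.
pose d := Num.min (Num.min d1 d2) (Num.min 1 (e / (2 * Q))).
exists d; first by rewrite !lt_min d10 d20 ltr01 divr_gt0// mulr_gt0.
move=> y; rewrite !lt_min => /andP[/andP[yd1 yd2] /andP[y1 yQ]].
set a := cabs (y - z) in yd1 yd2 y1 yQ *.
have a0 : 0 <= a by exact: cabs_ge0.
have Dh := D1 _ yd1; have Dk := D2 _ yd2.
set rh := h y - h z - l * (y - z) in Dh; set rk := k y - k z - m * (y - z) in Dk.
have Hh : cabs rh <= e1 * a by exact: Dh.
have Hk : cabs rk <= e1 * a by exact: Dk.
have kk : cabs (k y - k z) <= (M + 1) * a.
  rewrite (_ : k y - k z = rk + m * (y - z)); last by rewrite /rk; ring.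
  rewrite (le_trans (cabsD _ _))// cabsM -/a -/M.
  by have := ler_wpM2r a0 e11; lra.
have ky : cabs (k y) <= K + M + 1.
  rewrite (_ : k y = k z + (k y - k z)); last by ring.
  rewrite (le_trans (cabsD _ _))// -/K.
  have M1 : 0 <= M + 1 by lra.
  by have := ler_wpM2l M1 (ltW y1); lra.
rewrite (_ : _ - _ = rh * k y + l * (y - z) * (k y - k z) + h z * rk); last first.
  by rewrite /rh /rk; ring.
have P1 : cabs (rh * k y) <= e1 * a * (K + M + 1).
  by rewrite cabsM ler_pM ?cabs_ge0.
have P2 : cabs (l * (y - z) * (k y - k z)) <= (L + 1) * (M + 1) * a * a.
  rewrite !cabsM -/L -/a (_ : (L + 1) * (M + 1) * a * a = (L + 1) * a * ((M + 1) * a)); last by ring.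
  by rewrite ler_pM ?mulr_ge0 ?cabs_ge0// ler_wpM2r// lerDl.
have P3 : cabs (h z * rk) <= H * (e1 * a) by rewrite cabsM ler_wpM2l.
have P2' : Q * a * a <= e / 2 * a.
  rewrite ler_wpM2r// mulrC -ler_pdivlMr// -mulrA -invfM.
  exact: ltW.
have e1Sa : e1 * S * a <= e / 2 * a by rewrite ler_wpM2r.
have P4 : e1 * a * (K + M + 1) + H * (e1 * a) <= e1 * S * a.
  have -> : e1 * S * a = e1 * a * (K + M + 1) + H * (e1 * a) + e1 * a by rewrite /S; ring.
  by rewrite lerDl mulr_ge0// ltW.
apply: (le_trans (cabsD _ _)).
have := cabsD (rh * k y) (l * (y - z) * (k y - k z)).
by rewrite -/Q in P2; lra.
Qed.

(** The increment of the exponential factors through the second-order remainder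
exp w - 1 - w at w = b (y - z). *)
Lemma cderiv_cexp (a b z : R[i]) :
  cderiv (fun y => cexp (a + b * y)) z (b * cexp (a + b * z)).
Proof.
move=> e e0; pose E := cabs (cexp (a + b * z)); pose B := cabs b.
have E0 : 0 <= E by exact: cabs_ge0.
have B0 : 0 <= B by exact: cabs_ge0.
pose X := E * 4 * (B + 1) ^+ 2 * expR 1 + 1.
have X0 : 0 < X.
  by rewrite ltr_pwDr// mulr_ge0 ?expR_ge0// mulr_ge0 ?exprn_ge0 ?addr_ge0// mulr_ge0.
exists (Num.min (B + 1)^-1 (e / X)).
  by rewrite lt_min invr_gt0 divr_gt0// andbT; lra.
move=> y; rewrite lt_min; set t := cabs (y - z) => /andP[tB tX].
have t0 : 0 <= t by exact: cabs_ge0.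
pose w := b * (y - z).
have -> : cexp (a + b * y) - cexp (a + b * z) - b * cexp (a + b * z) * (y - z) =
    cexp (a + b * z) * (cexp w - 1 - w).
  rewrite (_ : a + b * y = a + b * z + w); last by rewrite /w; ring.
  by rewrite cexpD /w; ring.
rewrite cabsM -/E.
have wt : cabs w <= (B + 1) * t by rewrite cabsM -/B -/t ler_wpM2r// lerDl.
have w1 : `|ReC w| <= 1.
  apply: (le_trans (Re_le_cabs _)); apply: (le_trans wt).
  by rewrite mulrC -ler_pdivlMr ?div1r ?(ltW tB)//; lra.
have h1 : cabs (cexp w - 1 - w) <= 4 * ((B + 1) * t) ^+ 2 * expR 1.
  apply: (le_trans (cexp_taylor2 w)); apply: ler_pM; rewrite ?expR_ge0 ?ler_expR//.
    by rewrite mulr_ge0 ?sqr_ge0.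
  by rewrite ler_wpM2l// ler_pXn2r ?nnegrE ?cabs_ge0// mulr_ge0//; lra.
apply: (le_trans (ler_wpM2l E0 h1)).
have -> : E * (4 * ((B + 1) * t) ^+ 2 * expR 1) = (X - 1) * t * t.
  by rewrite /X; ring.
rewrite ler_wpM2r//; apply: (@le_trans _ _ (X * t)); first by rewrite ler_wpM2r//; lra.
by rewrite mulrC -ler_pdivlMr// ltW.
Qed.

End ComplexDerivative.

Lemma nbhs_rowP (K : numFieldType) n (z : 'rV[K]_n) (P : set 'rV[K]_n) :
  nbhs z P <-> exists2 d : K, 0 < d &
    forall y : 'rV[K]_n, (forall i, `|y 0 i - z 0 i| < d) -> P y.
Proof.
split=> [/nbhs_ballP[d /= d0 dP]|[d d0 dP]].
  exists d => // y yz; apply: dP; split => // i j.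
  by rewrite ord1 /ball /= distrC; exact: yz.
apply/nbhs_ballP; exists d => // y [_ yz]; apply: dP => i.
by have := yz 0 i; rewrite /ball /= distrC.
Qed.

Section EntireSlices.
Variables (R : realType) (n : nat).
Local Open Scope complex_scope.
Local Notation C := (R[i]^o).
Implicit Types (f : 'rV[R[i]]_n -> C) (h : 'rV[R[i]]_n).

Lemma norm_row_le h : `|h| <= (\sum_i cabs (h 0 i))%:C.
Proof.
have [->|/eqP h0] := eqVneq h 0.
  rewrite normr0 -(rmorph0 (real_complex R)) lecR.
  by apply: sumr_ge0 => i _; exact: cabs_ge0.
have /mx_norm_neq0[[i j]] : mx_norm h != 0 by apply/eqP => /mx_norm_eq0.
rewrite /= ord1 => E; rewrite [`|h|]E /= cabsE lecR (bigD1 j)//= lerDl.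
by apply: sumr_ge0 => k _; exact: cabs_ge0.
Qed.

Let V : normedModType R[i] := 'rV[R[i]]_n.

Lemma nbhs_row (P : set V) (z : V) : nbhs z P ->
  exists2 d : R, 0 < d & forall y : 'rV[R[i]]_n, (forall i, cabs (y 0 i - z 0 i) < d) -> P y.
Proof.
move=> /(@nbhs_rowP R[i])[d d0 dP].
have [d' dE d'0] := gt0_real d0; move: dP; rewrite dE => dP; exists d' => // y yz.
by apply: dP => i; rewrite cabsE ltcR.
Qed.

Lemma row_nbhs (P : set V) (z : V) (d : R) : 0 < d ->
  (forall y : 'rV[R[i]]_n, (forall i, cabs (y 0 i - z 0 i) < d) -> P y) -> nbhs z P.
Proof.
move=> d0 dP; apply/(@nbhs_rowP R[i]); exists d%:C; rewrite ?ltcR// => y yz.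
by apply: dP => i; have := yz i; rewrite cabsE ltcR.
Qed.

(** The bridge from the differential, defined with the complex-valued norm, to
estimates between real numbers. *)
Lemma differentiable_eps f (z : V) : differentiable f z ->
  forall e : R, 0 < e -> exists2 d : R, 0 < d &
    forall h : 'rV[R[i]]_n, (forall i, cabs (h 0 i) < d) ->
    cabs (f (z + h) - f z - ('d f z : _ -> _) h) <= e * \sum_i cabs (h 0 i).
Proof.
move=> df e e0; have /eqaddoP H := diff_locally df.
have e0C : (0 : R[i]) < e%:C by rewrite ltcR.
have /nbhs_row[d d0 dP] := H _ e0C; exists d => // h hd.
have := dP h; rewrite !fctE /= => /(_ _).
have hd' i : cabs (h 0 i - (0 : 'rV[R[i]]_n) 0 i) < d by rewrite mxE subr0.
move=> /(_ hd'); rewrite opprD addrA addrC => H1.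
rewrite -lecR rmorphM/= -cabsE; apply: le_trans (ler_wpM2l (ltW e0C) (norm_row_le h)).
by move: H1; rewrite addrC [h + _]addrC.
Qed.

Lemma entire_cont f (z_ : nat -> 'rV[R[i]]_n) (z : 'rV[R[i]]_n) : entire f ->
  (forall i, ccvg (fun k => z_ k 0 i) (z 0 i)) -> ccvg (fun k => f (z_ k)) (f z).
Proof.
move=> ef cz; have cf := differentiable_continuous (ef z).
apply/cvgrPdist_le => e e0.
have [d d0 dP] : exists2 d : R, 0 < d & forall y : 'rV[R[i]]_n,
    (forall i, cabs (y 0 i - z 0 i) < d) -> cabs (f y - f z) < e.
  have /cvgrPdist_lt/(_ e%:C) := cf; rewrite ltcR => /(_ e0) /nbhs_row[d d0 dP].
  by exists d => // y /dP; rewrite /= cabsE ltcR cabs_distC.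
have : \forall k \near \oo, forall i : 'I_n, cabs (z_ k 0 i - z 0 i) < d.
  apply: filter_forall => i; have /cvgrPdist_lt/(_ _ d0) := cz i.
  by apply: filterS => k; rewrite sub0r normrN ger0_norm ?cabs_ge0.
by apply: filterS => k /dP /ltW; rewrite sub0r normrN ger0_norm ?cabs_ge0.
Qed.

Definition cupd (z : 'rV[R[i]]_n) (j : 'I_n) (w : R[i]) : 'rV[R[i]]_n :=
  \row_i (if i == j then w else z 0 i).

Lemma entire_slice f z j w : entire f ->
  exists l, cderiv (fun y => f (cupd z j y)) w l.
Proof.
move=> ef; exists (('d f (cupd z j w : V) : _ -> _) (delta_mx 0 j)) => e e0.
have [d d0 dP] := differentiable_eps (ef (cupd z j w)) e0.
exists d => // y yw; pose h := (y - w) *: delta_mx 0 j : 'rV[R[i]]_n.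
have hE i : h 0 i = if i == j then y - w else 0.
  by rewrite !mxE eqxx /=; case: eqP => _; rewrite ?mulr1 ?mulr0.
have -> : cupd z j y = cupd z j w + h.
  apply/rowP => i; rewrite [in RHS]mxE hE !mxE; case: eqP => _; first by rewrite addrC subrK.
  by rewrite addr0.
have := dP h; rewrite (bigD1 j)//= hE eqxx big1 ?addr0; last first.
  by move=> i /negbTE ij; rewrite hE ij cabs0.
have -> : ('d f (cupd z j w : V) : _ -> _) h = ('d f (cupd z j w : V) : _ -> _) (delta_mx 0 j) * (y - w).
  by rewrite /h linearZ /= mulrC.
by apply => i; rewrite hE; case: eqP => // _; rewrite cabs0.
Qed.

End EntireSlices.

Section Shift.
Variables (R : realType) (n : nat).
Local Open Scope complex_scope.
Local Notation RT := (measurableTypeR R).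
Local Notation T := (n.-tuple RT).
Local Notation lambda := (@lebesgue_measure R).

Definition cpt (t : T) (eta : 'rV[R]_n) : 'rV[R[i]]_n :=
  \row_i ((tnth t i : R) +i* eta 0 i).

Lemma Wgt_upd (t : T) j s : Wgt (upd t j s) <= wgt s.
Proof.
rewrite /Wgt (bigD1 j)//= tnth_mktuple eqxx ler_piMr ?wgt_ge0//.
set P := \prod_(i | _) _; suff /andP[] : 0 <= P <= 1 by [].
rewrite /P; elim/big_ind: _ => [|a b /andP[a0 a1] /andP[b0 b1]|i _].
- by rewrite ler01 lexx.
- by rewrite mulr_ge0// mulr_ile1.
- by rewrite wgt_ge0 wgt_le1.
Qed.

Variable H : 'rV[R[i]]_n -> R[i].
Hypothesis Hc : forall (z_ : nat -> 'rV[R[i]]_n) (z : 'rV[R[i]]_n),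
  (forall i, ccvg (fun k => z_ k 0 i) (z 0 i)) -> ccvg (fun k => H (z_ k)) (H z).
Hypothesis Hd : forall z j w, exists l, cderiv (fun y => H (cupd z j y)) w l.

Lemma scont_cpt eta : scont (fun t : T => H (cpt t eta)).
Proof.
move=> t_ t ct; apply: Hc => i; apply/ccvgP; rewrite !mxE; split => /=.
- by under eq_fun do rewrite mxE /=; exact: ct.
- by under eq_fun do rewrite mxE /=; exact: cvg_cst.
Qed.

Variables (eta : 'rV[R]_n) (C : R).
Hypothesis HC : forall (t : T) (theta : 'rV[R]_n), (forall i, `|theta 0 i| <= `|eta 0 i|) ->
  cabs (H (cpt t theta)) <= C * Wgt t.

(* the path from 0 to eta along the coordinate directions *)
Let etak (k : nat) : 'rV[R]_n := \row_i (if (i < k)%N then eta 0 i else 0).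

Let etak_le k i : `|etak k 0 i| <= `|eta 0 i|.
Proof. by rewrite mxE; case: ifP => // _; rewrite normr0. Qed.

Let dHk k : wdom (fun t : T => H (cpt t (etak k))).
Proof.
split; first by apply: scont_cmeas; exact: scont_cpt.
by exists C => t; apply: HC; exact: etak_le.
Qed.

Let C0 : 0 <= C.
Proof. by apply: (@wdom_ge0 _ _ (fun t : T => H (cpt t eta))) => t; exact: HC. Qed.

Let step (j : 'I_n) :
  cint (lebesgue_tuple R n) setT (fun t : T => H (cpt t (etak j))) =
  cint (lebesgue_tuple R n) setT (fun t : T => H (cpt t (etak j.+1))).
Proof.
apply: (cint_slice (j := j)) => // t.
pose z := cpt t (etak j); pose h w := H (cupd z j w).
have cptE s y : cupd z j (s +i* y) =
    cpt (upd t j s) (\row_i (if i == j then y else etak j 0 i)).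
  apply/rowP => i; rewrite !mxE tnth_mktuple; case: eqP => // _.
have E0 s : H (cpt (upd t j s) (etak j)) = h (s +i* 0).
  rewrite /h cptE; congr (H (cpt _ _)); apply/rowP => i; rewrite !mxE.
  by case: eqP => // ->; rewrite ltnn.
have E1 s : H (cpt (upd t j s) (etak j.+1)) = h (s +i* eta 0 j).
  rewrite /h cptE; congr (H (cpt _ _)); apply/rowP => i; rewrite !mxE ltnS leq_eqVlt.
  by rewrite (inj_eq val_inj); case: eqP => [->|].
under eq_fun do rewrite E0; under [in RHS]eq_fun do rewrite E1.
have bnd s y : `|y| <= `|eta 0 j| -> cabs (h (s +i* y)) <= C * wgt s.
  move=> yj; rewrite /h cptE (le_trans (HC _ _))//; last by rewrite ler_wpM2l// Wgt_upd.
  by move=> i; rewrite mxE; case: eqP => [->//|_]; exact: etak_le.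
have dh w : exists l, cderiv h w l by exact: Hd.
have [e0|e0] := leP 0 (eta 0 j).
- apply: (cint_strip dh e0 (C := C)) => s y /andP[y0 ye]; apply: bnd.
  by rewrite !ger0_norm.
- apply/esym/(cint_strip dh (ltW e0) (C := C)) => s y /andP[y0 ye]; apply: bnd.
  by rewrite !ler0_norm ?lerN2// ltW.
Qed.

(** Cauchy's theorem for decaying functions: the domain of integration may be
translated in an imaginary direction, one coordinate at a time. *)
Lemma cint_shift :
  cint (lebesgue_tuple R n) setT (fun t : T => H (cpt t 0)) =
  cint (lebesgue_tuple R n) setT (fun t : T => H (cpt t eta)).
Proof.
have {1}-> : 0 = etak 0 by apply/rowP => i; rewrite !mxE.
have -> : eta = etak n by apply/rowP => i; rewrite !mxE ltn_ord.
suff S k : (k <= n)%N ->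
    cint (lebesgue_tuple R n) setT (fun t : T => H (cpt t (etak 0))) =
    cint (lebesgue_tuple R n) setT (fun t : T => H (cpt t (etak k))) by exact: S.
elim: k => // k IH kn.
by rewrite IH ?(ltnW kn)// (step (Ordinal kn)).
Qed.

End Shift.

(** * The Fourier transform of a rapidly decreasing function *)

Section Transform.
Variables (R : realType) (n : nat).
Local Open Scope complex_scope.
Local Notation RT := (measurableTypeR R).
Local Notation T := (n.-tuple RT).
Local Notation rV := ('rV[R]_n).
Implicit Types (g : rV -> R[i]) (x y xi : rV) (t : T).

(** Integrals live on tuples, derivatives and weights on row vectors. *)
Definition rt t : rV := \row_i (tnth t i : R).

Definition transform g x : R[i] :=
  cint (lebesgue_tuple R n) setT (fun t => g (rt t) * cis (- dot x (rt t))).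

(** Powers of Wgt play the part of powers of 1 / (1 + |x|): each scale is dominated
by the other. *)
Definition rapid g := cmeas setT (fun t => g (rt t)) /\
  forall m, exists C, forall t, cabs (g (rt t)) <= C * Wgt t ^+ m.

(** The factor produced by differentiating exp (- i <x, xi>) in x_j. *)
Definition mulj (j : 'I_n) g : rV -> R[i] := fun xi => - 'i%C * (xi 0 j)%:C * g xi.

Lemma cmeas_rt_coord j : cmeas setT (fun t => (rt t 0 j)%:C).
Proof.
apply: cmeas_real; under eq_fun do rewrite mxE; exact: measurable_tnth.
Qed.

Lemma wgt_mul_le (s : R) : `|s| * wgt s <= 1 /\ s ^+ 2 * wgt s <= 1.
Proof.
have s0 : 0 < 1 + s ^+ 2 by rewrite ltr_pwDl ?sqr_ge0.
split; rewrite /wgt ler_pdivrMr// mul1r; last by lra.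
by rewrite -(real_normK (num_real s)); have := sqr_ge0 (`|s| - 1); have := normr_ge0 s; nra.
Qed.

Lemma Wgt_le_wgt t j : Wgt t <= wgt (tnth t j).
Proof.
have := Wgt_upd t j (tnth t j); rewrite (_ : upd t j _ = t)//.
by apply: eq_from_tnth => i; rewrite tnth_mktuple; case: eqP => [->|].
Qed.

Lemma coord_Wgt_le t j : `|rt t 0 j| * Wgt t <= 1.
Proof.
rewrite mxE; apply: le_trans (wgt_mul_le (tnth t j)).1.
by rewrite ler_wpM2l// Wgt_le_wgt.
Qed.

Lemma coord2_Wgt_le t j : rt t 0 j ^+ 2 * Wgt t <= 1.
Proof.
rewrite mxE; apply: le_trans (wgt_mul_le (tnth t j)).2.
by rewrite ler_wpM2l ?sqr_ge0// Wgt_le_wgt.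
Qed.

Lemma rapid_mulj j g : rapid g -> rapid (mulj j g).
Proof.
move=> [mg gC]; split.
  apply: cmeasM => //; apply: cmeasM; [exact: cmeas_cst|exact: cmeas_rt_coord].
move=> m; have [C Cm] := gC m.+1; exists C => t.
have C0 : 0 <= C * Wgt t ^+ m.
  by have := le_trans (cabs_ge0 _) (Cm t); rewrite exprSr mulrA pmulr_lge0 ?Wgt_gt0.
rewrite /mulj !cabsM cabsN cabs_i mul1r cabs_real.
apply: (@le_trans _ _ (`|rt t 0 j| * (C * Wgt t ^+ m.+1))); first by rewrite ler_wpM2l.
rewrite (_ : _ * _ = `|rt t 0 j| * Wgt t * (C * Wgt t ^+ m)); last by rewrite exprS; ring.
by rewrite ler_piMl// coord_Wgt_le.
Qed.

Lemma rapid_foldr s g : rapid g -> rapid (foldr mulj g s).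
Proof. by move=> rg; elim: s => //= j s; exact: rapid_mulj. Qed.

Lemma foldr_muljE s g xi :
  foldr mulj g s xi = (\prod_(j <- s) (- 'i%C * (xi 0 j)%:C)) * g xi.
Proof.
elim: s => [|j s IH] /=; first by rewrite big_nil mul1r.
by rewrite big_cons /mulj IH mulrA.
Qed.

Lemma measurable_dot x : measurable_fun setT (fun t => dot x (rt t)).
Proof.
rewrite /dot; apply: measurable_sum => j; apply: measurable_funM => //.
under eq_fun do rewrite mxE; exact: measurable_tnth.
Qed.

Lemma rapid_wdom g x : rapid g -> wdom (fun t => g (rt t) * cis (- dot x (rt t))).
Proof.
move=> [mg /(_ 1%N)[C gC]]; split.
  apply: cmeasM => //; apply: cmeas_cis; apply: measurableT_comp => //.
  exact: measurable_dot.
by exists C => t; rewrite cabsM cabs_cis mulr1 (le_trans (gC t)).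
Qed.

Lemma dotDl x y xi : dot (x + y) xi = dot x xi + dot y xi.
Proof. by rewrite /dot -big_split; apply: eq_bigr => i _; rewrite mxE mulrDl. Qed.

Lemma dotZl (a : R) x xi : dot (a *: x) xi = a * dot x xi.
Proof. by rewrite /dot mulr_sumr; apply: eq_bigr => i _; rewrite mxE mulrA. Qed.

Lemma dotNl x xi : dot (- x) xi = - dot x xi.
Proof. by rewrite /dot -sumrN; apply: eq_bigr => i _; rewrite mxE mulNr. Qed.

Lemma dot_delta j xi : dot (delta_mx 0 j) xi = xi 0 j.
Proof.
rewrite /dot (bigD1 j)//= mxE !eqxx mul1r big1 ?addr0// => i /negbTE ij.
by rewrite mxE ij andbF mul0r.
Qed.

Let I1 : R := \int[lebesgue_tuple R n]_t Wgt t.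

Lemma wgt_int_ge0 : 0 <= \int[lebesgue_tuple R n]_t Wgt t.
Proof. by apply: Rintegral_ge0 => t _; exact: Wgt_ge0. Qed.

Lemma le_cint_Wgt (u : T -> R[i]) (C : R) : cmeas setT u ->
  (forall t, cabs (u t) <= C * Wgt t) ->
  cabs (cint (lebesgue_tuple R n) setT u) <= 2 * I1 * C.
Proof.
move=> mu uC; have := le_cint measurableT mu
  (@rintegrable_WgtZ R n C) (fun t _ => uC t).
rewrite RintegralZl//; last exact: rintegrable_Wgt.
by rewrite (mulrC C) mulrA.
Qed.

(** Differentiation under the integral sign, with a quadratic remainder that is
uniform in x: cis (- h s) is expanded to second order, and s^2 is absorbed by
one power of Wgt. *)
Lemma transform_quad g j : rapid g -> exists K, forall x (h : R),
  cabs (transform g (x + h *: delta_mx 0 j) - transform g x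
        - h%:C * transform (mulj j g) x) <= K * h ^+ 2.
Proof.
move=> rg; have [mg /(_ 2%N)[C gC]] := rg.
exists (2 * I1 * (4 * C)) => x h.
have i1 := wdom_integrable (rapid_wdom (x + h *: delta_mx 0 j) rg).
have i2 := wdom_integrable (rapid_wdom x rg).
have i3 := wdom_integrable (rapid_wdom x (rapid_mulj j rg)).
rewrite /transform -cintB// -cintM// -cintB//; last 2 first.
- exact: cintegrableB.
- exact: cintegrableM.
rewrite -mulrA (_ : 4 * C * h ^+ 2 = (4 * h ^+ 2 * C)); last by ring.
apply: le_cint_Wgt.
  apply: cmeasB; first by apply: cmeasB; [exact: (rapid_wdom _ rg).1|exact: (rapid_wdom _ rg).1].
  apply: cmeasM; first exact: cmeas_cst.
  exact: (rapid_wdom _ (rapid_mulj j rg)).1.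
move=> t; set s := rt t 0 j.
have -> : g (rt t) * cis (- dot (x + h *: delta_mx 0 j) (rt t)) - g (rt t) * cis (- dot x (rt t))
   - h%:C * (mulj j g (rt t) * cis (- dot x (rt t))) =
   g (rt t) * cis (- dot x (rt t)) * (cis (- (h * s)) - 1 - 'i%C * (- (h * s))%:C).
  rewrite dotDl dotZl dot_delta opprD cisD /mulj -/s rmorphN rmorphM /=; ring.
rewrite !cabsM cabs_cis mulr1.
apply: (@le_trans _ _ (C * Wgt t ^+ 2 * (4 * (- (h * s)) ^+ 2))).
  by rewrite ler_pM ?cabs_ge0// cis_taylor2.
have -> : C * Wgt t ^+ 2 * (4 * (- (h * s)) ^+ 2) = 4 * h ^+ 2 * (C * Wgt t * (s ^+ 2 * Wgt t)) by ring.
have h0 : 0 <= 4 * h ^+ 2 by rewrite mulr_ge0// sqr_ge0.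
rewrite -[leRHS]mulrA; apply: ler_wpM2l => //; rewrite ler_piMr ?coord2_Wgt_le//.
have := le_trans (cabs_ge0 _) (gC t); rewrite expr2 mulrA pmulr_lge0//.
exact: Wgt_gt0.
Qed.

Lemma transform_lipschitz g : rapid g -> exists2 K, 0 <= K & forall x y,
  cabs (transform g x - transform g y) <= K * \sum_j `|x 0 j - y 0 j|.
Proof.
move=> rg; have [mg /(_ 2%N)[C gC]] := rg.
have C0 t : 0 <= C * Wgt t.
  have := le_trans (cabs_ge0 _) (gC t); rewrite expr2 mulrA pmulr_lge0//.
  exact: Wgt_gt0.
have C0' : 0 <= C by have := C0 [tuple of nseq n 0]; rewrite pmulr_lge0 ?Wgt_gt0.
exists (2 * I1 * (2 * C)) => [|x y].
  by rewrite !mulr_ge0// wgt_int_ge0.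
set D := \sum_j _.
have i1 := wdom_integrable (rapid_wdom x rg).
have i2 := wdom_integrable (rapid_wdom y rg).
rewrite /transform -cintB// -[leRHS]mulrA; apply: le_cint_Wgt.
  by apply: cmeasB; [exact: (rapid_wdom _ rg).1|exact: (rapid_wdom _ rg).1].
move=> t.
have -> : g (rt t) * cis (- dot x (rt t)) - g (rt t) * cis (- dot y (rt t)) =
  g (rt t) * cis (- dot y (rt t)) * (cis (- dot (x - y) (rt t)) - 1).
  rewrite mulrBr mulr1 -mulrA -cisD; congr (_ * cis _ - _).
  by rewrite dotDl dotNl; ring.
rewrite !cabsM cabs_cis mulr1.
apply: (@le_trans _ _ (C * Wgt t ^+ 2 * (2 * `|dot (x - y) (rt t)|))).
  by rewrite ler_pM ?cabs_ge0// (le_trans (cis_lipschitz _))// normrN.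
have dD : `|dot (x - y) (rt t)| * Wgt t <= D.
  rewrite /dot /D; apply: (@le_trans _ _ ((\sum_i `|(x - y) 0 i * rt t 0 i|) * Wgt t)).
    by rewrite ler_wpM2r ?Wgt_ge0// ler_norm_sum.
  rewrite mulr_suml; apply: ler_sum => i _; rewrite normrM !mxE -mulrA ler_piMr//.
  by have := coord_Wgt_le t i; rewrite mxE.
have -> : C * Wgt t ^+ 2 * (2 * `|dot (x - y) (rt t)|) =
  2 * (C * Wgt t) * (`|dot (x - y) (rt t)| * Wgt t) by ring.
have -> : 2 * C * D * Wgt t = 2 * (C * Wgt t) * D by ring.
by rewrite ler_wpM2l// mulr_ge0.
Qed.

Lemma quad_is_derive (h : rV -> R) x v (l K : R) :
  (forall t : R, `|h (x + t *: v) - h x - t * l| <= K * t ^+ 2) ->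
  is_derive x v h l.
Proof.
move=> hK.
have K0 : 0 <= K by have := le_trans (normr_ge0 _) (hK 1); rewrite expr1n mulr1.
have H : (fun t : R => t^-1 *: (h (t *: v + x) - h x)) @ 0^' --> l.
  apply/cvgrPdist_le => e e0; near=> t.
  have t0 : t != 0 by near: t; exact: nbhs_dnbhs_neq.
  have te : `|t| * (K + 1) <= e.
    rewrite -ler_pdivlMr ?ltr_pwDr//; apply: ltW; near: t.
    by apply: dnbhs0_lt; rewrite divr_gt0// ltr_pwDr.
  have -> : l - t^-1 *: (h (t *: v + x) - h x) = - (t^-1 * (h (x + t *: v) - h x - t * l)).
    by rewrite /GRing.scale /= (addrC x) [in RHS]mulrBr mulKf//; ring.
  rewrite normrN normrM normfV ler_pdivrMl ?normr_gt0//.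
  apply: (le_trans (hK t)); rewrite -(real_normK (num_real t)) expr2 mulrCA ler_wpM2l//.
  by apply: le_trans te; rewrite mulrC ler_wpM2l// lerDl.
apply: DeriveDef; first by apply/cvg_ex; exists l.
exact/cvg_lim.
Unshelve. all: by end_near. Qed.

Lemma transform_is_derive g j x : rapid g ->
  is_derive x (delta_mx 0 j : rV) (re (transform g)) (ReC (transform (mulj j g) x)) /\
  is_derive x (delta_mx 0 j : rV) (im (transform g)) (ImC (transform (mulj j g) x)).
Proof.
move=> /(transform_quad j)[K HK]; split; apply: (quad_is_derive (K := K)) => t.
- apply: le_trans (HK x t); apply: le_trans (Re_le_cabs _).
  by rewrite !ReCB ReCM /= mul0r subr0.
- apply: le_trans (HK x t); apply: le_trans (Im_le_cabs _).
  by rewrite !ImCB ImCM /= mul0r addr0.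
Qed.

Lemma partials_transform s g : rapid g ->
  partials s (re (transform g)) = re (transform (foldr mulj g s)) /\
  partials s (im (transform g)) = im (transform (foldr mulj g s)).
Proof.
move=> rg; elim: s => //= j s [-> ->]; split; apply/funext => x.
- by have [H _] := transform_is_derive j x (rapid_foldr s rg); rewrite derive_val.
- by have [_ H] := transform_is_derive j x (rapid_foldr s rg); rewrite derive_val.
Qed.

Lemma lipschitz_continuous (h : rV -> R) (K : R) : 0 <= K ->
  (forall x y, `|h x - h y| <= K * \sum_j `|x 0 j - y 0 j|) -> continuous h.
Proof.
move=> K0 hK x; have FF : Filter (nbhs x) by exact: nbhs_filter.
apply/(@cvgrPdist_le _ _ _ _ FF) => e e0.
pose d := e / (K * n%:R + 1).
have X0 : 0 < K * n%:R + 1 by rewrite ltr_pwDr// mulr_ge0.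
have d0 : 0 < d by rewrite divr_gt0.
apply/nbhs_rowP; exists d => // y yd; apply: (le_trans (hK x y)).
apply: (@le_trans _ _ (K * \sum_(j < n) d)).
  by rewrite ler_wpM2l//; apply: ler_sum => j _; rewrite distrC ltW.
rewrite sumr_const card_ord -[d *+ n]mulr_natr mulrCA /d mulrAC ler_pdivrMr//.
by rewrite ler_wpM2l ?(ltW e0)// lerDl.
Qed.

Lemma continuous_transform g : rapid g ->
  continuous (re (transform g)) /\ continuous (im (transform g)).
Proof.
move=> /transform_lipschitz[K K0 HK]; split; apply: (lipschitz_continuous K0) => x y.
- by apply: le_trans (HK x y); apply: le_trans (Re_le_cabs _); rewrite ReCB.
- by apply: le_trans (HK x y); apply: le_trans (Im_le_cabs _); rewrite ImCB.
Qed.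

Lemma smooth_transform g : rapid g ->
  smooth (re (transform g)) /\ smooth (im (transform g)).
Proof.
move=> rg; split=> s; have rs := rapid_foldr s rg.
- rewrite (partials_transform s rg).1; split; first by have [] := continuous_transform rs.
  by move=> j x; have [[] ] := transform_is_derive j x rs.
- rewrite (partials_transform s rg).2; split; first by have [] := continuous_transform rs.
  by move=> j x; have [_ []] := transform_is_derive j x rs.
Qed.

End Transform.

(** * The Paley-Wiener estimate *)

Section Forward.
Variables (R : realType) (n : nat).
Local Open Scope complex_scope.
Local Notation RT := (measurableTypeR R).
Local Notation T := (n.-tuple RT).
Local Notation rV := ('rV[R]_n).
Local Notation cV := ('rV[R[i]]_n).
Implicit Types (x xi eta theta : rV) (z : cV) (t : T).

Lemma cenorm_ge0 z : 0 <= cenorm z. Proof. exact: sqrtr_ge0. Qed.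

Lemma coord_cenorm z i : cabs (z 0 i) <= cenorm z.
Proof.
rewrite /cenorm -[leLHS]ger0_norm ?cabs_ge0// -sqrtr_sqr; apply: ler_wsqrtr.
by rewrite (bigD1 i)//= lerDl sumr_ge0// => k _; rewrite sqr_ge0.
Qed.

(** 2n powers of the norm control one power of Wgt: each of the n factors
1 + t_i^2 is at most (1 + |z|)^2. *)
Lemma cenorm1_Wgt t theta m : 1 <= (1 + cenorm (cpt t theta)) ^+ (2 * n * m) * Wgt t ^+ m.
Proof.
set c := cenorm _; have c0 : 0 <= c by exact: cenorm_ge0.
rewrite exprM -exprMn; apply: exprn_ege1; rewrite exprM /Wgt.
rewrite -[X in _ ^+ X]card_ord -prodr_const -big_split /=.
elim/big_ind: _ => // [a b a1 b1|i _]; first by rewrite -[1]mulr1 ler_pM.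
have ti : `|tnth t i| <= c.
  by apply: le_trans (coord_cenorm _ i); rewrite mxE; exact: (Re_le_cabs (_ +i* _)).
rewrite /wgt ler_pdivlMr ?ltr_pwDl ?sqr_ge0// mul1r.
by rewrite -(real_normK (num_real (tnth t i))); have := normr_ge0 (tnth t i : R); nra.
Qed.

Lemma Im_cpt t theta : map_mx (@complex.Im R) (cpt t theta) = theta.
Proof. by apply/rowP => i; rewrite !mxE. Qed.

Lemma cpt0 t : cpt t 0 = map_mx (real_complex R) (rt t).
Proof. by apply/rowP => i; rewrite !mxE. Qed.

Variables (f : cV -> R[i]^o) (ef : entire f).

Definition on_reals : rV -> R[i] := fun xi => f (map_mx (real_complex R) xi).

Variable (phi : rV -> R).
Hypothesis fC : forall m, exists P, forall z,
  cabs (f z) * (1 + cenorm z) ^+ m <= P * expR (phi (map_mx (@complex.Im R) z)).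

Lemma scont_entire_cpt eta : scont (fun t => f (cpt t eta)).
Proof. by apply: scont_cpt => z_ z; exact: entire_cont. Qed.

Lemma entire_cpt_le m P t theta :
  (forall z, cabs (f z) * (1 + cenorm z) ^+ (2 * n * m) <=
     P * expR (phi (map_mx (@complex.Im R) z))) ->
  cabs (f (cpt t theta)) <= P * expR (phi theta) * Wgt t ^+ m.
Proof.
move=> /(_ (cpt t theta)); rewrite Im_cpt => H.
apply: le_trans (ler_wpM2r (exprn_ge0 m (Wgt_ge0 t)) H).
by rewrite -mulrA ler_peMr ?cabs_ge0// cenorm1_Wgt.
Qed.

Lemma rapid_cpt eta : rapid (fun xi => f (\row_i (xi 0 i +i* eta 0 i))).
Proof.
have E t : \row_i (rt t 0 i +i* eta 0 i) = cpt t eta by apply/rowP => i; rewrite !mxE.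
split.
  by under eq_fun do rewrite E; apply: scont_cmeas; exact: scont_entire_cpt.
move=> m; have [P HP] := fC (2 * n * m); exists (P * expR (phi eta)) => t.
by rewrite E; exact: entire_cpt_le.
Qed.

Lemma rapid_on_reals : rapid on_reals.
Proof.
have [m1 m2] := rapid_cpt 0; split.
  by apply: cmeas_eq m1 => t; rewrite /on_reals; congr f; apply/rowP => i; rewrite !mxE.
move=> m; have [C HC] := m2 m; exists C => t; apply: le_trans (HC t).
by rewrite le_eqVlt; apply/orP; left; apply/eqP; congr (cabs (f _)); apply/rowP => i; rewrite !mxE.
Qed.

Definition cdot x z : R[i] := \sum_i (x 0 i)%:C * z 0 i.

Let H s x z : R[i] := (\prod_(j <- s) (- 'i%C * z 0 j)) * f z * cexp (- 'i%C * cdot x z).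

Lemma cdot_cupd x z j w :
  cdot x (cupd z j w) = (cdot x z - (x 0 j)%:C * z 0 j) + (x 0 j)%:C * w.
Proof.
rewrite /cdot (bigD1 j)//= [in RHS](bigD1 j)//= mxE eqxx.
rewrite (eq_bigr (fun i => (x 0 i)%:C * z 0 i)); first by ring.
by move=> i /negbTE ij; rewrite mxE ij.
Qed.

Lemma cderiv_exp_slice (k : R[i]) x z j w :
  exists l, cderiv (fun y => cexp (k * cdot x (cupd z j y))) w l.
Proof.
eexists; apply: cderiv_ext; last first.
  exact: (cderiv_cexp (k * (cdot x z - (x 0 j)%:C * z 0 j)) (k * (x 0 j)%:C)).
by move=> y; rewrite cdot_cupd; congr cexp; ring.
Qed.

Let Hc s x (z_ : nat -> cV) z :
  (forall i, ccvg (fun k => z_ k 0 i) (z 0 i)) -> ccvg (fun k => H s x (z_ k)) (H s x z).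
Proof.
move=> cz; apply: ccvgM; first apply: ccvgM.
- elim: s => [|j s IH]; first by under eq_fun do rewrite big_nil; rewrite big_nil; exact: ccvg_cst.
  under eq_fun do rewrite big_cons; rewrite big_cons; apply: ccvgM => //.
  by apply: ccvgM; [exact: ccvg_cst|exact: cz].
- exact: entire_cont.
- apply: ccvg_cexp; apply: ccvgM; first exact: ccvg_cst.
  rewrite /cdot; elim: (index_enum _) => [|j r IH].
    by under eq_fun do rewrite big_nil; rewrite big_nil; exact: ccvg_cst.
  under eq_fun do rewrite big_cons; rewrite big_cons; apply: ccvgD => //.
  by apply: ccvgM; [exact: ccvg_cst|exact: cz].
Qed.

Let Hd s x z j w : exists l, cderiv (fun y => H s x (cupd z j y)) w l.
Proof.
have [l1 d1] := entire_slice z j w ef.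
have [l2 d2] := cderiv_exp_slice (- 'i%C) x z j w.
have [l3 d3] : exists l, cderiv (fun y => \prod_(i <- s) (- 'i%C * cupd z j y 0 i)) w l.
  elim: s => [|i s [l IH]].
    by exists 0; under [in X in cderiv X]eq_fun do rewrite big_nil; exact: cderiv_cst.
  have [l' dl'] : exists l', cderiv (fun y => - 'i%C * cupd z j y 0 i) w l'.
    under [in X in cderiv X]eq_fun do rewrite mxE.
    case: (i == j); last by exists 0; exact: cderiv_cst.
    by eexists; exact: (cderivM (cderiv_cst _ _) (@cderiv_id _ w)).
  by under [in X in cderiv X]eq_fun do rewrite big_cons; eexists; exact: (cderivM dl' IH).
by eexists; exact: (cderivM (cderivM d3 d1) d2).
Qed.

Lemma prod_cenorm s z : cabs (\prod_(j <- s) (- 'i%C * z 0 j)) <= (1 + cenorm z) ^+ size s.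
Proof.
have c0 := cenorm_ge0 z.
elim: s => [|j s IH]; first by rewrite big_nil cabs1 expr0.
rewrite big_cons cabsM cabsM cabsN cabs_i mul1r exprS ler_pM ?cabs_ge0//.
by have := coord_cenorm z j; lra.
Qed.

Lemma Re_cdot_cpt x t theta : ReC (- 'i%C * cdot x (cpt t theta)) = dot x theta.
Proof.
rewrite /cdot mulr_sumr (raddf_sum (@complex.Re R : Rcomplex R -> R)) /dot.
by apply: eq_bigr => i _; rewrite mxE /=; ring.
Qed.

Lemma cdot_real x xi : cdot x (map_mx (real_complex R) xi) = (dot x xi)%:C.
Proof. by rewrite /dot rmorph_sum /=; apply: eq_bigr => i _; rewrite mxE rmorphM. Qed.

Let Hbound s x t theta P :
  (forall z, cabs (f z) * (1 + cenorm z) ^+ (size s + 2 * n) <=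
     P * expR (phi (map_mx (@complex.Im R) z))) ->
  cabs (H s x (cpt t theta)) <= P * expR (phi theta + dot x theta) * Wgt t.
Proof.
move=> /(_ (cpt t theta)); rewrite Im_cpt => HP.
rewrite /H cabsM cabs_cexp cabsM Re_cdot_cpt.
have -> : P * expR (phi theta + dot x theta) * Wgt t =
  P * expR (phi theta) * Wgt t * expR (dot x theta) by rewrite expRD; ring.
apply: ler_wpM2r; first exact: expR_ge0.
have c1 := cenorm1_Wgt t theta 1; rewrite muln1 expr1 in c1.
apply: le_trans (ler_wpM2r (Wgt_ge0 t) HP).
rewrite exprD; set A := _ ^+ size s; set B := _ ^+ (2 * n); set F := cabs (f _).
have -> : F * (A * B) * Wgt t = (F * A) * (B * Wgt t) by ring.
rewrite (mulrC _ F) -[leLHS]mulr1; apply: ler_pM => //; rewrite ?mulr_ge0 ?cabs_ge0//.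
by rewrite ler_wpM2l ?cabs_ge0// prod_cenorm.
Qed.

(* The weight may grow with the imaginary part, so the bounds needed on the way
to eta are available only if phi eta dominates phi on the box below eta. *)
Let Hshift s x eta P :
  (forall theta, (forall i, `|theta 0 i| <= `|eta 0 i|) -> phi theta <= phi eta) ->
  (forall z, cabs (f z) * (1 + cenorm z) ^+ (size s + 2 * n) <=
     P * expR (phi (map_mx (@complex.Im R) z))) ->
  cint (lebesgue_tuple R n) setT (fun t => H s x (cpt t 0)) =
  cint (lebesgue_tuple R n) setT (fun t => H s x (cpt t eta)).
Proof.
move=> phimono HP.
have P0 : 0 <= P.
  suff: 0 <= P * expR (phi (map_mx (@complex.Im R) (0 : cV))).
    by rewrite pmulr_lge0 ?expR_gt0.
  apply: le_trans (HP 0); rewrite mulr_ge0 ?cabs_ge0// exprn_ge0//.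
  by rewrite addr_ge0// cenorm_ge0.
have HC theta t : (forall i, `|theta 0 i| <= `|eta 0 i|) ->
    cabs (H s x (cpt t theta)) <= P * expR (phi eta + \sum_i `|x 0 i| * `|eta 0 i|) * Wgt t.
  move=> te; apply: (le_trans (Hbound _ _ _ HP)); rewrite ler_wpM2r ?Wgt_ge0//.
  rewrite ler_wpM2l// ler_expR lerD ?phimono// /dot; apply: ler_sum => i _.
  by rewrite (le_trans (ler_norm _))// normrM ler_wpM2l.
exact: (cint_shift (Hc s x) (Hd s x) (fun t theta => HC theta t)).
Qed.

(** The Paley-Wiener estimate: moving the integration to the parallel space
through i eta gains the exponential factor. *)
Lemma transform_bound s x eta P :
  (forall theta, (forall i, `|theta 0 i| <= `|eta 0 i|) -> phi theta <= phi eta) ->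
  (forall z, cabs (f z) * (1 + cenorm z) ^+ (size s + 2 * n) <=
     P * expR (phi (map_mx (@complex.Im R) z))) ->
  cabs (transform (foldr (@mulj R n) on_reals s) x) <=
    2 * (\int[lebesgue_tuple R n]_t Wgt t) * (P * expR (phi eta + dot x eta)).
Proof.
move=> phimono HP.
have -> : transform (foldr (@mulj R n) on_reals s) x =
    cint (lebesgue_tuple R n) setT (fun t => H s x (cpt t 0)).
  apply: eq_cint => t _; rewrite foldr_muljE /H cpt0 cdot_real; congr (_ * _ * _).
    by apply: eq_bigr => j _; rewrite [in RHS]mxE.
  by rewrite mulNr -mulrN -rmorphN /= cexp_im.
rewrite (Hshift x phimono HP).
apply: le_cint_Wgt; last by move=> t; exact: Hbound.
by apply: scont_cmeas; apply: scont_cpt; exact: Hc.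
Qed.

(** This carries the decay of the transform, and with it Fourier inversion, over
from the real space to its translate by i eta. *)
Lemma transform_shift x eta P :
  (forall theta, (forall i, `|theta 0 i| <= `|eta 0 i|) -> phi theta <= phi eta) ->
  (forall z, cabs (f z) * (1 + cenorm z) ^+ (2 * n) <=
     P * expR (phi (map_mx (@complex.Im R) z))) ->
  transform on_reals x = (expR (dot x eta))%:C *
    transform (fun xi => f (\row_i (xi 0 i +i* eta 0 i))) x.
Proof.
move=> phimono HP.
have -> : transform on_reals x =
    cint (lebesgue_tuple R n) setT (fun t => H [::] x (cpt t 0)).
  apply: eq_cint => t _; rewrite /H big_nil mul1r cpt0 cdot_real; congr (_ * _).
  by rewrite mulNr -mulrN -rmorphN /= cexp_im.
rewrite (Hshift (s := [::]) x phimono HP).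
rewrite -cintM//; last exact: (wdom_integrable (rapid_wdom x (rapid_cpt eta))).
apply: eq_cint => t _; rewrite /H big_nil mul1r [RHS]mulrCA; congr (f _ * _).
  by apply/rowP => i; rewrite !mxE.
rewrite /cexp Re_cdot_cpt; congr (_ * cis _).
rewrite /cdot mulr_sumr (raddf_sum (@complex.Im R : Rcomplex R -> R)) /dot -sumrN.
by apply: eq_bigr => i _; rewrite !mxE /=; ring.
Qed.

End Forward.

(** * The inverse transform on complex space *)

Lemma coord_le_mx_norm (K : numFieldType) n (x : 'rV[K]_n) j : `|x 0 j| <= `|x|.
Proof.
rewrite [`|x|]mx_normE -[leLHS]nngE num_le.
exact: (le_bigmax _ (fun i => `|x i.1 i.2|%:nng) (0, j)).
Qed.

Section Inverse.
Variables (R : realType) (n : nat).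
Local Open Scope complex_scope.
Local Notation RT := (measurableTypeR R).
Local Notation T := (n.-tuple RT).
Local Notation rV := ('rV[R]_n).
Local Notation cV := ('rV[R[i]]_n).
Implicit Types (x xi eta theta : rV) (z : cV) (t : T) (g : rV -> R[i]).

Definition row_tuple x : T := [tuple x 0 i | i < n].

Lemma rtK x : rt (row_tuple x) = x.
Proof. by apply/rowP => i; rewrite mxE tnth_mktuple. Qed.

Lemma dot_rt t t' : dot (rt t) (rt t') = tdot t t'.
Proof. by apply: eq_bigr => i _; rewrite !mxE. Qed.

(** The transform with the opposite sign, which is the inverse up to the factor
(2 pi)^n, on either side. *)
Definition itransform g x : R[i] :=
  cint (lebesgue_tuple R n) setT (fun t => g (rt t) * cis (dot x (rt t))).

Lemma transformK g (C C' : R) y : scont (fun t => g (rt t)) ->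
  (forall t, cabs (g (rt t)) <= C * Wgt t) ->
  (forall t, cabs (transform g (rt t)) <= C' * Wgt t) ->
  itransform (transform g) y = (2 * pi)%:C ^+ n * g y.
Proof.
move=> cg gC gC'; have E t : tfourier 1 (fun t => g (rt t)) t = transform g (rt t).
  by apply: eq_cint => t' _; rewrite dot_rt mul1r.
have := @fourier_inversion R 1 (expr1n _ _) n (fun t => g (rt t)) C C' (row_tuple y) cg gC.
rewrite rtK => <-; last by move=> t; rewrite E.
apply: eq_cint => t _; rewrite E mul1r -dot_rt rtK; congr (_ * cis _).
by apply: eq_bigr => i _; rewrite mulrC.
Qed.

Lemma itransformK g (C C' : R) y : scont (fun t => g (rt t)) ->
  (forall t, cabs (g (rt t)) <= C * Wgt t) ->
  (forall t, cabs (itransform g (rt t)) <= C' * Wgt t) ->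
  transform (itransform g) y = (2 * pi)%:C ^+ n * g y.
Proof.
move=> cg gC gC'; have E t : tfourier (-1) (fun t => g (rt t)) t = itransform g (rt t).
  by apply: eq_cint => t' _; rewrite dot_rt mulN1r opprK.
have s2 : (-1) ^+ 2 = 1 :> R by rewrite sqrrN expr1n.
have := @fourier_inversion R (-1) s2 n (fun t => g (rt t)) C C' (row_tuple y) cg gC.
rewrite rtK => <-; last by move=> t; rewrite E.
apply: eq_cint => t _; rewrite E mulN1r -dot_rt rtK; congr (_ * cis (- _)).
by apply: eq_bigr => i _; rewrite mulrC.
Qed.

(** The opposite transform at complex points; the factor (2 pi)^-n is left out. *)
Definition inverse g z : R[i] :=
  cint (lebesgue_tuple R n) setT (fun t => g (rt t) * cexp ('i%C * cdot (rt t) z)).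

Definition l1norm x : R := \sum_i `|x 0 i|.

Lemma l1norm_ge0 x : 0 <= l1norm x. Proof. exact: sumr_ge0. Qed.

Lemma expR_l1norm_Wgt t : expR (- l1norm (rt t)) <= 4 ^+ n * Wgt t.
Proof.
rewrite /l1norm -sumrN expR_sum /Wgt -[X in 4 ^+ X]card_ord -prodr_const -big_split /=.
apply: ler_prod => i _; rewrite expR_ge0 mxE /=.
by apply: (le_trans (expRN_le _)); rewrite // /wgt real_normK ?num_real.
Qed.

Lemma cabs_cdot x z : cabs (cdot x z) <= l1norm x * \sum_i cabs (z 0 i).
Proof.
rewrite /cdot /l1norm mulr_suml.
apply: (@le_trans _ _ (\sum_i `|x 0 i| * cabs (z 0 i))).
  elim: (index_enum _) => [|i r IH]; first by rewrite !big_nil cabs0.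
  by rewrite !big_cons (le_trans (cabsD _ _))// lerD// cabsM cabs_real.
apply: ler_sum => i _; rewrite ler_wpM2l// (bigD1 i)//= lerDl.
by apply: sumr_ge0 => j _; exact: cabs_ge0.
Qed.

Lemma Re_icdot x z : ReC ('i%C * cdot x z) = - dot x (map_mx (@complex.Im R) z).
Proof.
rewrite /cdot mulr_sumr (raddf_sum (@complex.Re R : Rcomplex R -> R)) /dot -sumrN.
by apply: eq_bigr => i _; rewrite mxE; case: (z 0 i) => a b /=; ring.
Qed.

Lemma Im_icdot x z : ImC ('i%C * cdot x z) = dot x (map_mx (@complex.Re R) z).
Proof.
rewrite /cdot mulr_sumr (raddf_sum (@complex.Im R : Rcomplex R -> R)) /dot.
by apply: eq_bigr => i _; rewrite mxE; case: (z 0 i) => a b /=; ring.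
Qed.

Lemma cdotDr x z z' : cdot x (z + z') = cdot x z + cdot x z'.
Proof. by rewrite /cdot -big_split; apply: eq_bigr => i _; rewrite mxE mulrDr. Qed.

Lemma scont_cexp_cdot z : scont (fun t => cexp ('i%C * cdot (rt t) z)).
Proof.
move=> t_ t ct; apply: ccvg_cexp; apply: ccvgM; first exact: ccvg_cst.
rewrite /cdot; elim: (index_enum _) => [|j r IH].
  by under eq_fun do rewrite big_nil; rewrite big_nil; exact: ccvg_cst.
under eq_fun do rewrite big_cons; rewrite big_cons; apply: ccvgD => //.
apply: ccvgM; last exact: ccvg_cst.
by apply: ccvg_real; under eq_fun do rewrite mxE; rewrite mxE; exact: ct.
Qed.

(** This decay makes the opposite transform converge at every complex point. *)
Definition superexp g := cmeas setT (fun t => g (rt t)) /\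
  forall B : R, exists C, forall t, cabs (g (rt t)) <= C * expR (- (B * l1norm (rt t))).

Lemma superexp_ge0 g (B C : R) :
  (forall t, cabs (g (rt t)) <= C * expR (- (B * l1norm (rt t)))) -> 0 <= C.
Proof.
move=> /(_ [tuple of nseq n 0]) /(le_trans (cabs_ge0 _)).
by rewrite pmulr_lge0// expR_gt0.
Qed.

Lemma superexp_wgt g : superexp g -> exists C, forall t, cabs (g (rt t)) <= C * Wgt t.
Proof.
move=> [_ /(_ 1)[C HC]]; have C0 := superexp_ge0 HC; exists (C * 4 ^+ n) => t.
apply: (le_trans (HC t)); rewrite mul1r -mulrA ler_wpM2l//.
exact: expR_l1norm_Wgt.
Qed.

Lemma Re_icdot_le x z : `|ReC ('i%C * cdot x z)| <= l1norm x * \sum_i cabs (z 0 i).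
Proof.
apply: (le_trans (Re_le_cabs _)); rewrite cabsM cabs_i mul1r.
exact: cabs_cdot.
Qed.

(** The exponential growth of the kernel, the moments up to the second order and
an extra exponential are all absorbed by the decay of g; the extra exponential
makes the bound locally uniform in z. *)
Lemma superexp_dom g z (k : nat) (B : R) : superexp g -> (k <= 2)%N -> exists C, forall t,
  cabs (g (rt t) * cexp ('i%C * cdot (rt t) z)) * (l1norm (rt t) ^+ k * expR (B * l1norm (rt t)))
    <= C * Wgt t.
Proof.
move=> [mg gB] k2; pose S := \sum_i cabs (z 0 i).
have [C gC] := gB (S + B + 2); have C0 := superexp_ge0 gC.
exists (4 * C * 4 ^+ n) => t; set N := l1norm (rt t).
have N0 : 0 <= N by exact: l1norm_ge0.
have NkE : N ^+ k <= 4 * expR N.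
  have : 1 + N / 2 <= expR (N / 2) by exact: expR_ge1Dx.
  have -> : expR N = expR (N / 2) ^+ 2 by rewrite expr2 -expRD; congr expR; lra.
  move: (expR (N / 2)) => E EN; have EE : (1 + N / 2) ^+ 2 <= E ^+ 2.
    by rewrite ler_pXn2r ?nnegrE//; lra.
  by case: k k2 => [|[|[|k]]]// _; rewrite ?expr0 ?expr1; nra.
rewrite cabsM cabs_cexp.
have h1 : expR (ReC ('i%C * cdot (rt t) z)) <= expR (S * N).
  by rewrite ler_expR [leRHS]mulrC (le_trans (ler_norm _))// Re_icdot_le.
apply: (@le_trans _ _ (C * expR (- ((S + B + 2) * N)) * expR (S * N) * (4 * expR N * expR (B * N)))).
  apply: ler_pM; rewrite ?mulr_ge0 ?cabs_ge0 ?expR_ge0 ?exprn_ge0//.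
    by apply: ler_pM; rewrite ?cabs_ge0 ?expR_ge0//; exact: gC.
  by apply: ler_pM; rewrite ?expR_ge0 ?exprn_ge0.
rewrite (_ : C * _ * _ * _ = 4 * C * (expR (- ((S + B + 2) * N)) * expR (S * N) * expR N * expR (B * N))); last by ring.
rewrite -!expRD (_ : - ((S + B + 2) * N) + S * N + N + B * N = - N); last by ring.
by rewrite -[leRHS]mulrA ler_wpM2l ?mulr_ge0// expR_l1norm_Wgt.
Qed.

Lemma superexp_wdom g z : superexp g ->
  wdom (fun t => g (rt t) * cexp ('i%C * cdot (rt t) z)).
Proof.
move=> sg; split.
  by apply: cmeasM; [exact: sg.1|apply: scont_cmeas; exact: scont_cexp_cdot].
have [C HC] := superexp_dom z 0 sg (leq0n 2); exists C => t.
by have := HC t; rewrite expr0 mul0r expR0 !mulr1.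
Qed.

Lemma l1norm_coord x i : `|x 0 i| <= l1norm x.
Proof. by rewrite /l1norm (bigD1 i)//= lerDl sumr_ge0. Qed.

Lemma superexp_coord g j : superexp g -> superexp (fun xi => g xi * ('i%C * (xi 0 j)%:C)).
Proof.
move=> [mg gB]; split.
  by apply: cmeasM => //; apply: cmeasM; [exact: cmeas_cst|exact: cmeas_rt_coord].
move=> B; have [C HC] := gB (B + 1); exists C => t; set N := l1norm (rt t).
have C0 := superexp_ge0 HC.
rewrite !cabsM cabs_i mul1r cabs_real.
apply: (@le_trans _ _ (C * expR (- ((B + 1) * N)) * expR N)).
  apply: ler_pM; rewrite ?cabs_ge0//.
  apply: (le_trans (l1norm_coord _ _)); have := expR_ge1Dx N; rewrite -/N; lra.
by rewrite -mulrA -expRD (_ : - ((B + 1) * N) + N = - (B * N)); last by ring.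
Qed.

Let I1 : R := \int[lebesgue_tuple R n]_t Wgt t.

(** Differentiation under the integral sign: exp w - 1 - w is at most
4 |w|^2 exp |Re w|, and w = i <x, h> is linear in the increment h. *)
Lemma inverse_quad g z : superexp g -> exists2 K, 0 <= K & forall h : cV,
  \sum_i cabs (h 0 i) <= 1 ->
  cabs (inverse g (z + h) - inverse g z -
    \sum_j h 0 j * inverse (fun xi => g xi * ('i%C * (xi 0 j)%:C)) z) <=
  K * (\sum_i cabs (h 0 i)) ^+ 2.
Proof.
move=> sg; have [C HC] := superexp_dom z 1 sg (leqnn 2).
have C0 : 0 <= C.
  pose t0 : T := [tuple of nseq n 0].
  suff : 0 <= C * Wgt t0 by rewrite pmulr_lge0 ?Wgt_gt0.
  apply: le_trans (HC t0).
  apply: mulr_ge0; first exact: cabs_ge0.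
  by apply: mulr_ge0; [rewrite exprn_ge0// l1norm_ge0|exact: expR_ge0].
exists (2 * I1 * (4 * C)) => [|h h1]; first by rewrite !mulr_ge0// wgt_int_ge0.
set S := \sum_i cabs (h 0 i) in h1 *.
have S0 : 0 <= S by apply: sumr_ge0 => i _; exact: cabs_ge0.
have i1 := wdom_integrable (superexp_wdom (z + h) sg).
have i2 := wdom_integrable (superexp_wdom z sg).
have dj j := superexp_wdom z (superexp_coord j sg).
have [mL iL LE] : [/\ cmeas setT (fun t => \sum_j h 0 j * (g (rt t) * ('i%C * (rt t 0 j)%:C) * cexp ('i%C * cdot (rt t) z))),
   cintegrable (lebesgue_tuple R n) setT (fun t => \sum_j h 0 j * (g (rt t) * ('i%C * (rt t 0 j)%:C) * cexp ('i%C * cdot (rt t) z)))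
   & \sum_j h 0 j * inverse (fun xi => g xi * ('i%C * (xi 0 j)%:C)) z =
     cint (lebesgue_tuple R n) setT (fun t => \sum_j h 0 j * (g (rt t) * ('i%C * (rt t 0 j)%:C) * cexp ('i%C * cdot (rt t) z)))].
  elim: (index_enum _) => [|j r [IH1 IH2 IH3]].
    rewrite big_nil; under [in X in cmeas _ X]eq_fun do rewrite big_nil.
    split; first exact: cmeas_cst.
      under [in X in cintegrable _ _ X]eq_fun do rewrite big_nil.
      apply: (@wdom_integrable R n (fun=> 0)); split; first exact: cmeas_cst.
      by exists 0 => t; rewrite cabs0 mul0r.
    by under eq_cint do rewrite big_nil; rewrite cint0.
  have ij := cintegrableM measurableT (h 0 j) (wdom_integrable (dj j)).
  split.
  - under [in X in cmeas _ X]eq_fun do rewrite big_cons.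
    by apply: cmeasD => //; apply: cmeasM; [exact: cmeas_cst|exact: (dj j).1].
  - under [in X in cintegrable _ _ X]eq_fun do rewrite big_cons.
    exact: cintegrableD.
  - rewrite big_cons IH3; under [RHS]eq_cint do rewrite big_cons.
    rewrite cintD//; congr (_ + _); rewrite cintM//.
    exact: (wdom_integrable (dj j)).
rewrite LE /inverse -cintB// -cintB//; last exact: cintegrableB.
rewrite -[leRHS]mulrA (_ : 4 * C * S ^+ 2 = 4 * S ^+ 2 * C); last by ring.
apply: le_cint_Wgt.
  apply: cmeasB => //; apply: cmeasB; [exact: (superexp_wdom _ sg).1|exact: (superexp_wdom _ sg).1].
move=> t; set N := l1norm (rt t); have N0 : 0 <= N by exact: l1norm_ge0.
pose w := 'i%C * cdot (rt t) h.
have -> : \sum_j h 0 j * (g (rt t) * ('i%C * (rt t 0 j)%:C) * cexp ('i%C * cdot (rt t) z)) =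
    g (rt t) * cexp ('i%C * cdot (rt t) z) * w.
  by rewrite /w /cdot !mulr_sumr; apply: eq_bigr => j _; ring.
rewrite cdotDr mulrDr cexpD (_ : _ - _ = g (rt t) * cexp ('i%C * cdot (rt t) z) * (cexp w - 1 - w)); last first.
  by rewrite /w; ring.
have wN : cabs w <= N * S by rewrite /w cabsM cabs_i mul1r cabs_cdot.
have wN1 : `|ReC w| <= 1 * N.
  by rewrite (le_trans (Re_le_cabs _))// (le_trans wN)// mul1r ler_piMr.
rewrite cabsM; set G := cabs (g (rt t) * _).
have G0 : 0 <= G by exact: cabs_ge0.
apply: (@le_trans _ _ (G * (4 * (N * S) ^+ 2 * expR (1 * N)))).
  rewrite ler_wpM2l// (le_trans (cexp_taylor2 w))//.
  apply: ler_pM; rewrite ?expR_ge0 ?ler_expR//.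
    by rewrite mulr_ge0 ?sqr_ge0.
  by rewrite ler_wpM2l// ler_pXn2r ?nnegrE ?cabs_ge0// mulr_ge0.
rewrite (_ : G * _ = 4 * S ^+ 2 * (G * (N ^+ 2 * expR (1 * N)))); last by ring.
rewrite -[leRHS]mulrA; apply: ler_wpM2l; last exact: HC.
by rewrite mulr_ge0// sqr_ge0.
Qed.

End Inverse.

Section EntireCriterion.
Variables (R : realType) (n : nat).
Local Open Scope complex_scope.
Let V : normedModType R[i] := 'rV[R[i]]_n.
Local Notation cV := ('rV[R[i]]_n).

(** A first-order expansion with quadratic remainder exhibits the differential; the
sum norm is comparable to the norm of row vectors. *)
Lemma entire_of_quad (F : cV -> R[i]^o) :
  (forall z : cV, exists D : 'I_n -> R[i], exists2 K : R, 0 <= K & forall h : cV,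
     \sum_i cabs (h 0 i) <= 1 ->
     cabs (F (z + h) - F z - \sum_j h 0 j * D j) <= K * (\sum_i cabs (h 0 i)) ^+ 2) ->
  entire F.
Proof.
move=> FH z; have [D [K K0 HK]] := FH z.
pose L (h : V) : R[i]^o := \sum_j (h : cV) 0 j * D j.
have Llin : linear L.
  move=> a x y; rewrite /L scaler_sumr -big_split; apply: eq_bigr => j _.
  by rewrite !mxE mulrDl /GRing.scale /= mulrA.
pose L' : {linear V -> R[i]^o} := HB.pack L (GRing.isLinear.Build _ _ _ _ L Llin).
have n0 : 0 < n.+1%:R :> R by rewrite ltr0n.
have cL : continuous (L' : V -> R[i]^o).
  apply: continuousfor0_continuous.
  have L0 : (L' : V -> R[i]^o) 0 = 0 by exact: linear0.
  suff H (l : R[i]^o) : l = 0 -> (L' : V -> R[i]^o) @ (0 : V) --> l by exact: (H _ L0).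
  move=> ->.
  have FF : Filter (nbhs (0 : V)) by exact: nbhs_filter.
  apply/(@cvgrPdist_le _ _ _ _ FF) => e e0.
  have [e' eE {}e0] := gt0_real e0; rewrite eE.
  pose M := \sum_j cabs (D j); have M0 : 0 <= M by apply: sumr_ge0 => j _; exact: cabs_ge0.
  have M1 : 0 < M + 1 by rewrite ltr_pwDr.
  apply: (@row_nbhs _ _ _ _ (e' / (M + 1))); first by rewrite divr_gt0.
  move=> y yd; rewrite sub0r normrN cabsE lecR /=.
  apply: (@le_trans _ _ (\sum_j e' / (M + 1) * cabs (D j))).
    rewrite /L; apply: (@le_trans _ _ (\sum_j cabs (y 0 j * D j))).
      elim: (index_enum _) => [|i r IH]; first by rewrite !big_nil cabs0.
      by rewrite !big_cons (le_trans (cabsD _ _))// lerD.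
    apply: ler_sum => j _; rewrite cabsM ler_wpM2r ?cabs_ge0//.
    by have := yd j; rewrite mxE subr0 => /ltW.
  rewrite -mulr_sumr -/M mulrAC ler_pdivrMr// ler_wpM2l ?(ltW e0)//; lra.
have E : F \o shift (z : V) = cst (F z) + L' +o_ (0 : V) id.
  apply/eqaddoP => e e0.
  have [e' eE {}e0] := gt0_real e0; rewrite eE.
  pose d := Num.min n.+1%:R^-1 (e' / (K * n.+1%:R ^+ 2 + 1)).
  have X0 : 0 < K * n.+1%:R ^+ 2 + 1 by rewrite ltr_pwDr// mulr_ge0// sqr_ge0.
  have d0 : 0 < d by rewrite lt_min invr_gt0 n0 divr_gt0.
  have d1 : d * n.+1%:R <= 1 by rewrite -ler_pdivlMr// mul1r ge_min lexx.
  have d2 : d * (K * n.+1%:R ^+ 2) <= e'.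
    apply: (@le_trans _ _ (d * (K * n.+1%:R ^+ 2 + 1))); first by rewrite ler_wpM2l ?(ltW d0)// lerDl.
    by rewrite -ler_pdivlMr// ge_min lexx orbT.
  apply: (row_nbhs d0) => h hd.
  have [r hr] : exists r : R, `|h| = r%:C.
    exists (ReC `|h|); have := normr_ge0 h; case: `|h| => a b.
    by rewrite lecE /= => /andP[/eqP -> _].
  have hjr j : cabs (h 0 j) <= r.
    by have := coord_le_mx_norm h j; rewrite -lecR -cabsE -hr.
  pose S := \sum_i cabs (h 0 i).
  have S0 : 0 <= S by apply: sumr_ge0 => i _; exact: cabs_ge0.
  have Ssum (a : R) : (forall i, cabs (h 0 i) <= a) -> 0 <= a -> S <= a * n.+1%:R.
    move=> ha a0; apply: (@le_trans _ _ (\sum_(i < n) a)); first exact: ler_sum.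
    by rewrite sumr_const card_ord -[a *+ n]mulr_natr ler_wpM2l// ler_nat.
  have Sd : S <= d * n.+1%:R.
    by apply: Ssum; [move=> i; have := hd i; rewrite mxE subr0 => /ltW|exact: ltW].
  have r0 : 0 <= r by rewrite -lecR -hr normr_ge0.
  have Sr : S <= r * n.+1%:R by exact: Ssum.
  have := HK h (le_trans Sd d1); rewrite -/S => H.
  rewrite !fctE /= [h + z]addrC opprD addrA cabsE hr -rmorphM lecR /=.
  apply: (le_trans H); rewrite expr2 mulrA.
  apply: (@le_trans _ _ (K * (d * n.+1%:R) * (r * n.+1%:R))).
    by apply: ler_pM => //; [exact: mulr_ge0|exact: ler_wpM2l].
  rewrite (_ : K * (d * n.+1%:R) * (r * n.+1%:R) = d * (K * n.+1%:R ^+ 2) * r); last by ring.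
  by rewrite ler_wpM2r.
have dE := diff_unique cL E.
by apply/diff_locallyP; rewrite dE.
Qed.

End EntireCriterion.

Section Parts.
Variables (R : realType) (n : nat).
Local Open Scope complex_scope.
Local Notation RT := (measurableTypeR R).
Local Notation T := (n.-tuple RT).
Local Notation rV := ('rV[R]_n).
Local Notation cV := ('rV[R[i]]_n).
Local Notation lambda := (@lebesgue_measure R).
Implicit Types (x : rV) (z : cV) (t : T) (g : rV -> R[i]).

Lemma entire_inverse g : superexp g -> entire (inverse g).
Proof.
move=> sg; apply: entire_of_quad => z.
exists (fun j => inverse (fun xi => g xi * ('i%C * (xi 0 j)%:C)) z).
exact: inverse_quad.
Qed.

Lemma continuous_seq (h : rV -> R) (x_ : nat -> rV) x : continuous h ->
  (forall i, (fun k => x_ k 0 i) @ \oo --> x 0 i) -> (fun k => h (x_ k)) @ \oo --> h x.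
Proof.
move=> ch cx; apply/cvgrPdist_lt => e e0.
have FF : Filter (nbhs x) by exact: nbhs_filter.
have /(@cvgrPdist_lt _ _ _ _ FF)/(_ e e0)/nbhs_rowP[d d0 dP] := ch x.
have : \forall k \near \oo, forall i : 'I_n, `|x_ k 0 i - x 0 i| < d.
  apply: filter_forall => i; have /cvgrPdist_lt/(_ _ d0) := cx i.
  by apply: filterS => k; rewrite distrC.
by apply: filterS => k /dP.
Qed.

Lemma continuous_scont g : continuous (re g) -> continuous (im g) ->
  scont (fun t => g (rt t)).
Proof.
move=> c1 c2 t_ t ct; apply/ccvgP; split.
- apply: (continuous_seq c1) => i; rewrite mxE; under eq_fun do rewrite mxE.
  exact: ct.
- apply: (continuous_seq c2) => i; rewrite mxE; under eq_fun do rewrite mxE.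
  exact: ct.
Qed.

Lemma is_derive_line (h : rV -> R) (a v : rV) (s l : R) :
  is_derive (a + s *: v) v h l -> is_derive s (1 : R) (fun s : R => h (a + s *: v)) l.
Proof.
move=> [dh dhl].
have E : (fun k : R => k^-1 *: (h (a + (k *: (1 : R) + s) *: v) - h (a + s *: v))) =
    (fun k : R => k^-1 *: (h (k *: v + (a + s *: v)) - h (a + s *: v))).
  apply/funext => k; congr (_ *: (h _ - _)).
  by rewrite /GRing.scale /= mulr1 -/(GRing.scale _ _) scalerDl addrCA.
apply: DeriveDef.
- by rewrite /derivable /= E.
- by rewrite /derive /= E.
Qed.

Lemma continuous_line (h : rV -> R) (a v : rV) : continuous h ->
  continuous (fun s : R => h (a + s *: v)).
Proof.
move=> ch s; apply: (@continuous_comp _ _ _ (fun s : R => a + s *: v) h); last exact: ch.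
apply: cvgD; first exact: cvg_cst.
by apply: cvgZl; exact: cvg_id.
Qed.

Lemma rt_upd t j s : rt (upd t j s) = rt (upd t j 0) + s *: delta_mx 0 j.
Proof.
apply/rowP => i; rewrite !mxE !tnth_mktuple eqxx /=.
by case: eqP => _; rewrite ?mulr1 ?mulr0 ?add0r ?addr0.
Qed.

(** Integration by parts in one coordinate: g times the kernel vanishes at infinity
on every line, so the integral of its derivative is 0. *)
Lemma inverse_parts g g' j z : superexp g -> superexp g' ->
  continuous (re g') -> continuous (im g') ->
  (forall x, is_derive x (delta_mx 0 j : rV) (re g) (ReC (g' x))) ->
  (forall x, is_derive x (delta_mx 0 j : rV) (im g) (ImC (g' x))) ->
  inverse g' z = - ('i%C * z 0 j) * inverse g z.
Proof.
move=> sg sg' c1 c2 d1 d2.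
pose E t := cexp ('i%C * cdot (rt t) z).
pose u t := g' (rt t) * E t + ('i%C * z 0 j) * (g (rt t) * E t).
have [mg' [C1 B1]] := superexp_wdom z sg'.
have [mg [C2 B2]] := superexp_wdom z sg.
pose C3 := C1 + cabs (z 0 j) * C2.
have du : wdom u.
  split; first by apply: cmeasD => //; apply: cmeasM => //; exact: cmeas_cst.
  exists C3 => t; rewrite (le_trans (cabsD _ _))// mulrDl lerD// cabsM cabsM cabs_i mul1r.
  by rewrite -mulrA ler_wpM2l ?cabs_ge0.
have uE : cint (lebesgue_tuple R n) setT u = inverse g' z + 'i%C * z 0 j * inverse g z.
  rewrite cintD//.
  - by rewrite cintM//; exact: (wdom_integrable (superexp_wdom z sg)).
  - exact: (wdom_integrable (superexp_wdom z sg')).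
  - by apply: cintegrableM => //; exact: (wdom_integrable (superexp_wdom z sg)).
suff u0 : cint (lebesgue_tuple R n) setT u = 0.
  by apply/eqP; rewrite mulNr -addr_eq0 -uE u0.
rewrite -(cint0 (lebesgue_tuple R n) measurableT); apply: (cint_slice (j := j)) => //.
  by split; [exact: cmeas_cst|exists 0 => t; rewrite cabs0 mul0r].
move=> t; rewrite cint0//.
pose a := rt (upd t j 0); pose v : rV := delta_mx 0 j.
pose p := 'i%C * cdot a z; pose q := 'i%C * z 0 j.
have EE s : E (upd t j s) = cexp (p + s%:C * q).
  rewrite /E rt_upd -/a -/v; congr cexp; rewrite /p /q /cdot !mulr_sumr.
  rewrite (bigD1 j)//= [X in _ = X + _](bigD1 j)//= !mxE !eqxx.
  rewrite [X in _ + X = _](eq_bigr (fun i => 'i%C * ((a 0 i)%:C * z 0 i))); last first.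
    by move=> i /negbTE ij; rewrite !mxE ij andbF mulr0 addr0.
  by rewrite mulr1 rmorphD /=; ring.
have ReE s : ReC (cexp (p + s%:C * q)) = expR (ReC p + s * ReC q) * cos (ImC p + s * ImC q).
  by rewrite /cexp /=; case: (p) => ? ?; case: (q) => ? ? /=; rewrite !mul0r !subr0 addr0.
have ImE s : ImC (cexp (p + s%:C * q)) = expR (ReC p + s * ReC q) * sin (ImC p + s * ImC q).
  by rewrite /cexp /=; case: (p) => ? ?; case: (q) => ? ? /=; rewrite !mul0r !subr0 !addr0.
pose A s := re g (a + s *: v); pose B s := im g (a + s *: v).
pose A' s := re g' (a + s *: v); pose B' s := im g' (a + s *: v).
have dA (s : R) : is_derive s (1 : R) A (A' s) by apply: is_derive_line; exact: d1.
have dB (s : R) : is_derive s (1 : R) B (B' s) by apply: is_derive_line; exact: d2.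
have cA' : continuous A' by exact: continuous_line.
have cB' : continuous B' by exact: continuous_line.
have cA := is_derive_continuous dA; have cB := is_derive_continuous dB.
pose X s := expR (ReC p + s * ReC q) * cos (ImC p + s * ImC q).
pose Y s := expR (ReC p + s * ReC q) * sin (ImC p + s * ImC q).
have dX (s : R) : is_derive s (1 : R) X (ReC q * X s - ImC q * Y s).
  by apply: is_derive_eq; rewrite /GRing.scale /= /X /Y; ring.
have dY (s : R) : is_derive s (1 : R) Y (ReC q * Y s + ImC q * X s).
  by apply: is_derive_eq; rewrite /GRing.scale /= /X /Y; ring.
have cX := is_derive_continuous dX; have cY := is_derive_continuous dY.
have uform s : u (upd t j s) = (A' s +i* B' s) * (X s +i* Y s) +
    (ReC q +i* ImC q) * ((A s +i* B s) * (X s +i* Y s)).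
  rewrite /u EE rt_upd; congr (_ * _ + _ * (_ * _)); apply: complexP;
    by rewrite ?ReE ?ImE.
have uR s : ReC (u (upd t j s)) = (A' s * X s - B' s * Y s) +
    (A s * (ReC q * X s - ImC q * Y s) - B s * (ReC q * Y s + ImC q * X s)).
  by rewrite uform /=; ring.
have uI s : ImC (u (upd t j s)) = (A' s * Y s + B' s * X s) +
    (A s * (ReC q * Y s + ImC q * X s) + B s * (ReC q * X s - ImC q * Y s)).
  by rewrite uform /=; ring.
have cM (f1 f2 : R -> R) : continuous f1 -> continuous f2 -> continuous (fun s : R => f1 s * f2 s).
  by move=> cf cg x; apply: cvgM; [exact: cf|exact: cg].
have cD (f1 f2 : R -> R) : continuous f1 -> continuous f2 -> continuous (fun s : R => f1 s + f2 s).
  by move=> cf cg x; apply: cvgD; [exact: cf|exact: cg].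
have cN (f1 : R -> R) : continuous f1 -> continuous (fun s : R => - f1 s).
  by move=> cf x; apply: cvgN; exact: cf.
have cZ (k : R) (f1 : R -> R) : continuous f1 -> continuous (fun s : R => k * f1 s).
  by move=> cf x; apply: cvgM; [exact: cvg_cst|exact: cf].
have cqX := cD _ _ (cZ (ReC q) _ cX) (cN _ (cZ (ImC q) _ cY)).
have cqY := cD _ _ (cZ (ReC q) _ cY) (cZ (ImC q) _ cX).
have cUR := cD _ _ (cD _ _ (cM _ _ cA' cX) (cN _ (cM _ _ cB' cY)))
  (cD _ _ (cM _ _ cA cqX) (cN _ (cM _ _ cB cqY))).
have cUI := cD _ _ (cD _ _ (cM _ _ cA' cY) (cM _ _ cB' cX))
  (cD _ _ (cM _ _ cA cqY) (cM _ _ cB cqX)).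
have C30 : 0 <= C3 by have [_ [? _]] := du; rewrite addr_ge0 ?mulr_ge0 ?cabs_ge0//;
  [exact: wdom_ge0 B1|exact: wdom_ge0 B2].
have ub s : cabs (u (upd t j s)) <= C3 * wgt s.
  apply: (@le_trans _ _ (C3 * Wgt (upd t j s))); last by rewrite ler_wpM2l ?Wgt_upd.
  rewrite (le_trans (cabsD _ _))// mulrDl lerD ?B1// cabsM cabsM cabs_i mul1r.
  by rewrite -mulrA ler_wpM2l ?cabs_ge0// B2.
have gb s : cabs (g (rt (upd t j s)) * E (upd t j s)) <= C2 * wgt s.
  apply: (le_trans (B2 _)); rewrite ler_wpM2l ?Wgt_upd//; exact: wdom_ge0 B2.
have fin (f : RT -> R) : continuous f -> (forall s, `|f s| <= C3 * wgt s) -> rintegrable lambda setT f.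
  move=> cf fC; apply: (rintegrable_le measurableT _ (rintegrableZ measurableT C3 (@rintegrable_wgt R))).
    exact: continuous_measurable_fun.
  by move=> s _; exact: fC.
have gE s : g (rt (upd t j s)) * E (upd t j s) = (A s +i* B s) * (X s +i* Y s).
  by rewrite rt_upd EE; congr (_ * _); apply: complexP; rewrite ?ReE ?ImE.
apply: complexP; rewrite /=.
- under eq_Rintegral do rewrite uR.
  apply: (@Rintegral_derive0 _ (fun s => A s * X s - B s * Y s) _ C2).
  + move=> s; apply: is_derive_eq; rewrite /GRing.scale /=; ring.
  + exact: cUR.
  + apply: fin; first exact: cUR.
    by move=> s; rewrite -uR (le_trans (Re_le_cabs _)).
  + by move=> s; have := gb s; rewrite gE; apply: le_trans; exact: (Re_le_cabs ((_ +i* _) * (_ +i* _))).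
- under eq_Rintegral do rewrite uI.
  apply: (@Rintegral_derive0 _ (fun s => A s * Y s + B s * X s) _ C2).
  + move=> s; apply: is_derive_eq; rewrite /GRing.scale /=; ring.
  + exact: cUI.
  + apply: fin; first exact: cUI.
    by move=> s; rewrite -uI (le_trans (Im_le_cabs _)).
  + by move=> s; have := gb s; rewrite gE; apply: le_trans; exact: (Im_le_cabs ((_ +i* _) * (_ +i* _))).
Qed.

End Parts.

(** * Exponential series, Young conjugates and weights *)

Section Exponential.
Variable R : realType.
Implicit Types a : R.

Lemma exp_sum_le a k : 0 <= a -> \sum_(0 <= i < k) a ^+ i / i`!%:R <= expR a.
Proof.
move=> a0; have := @nondecreasing_cvgn_le R (series (exp_coeff a)) _ (is_cvg_series_exp_coeff a) k.
apply; apply: nondecreasing_series => i _ _.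
by rewrite /exp_coeff /= divr_ge0 ?exprn_ge0.
Qed.

Lemma exp_coeff_le a b : 0 <= a -> a ^+ b / b`!%:R <= expR a.
Proof.
move=> a0; apply: le_trans (exp_sum_le b.+1 a0).
rewrite big_nat_recr //= lerDr; apply: sumr_ge0 => i _.
by rewrite divr_ge0 ?exprn_ge0.
Qed.

(** As exp a is the sum of the terms of the series at 2a weighted by the powers
of 1/2, one of these terms is not much smaller than exp a. *)
Lemma exp_coeff_large a : 0 <= a ->
  exists b, expR a <= 3 * ((2 * a) ^+ b / b`!%:R).
Proof.
move=> a0; apply: contrapT => H.
have lt b : (2 * a) ^+ b / b`!%:R < expR a / 3.
  by rewrite ltr_pdivlMr// mulrC ltNge; apply/negP => ?; apply: H; exists b.
have E0 := expR_gt0 a.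
have geo k : \sum_(0 <= i < k) (2^-1 : R) ^+ i <= 2.
  rewrite (_ : \sum_(0 <= i < k) _ = 2 - 2 * 2^-1 ^+ k).
    by rewrite gerBl mulr_ge0// exprn_ge0// invr_ge0.
  elim: k => [|k IH]; first by rewrite big_geq// expr0; lra.
  by rewrite big_nat_recr//= IH exprS; lra.
have S k : series (exp_coeff a) k <= 2 / 3 * expR a.
  rewrite /series /=; apply: (@le_trans _ _ (\sum_(0 <= i < k) (expR a / 3) * 2^-1 ^+ i)).
    apply: ler_sum => i _; rewrite /exp_coeff /=.
    have -> : a ^+ i / i`!%:R = (2 * a) ^+ i / i`!%:R * 2^-1 ^+ i.
      by rewrite mulrAC -exprMn mulrAC divff ?mul1r.
    by rewrite ler_wpM2r ?exprn_ge0 ?invr_ge0// ltW.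
  rewrite -mulr_sumr; have := geo k; nra.
have : expR a <= 2 / 3 * expR a.
  apply: limr_le; first exact: is_cvg_series_exp_coeff.
  by apply: nearW => k; exact: S.
by lra.
Qed.

End Exponential.

Section Conjugate.
Variables (R : realType) (n : nat).
Local Notation rV := ('rV[R]_n).
Variables (h : rV -> R) (v : rV) (F X N : R).
Hypotheses (F0 : 0 < F) (X0 : 0 <= X) (N0 : 0 <= N).
Let conj := young_conj (fun y => (h y)%:E) v.

Let conj_ge y : ((dot v y - h y)%:E <= conj)%E.
Proof. by apply: ereal_sup_ubound; exists y. Qed.

(** Bounds with the weight exp (- conj) amount to bounds with each of the affine
minorants of the conjugate. *)
Lemma le_conj : (forall y, X <= N * F * expR (- (dot v y - h y))) ->
  (X%:E / (F%:E * expeR (- conj)) <= N%:E)%E.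
Proof.
move=> H; have [->|Xn0] := eqVneq X 0; first by rewrite mul0e lee_fin.
have Xp : 0 < X by rewrite lt_def Xn0.
have Np : 0 < N.
  rewrite lt_def N0 andbT; apply/eqP => E; have := H 0.
  by rewrite E !mul0r leNgt Xp.
pose L := ln (N * F / X).
have cL : (conj <= L%:E)%E.
  apply: ge_ereal_sup => _ [y _ <-]; rewrite lee_fin.
  rewrite -ler_expR lnK ?posrE ?divr_gt0 ?mulr_gt0// ler_pdivlMr// mulrC -ler_pdivlMr ?expR_gt0//.
  by rewrite -expRN.
have := conj_ge 0; move: cL; case: conj => [r| |]//; rewrite !lee_fin => rL _.
rewrite /= -EFinM inver gt_eqF ?mulr_gt0 ?expR_gt0// -EFinM lee_fin.
rewrite ler_pdivrMr ?mulr_gt0 ?expR_gt0// mulrA.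
have : expR (- L) <= expR (- r) by rewrite ler_expR lerN2.
rewrite expRN lnK ?posrE ?divr_gt0 ?mulr_gt0// invf_div => XL.
apply: le_trans (ler_wpM2l _ XL); last by rewrite mulr_ge0// ltW.
by rewrite mulrC divfK// gt_eqF// mulr_gt0.
Qed.

Lemma conj_le : (X%:E / (F%:E * expeR (- conj)) <= N%:E)%E ->
  forall y, X <= N * F * expR (- (dot v y - h y)).
Proof.
move=> H y; have := conj_ge y; move: H; case: conj => [r| |]//=.
- rewrite -EFinM inver gt_eqF ?mulr_gt0 ?expR_gt0// -EFinM lee_fin.
  rewrite ler_pdivrMr ?mulr_gt0 ?expR_gt0// mulrA lee_fin => H1 H2.
  apply: (le_trans H1); rewrite ler_wpM2l ?mulr_ge0 ?(ltW F0)//.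
  by rewrite ler_expR lerN2.
- rewrite mule0 inve0 => H _; have -> : X = 0.
    move: H; have [->//|Xn0] := eqVneq X 0.
    by rewrite gt0_muley// lte_fin lt_def Xn0.
  by rewrite !mulr_ge0 ?expR_ge0 ?(ltW F0).
Qed.

End Conjugate.

Section Weights.
Variables (R : realType) (n : nat) (phi : 'rV[R]_n -> R).
Hypothesis wphi : weight phi.

(** The coordinates are enlarged one after the other; evenness reduces to the
orthant, where phi is nondecreasing in each of them. *)
Lemma weight_le (x y : 'rV[R]_n) : (forall i, `|x 0 i| <= `|y 0 i|) -> phi x <= phi y.
Proof.
have [_ even mono _] := wphi; move=> xy.
rewrite even [leRHS]even.
pose s (k : nat) : 'rV[R]_n := \row_i (if (i < k)%N then `|y 0 i| else `|x 0 i|).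
have -> : map_mx Num.norm x = s 0%N by apply/rowP => i; rewrite !mxE.
have -> : map_mx Num.norm y = s n by apply/rowP => i; rewrite !mxE ltn_ord.
suff S k : (k <= n)%N -> phi (s 0%N) <= phi (s k) by exact: S.
have so m : orthant (s m) by move=> i; rewrite mxE; case: ifP.
elim: k => // k IH kn; apply: (le_trans (IH (ltnW kn))).
apply: (mono (Ordinal kn)); rewrite ?so//.
- move=> j jk; have jk' : (nat_of_ord j == k) = false.
    by apply/negbTE; apply: contra jk => /eqP E; apply/eqP/val_inj.
  by rewrite !mxE ltnS [(j <= k)%N]leq_eqVlt jk'.
- by rewrite !mxE /= ltnn ltnS leqnn.
Qed.

End Weights.

(** * Seminorm estimates for the transform *)

Section Estimates.
Variables (R : realType) (n : nat) (phi : nat -> 'rV[R]_n -> R).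
Hypothesis wphi : forall nu, weight (phi nu).
Local Open Scope complex_scope.
Local Notation RT := (measurableTypeR R).
Local Notation T := (n.-tuple RT).
Local Notation rV := ('rV[R]_n).
Local Notation cV := ('rV[R[i]]_n).
Implicit Types (f : cV -> R[i]^o) (g : rV -> R[i]^o) (x y eta : rV) (z : cV).

Lemma pE_le nu m f (P : R) : (pE phi nu m f <= P%:E)%E <->
  forall z, cabs (f z) * (1 + cenorm z) ^+ m <= P * expR (phi nu (map_mx (@complex.Im R) z)).
Proof.
split=> [H z|H].
  rewrite -ler_pdivrMr ?expR_gt0// -lee_fin; apply: le_trans H.
  by apply: ereal_sup_ubound; exists z.
by apply: ge_ereal_sup => _ [z _ <-]; rewrite lee_fin ler_pdivrMr ?expR_gt0.
Qed.

Lemma pE_ge0 nu m f : (0 <= pE phi nu m f)%E.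
Proof.
apply: (@le_trans _ _ (cabs (f 0) * (1 + cenorm (0 : cV)) ^+ m /
    expR (phi nu (map_mx (@complex.Im R) (0 : cV))))%:E).
  rewrite lee_fin divr_ge0 ?expR_ge0// mulr_ge0 ?cabs_ge0// exprn_ge0//.
  by rewrite addr_ge0// cenorm_ge0.
by apply: ereal_sup_ubound; exists 0.
Qed.

Lemma pE_fine nu m f : E_ phi nu f -> exists2 P : R, 0 <= P & pE phi nu m f = P%:E.
Proof.
move=> [_ /(_ m)]; have := pE_ge0 nu m f; case: (pE _ _ _ _) => [r| |]//=.
by rewrite lee_fin => r0 _; exists r.
Qed.

Lemma E_bounds nu f : E_ phi nu f -> forall m, exists P, forall z,
  cabs (f z) * (1 + cenorm z) ^+ m <= P * expR (phi nu (map_mx (@complex.Im R) z)).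
Proof.
by move=> Ef m; have [P _ PE] := pE_fine m Ef; exists P; apply/pE_le; rewrite PE.
Qed.

Lemma E_rapid nu f : E_ phi nu f -> rapid (on_reals f).
Proof. by move=> Ef; exact: (rapid_on_reals Ef.1 (E_bounds Ef)). Qed.

(** The sequence of variables along which mD differentiates. *)
Definition mlist (a : multiindex n) : seq 'I_n :=
  flatten [seq nseq (a j) j | j <- enum 'I_n].

Lemma size_mlist a : size (mlist a) = mlength a.
Proof.
rewrite /mlist size_flatten /shape -map_comp sumnE big_map /mlength big_enum /=.
by apply: eq_bigr => j _; rewrite size_nseq.
Qed.

Let I1 : R := \int[lebesgue_tuple R n]_t Wgt t.

Lemma sgr_dot x (r : rV) : dot x (\row_i (- Num.sg (x 0 i) * r 0 i)) = - \sum_i `|x 0 i| * r 0 i.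
Proof.
rewrite /dot -sumrN; apply: eq_bigr => i _.
by rewrite mxE [`|_|]normrEsg; ring.
Qed.

Lemma sgr_row_le x (r : rV) i : `|(\row_i (- Num.sg (x 0 i) * r 0 i) : rV) 0 i| <= `|r 0 i|.
Proof.
rewrite mxE normrM normrN ler_piMl//.
by rewrite normr_sg; case: (x 0 i != 0).
Qed.

Lemma mfact_gt0 (b : multiindex n) : 0 < (mfact b)%:R :> R.
Proof. by rewrite ltr0n prodn_gt0// => i; rewrite fact_gt0. Qed.

Lemma dot_mvec_ln (b : multiindex n) y :
  expR (dot (mvec R b) y) = \prod_i expR (y 0 i) ^+ b i.
Proof.
by rewrite /dot expR_sum; apply: eq_bigr => i _; rewrite mxE expRM_natl.
Qed.

(** The Paley-Wiener estimate holds for all r = exp y in the open orthant; the bound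
a^b / b! <= e^a absorbs the power of x, and the best choice of y produces the
conjugate. *)
Lemma pG_transform nu m f : E_ phi nu f ->
  (pG phi nu m (transform (on_reals f)) <=
    (2 * I1)%:E * pE phi nu (m + 2 * n) f)%E.
Proof.
move=> Ef; have [P P0 PE] := pE_fine (m + 2 * n) Ef; rewrite PE -EFinM.
have I10 : 0 <= I1 by exact: wgt_int_ge0.
have I0 : 0 <= 2 * I1 by rewrite mulr_ge0.
apply: ge_ereal_sup => _ [x [a [b [am ->]]]].
apply: (@le_conj _ _ (fun y => phi nu (map_mx expR y))); rewrite ?mfact_gt0 ?cabs_ge0//.
  exact: mulr_ge0.
move=> y; pose r : rV := map_mx expR y; pose eta : rV := \row_i (- Num.sg (x 0 i) * r 0 i).
have HP : forall z, cabs (f z) * (1 + cenorm z) ^+ (size (mlist a) + 2 * n) <=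
    P * expR (phi nu (map_mx (@complex.Im R) z)).
  move=> z; have /pE_le/(_ z) : (pE phi nu (m + 2 * n) f <= P%:E)%E by rewrite PE.
  apply: le_trans; rewrite ler_wpM2l ?cabs_ge0//; apply: ler_weXn2l.
    by rewrite lerDl cenorm_ge0.
  by rewrite size_mlist leq_add2r.
have mono (theta : rV) : (forall i, `|theta 0 i| <= `|eta 0 i|) -> phi nu theta <= phi nu eta.
  exact: weight_le.
(* the direction of the shift is opposite to the signs of x, so that
   <x, eta> = - <|x|, r> *)
have := transform_bound Ef.1 x mono HP.
have -> : mD a (transform (on_reals f)) x = transform (foldr (@mulj R n) (on_reals f) (mlist a)) x.
  have [p1 p2] := partials_transform (mlist a) (E_rapid Ef).
  by apply: complexP; rewrite /mD -/(mlist a) /= ?p1 ?p2.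
move=> H; rewrite cabsM cabs_real.
apply: (le_trans (ler_wpM2l (normr_ge0 _) H)).
have pe : phi nu eta <= phi nu r by apply: weight_le => // i; exact: sgr_row_le.
rewrite [in leLHS]expRD sgr_dot [in leRHS]opprB [in leRHS]expRD [in leRHS]expRN dot_mvec_ln -/r -/I1.
have key : `|mpow x b| * expR (- \sum_i `|x 0 i| * r 0 i) * \prod_i expR (y 0 i) ^+ b i
     <= (mfact b)%:R.
  rewrite /mpow normr_prod -sumrN expR_sum -!big_split /= /mfact natr_prod.
  apply: ler_prod => i _; rewrite !mulr_ge0 ?expR_ge0 ?exprn_ge0 ?expR_ge0//=.
  rewrite normrX mulrAC -exprMn mxE expRN ler_pdivrMr ?expR_gt0//.
  have xr : 0 <= `|x 0 i| * expR (y 0 i) by rewrite mulr_ge0 ?expR_ge0.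
  by rewrite [leRHS]mulrC -ler_pdivrMr ?ltr0n ?fact_gt0// exp_coeff_le.
have pp : 0 < \prod_i expR (y 0 i) ^+ b i.
  by apply: prodr_gt0 => i _; rewrite exprn_gt0 ?expR_gt0.
rewrite [leRHS]mulrA ler_pdivlMr//.
have -> : `|mpow x b| * (2 * I1 * (P * (expR (phi nu eta) * expR (- \sum_i `|x 0 i| * r 0 i)))) *
   \prod_i expR (y 0 i) ^+ b i =
   2 * I1 * P * expR (phi nu eta) * (`|mpow x b| * expR (- \sum_i `|x 0 i| * r 0 i) *
   \prod_i expR (y 0 i) ^+ b i) by ring.
have -> : 2 * I1 * P * (mfact b)%:R * expR (phi nu r) = 2 * I1 * P * expR (phi nu r) * (mfact b)%:R by ring.
apply: ler_pM => //.
- by do ?[exact: expR_ge0|apply: mulr_ge0].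
- by do ?[exact: expR_ge0|exact: ltW|apply: mulr_ge0].
- by apply: ler_wpM2l; rewrite ?ler_expR//; exact: mulr_ge0.
Qed.

Lemma pG_ge0 nu m g : (0 <= pG phi nu m g)%E.
Proof.
pose b : multiindex n := [ffun=> 0%N].
have b0 : (mlength b <= m)%N by rewrite /mlength big1// => i _; rewrite ffunE.
apply: (@le_trans _ _ ((cabs ((mpow 0 b)%:C * mD b g 0))%:E /
         ((mfact b)%:R%:E * expeR (- young_conj (psi phi nu) (mvec R b))))%E).
  apply: mule_ge0; first by rewrite lee_fin cabs_ge0.
  rewrite inve_ge0; apply: mule_ge0; last exact: expeR_ge0.
  by rewrite lee_fin ltW// mfact_gt0.
by apply: ereal_sup_ubound; exists 0, b, b.
Qed.

Lemma pG_fine nu m g : G_ phi nu g -> exists2 N : R, 0 <= N & pG phi nu m g = N%:E.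
Proof.
move=> [_ _ /(_ m)]; have := pG_ge0 nu m g; case: (pG _ _ _ _) => [r| |]//=.
by rewrite lee_fin => r0 _; exists r.
Qed.

(** Choosing, for each point, the most favourable exponent turns the bounds on
x^beta D^alpha g into exponential decay. *)
Lemma G_decay nu m g (N : R) x (a : multiindex n) (r : rV) : 0 <= N ->
  (pG phi nu m g <= N%:E)%E -> (mlength a <= m)%N -> (forall i, 0 < r 0 i) ->
  cabs (mD a g x) <= 3 ^+ n * N * expR (phi nu (2 *: r) - \sum_i `|x 0 i| * r 0 i).
Proof.
move=> N0 gN am r0.
have xr i : 0 <= r 0 i * `|x 0 i| by rewrite mulr_ge0// ltW.
have /choice[bf bfP] : forall i, exists b, expR (r 0 i * `|x 0 i|) <=
    3 * ((2 * (r 0 i * `|x 0 i|)) ^+ b / b`!%:R).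
  by move=> i; exact: exp_coeff_large.
pose b : multiindex n := [ffun i => bf i].
have H0 : ((cabs ((mpow x b)%:C * mD a g x))%:E /
         ((mfact b)%:R%:E * expeR (- young_conj (psi phi nu) (mvec R b))) <= N%:E)%E.
  by apply: le_trans gN; apply: ereal_sup_ubound; exists x, a, b.
pose y : rV := \row_i ln (2 * r 0 i).
have := @conj_le _ _ (fun y => phi nu (map_mx expR y)) _ _ _ _ (mfact_gt0 b) (cabs_ge0 _) N0 H0 y.
have ey i : expR (y 0 i) = 2 * r 0 i by rewrite mxE lnK ?posrE// mulr_gt0.
have -> : map_mx expR y = 2 *: r by apply/rowP => i; rewrite mxE ey mxE.
rewrite opprB [in leRHS]expRD [in leRHS]expRN dot_mvec_ln.
have pp : 0 < \prod_i expR (y 0 i) ^+ b i.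
  by apply: prodr_gt0 => i _; rewrite exprn_gt0 ?expR_gt0.
rewrite [leRHS]mulrA ler_pdivlMr// cabsM cabs_real /mpow normr_prod => H1.
have key : expR (\sum_i `|x 0 i| * r 0 i) * (mfact b)%:R <=
    3 ^+ n * ((\prod_i `|x 0 i ^+ b i|) * \prod_i expR (y 0 i) ^+ b i).
  rewrite expR_sum /mfact natr_prod -big_split /= -[X in 3 ^+ X]card_ord -prodr_const -!big_split /=.
  apply: ler_prod => i _; rewrite mulr_ge0 ?expR_ge0//=.
  rewrite normrX -exprMn ey ffunE; have := bfP i.
  rewrite mulrA ler_pdivlMr ?ltr0n ?fact_gt0// (mulrC (r 0 i)).
  by rewrite (_ : 2 * (`|x 0 i| * r 0 i) = `|x 0 i| * (2 * r 0 i)); last by ring.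
rewrite expRD expRN [leRHS]mulrA ler_pdivlMr ?expR_gt0//.
have F0 := mfact_gt0 b.
rewrite -(ler_pM2r F0) -[leLHS]mulrA; set D := cabs (mD a g x) in H1 *.
have D0 : 0 <= D by exact: cabs_ge0.
apply: (le_trans (ler_wpM2l D0 key)).
set A := \prod_i `|_| in H1 *; set B := \prod_i expR _ ^+ _ in H1 *.
rewrite (_ : D * (3 ^+ n * (A * B)) = 3 ^+ n * (A * D * B)); last by ring.
rewrite (_ : 3 ^+ n * N * _ * _ = 3 ^+ n * (N * (mfact b)%:R * expR (phi nu (2 *: r)))); last by ring.
by rewrite ler_wpM2l// exprn_ge0.
Qed.

End Estimates.

(** * Seminorm estimates for the inverse transform *)

Section PureDerivatives.
Variables (R : realType) (n : nat).
Local Open Scope complex_scope.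
Local Notation RT := (measurableTypeR R).
Local Notation T := (n.-tuple RT).
Local Notation rV := ('rV[R]_n).
Local Notation cV := ('rV[R[i]]_n).
Implicit Types (f : cV -> R[i]^o) (g : rV -> R[i]^o) (x y eta : rV) (z : cV).

(** Derivatives in a single variable suffice to bound the growth of the inverse
transform, by cenorm_pow_le. *)
Definition pure (j : 'I_n) (k : nat) : multiindex n := [ffun i => if i == j then k else 0%N].

Lemma mlength_pure j k : mlength (pure j k) = k.
Proof.
rewrite /mlength (bigD1 j)//= ffunE eqxx big1 ?addn0// => i /negbTE ij.
by rewrite ffunE ij.
Qed.

Lemma mlist_pure j k : mlist (pure j k) = nseq k j.
Proof.
rewrite /mlist; have := enum_uniq 'I_n; have : j \in enum 'I_n by rewrite mem_enum.
elim: (enum 'I_n) => // i s IH; rewrite inE /= ffunE => /orP[/eqP <-|js] /andP[nis su].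
  rewrite eqxx; suff -> : flatten [seq nseq (pure j k l) l | l <- s] = [::] by rewrite cats0.
  elim: s nis {IH su} => //= l s IH; rewrite inE negb_or => /andP[jl js].
  by rewrite IH// ffunE eq_sym (negbTE jl).
by case: eqP => [E|_]; [move: nis; rewrite E js|exact: IH].
Qed.

Definition pderiv (j : 'I_n) (k : nat) g : rV -> R[i] := mD (pure j k) g.

Lemma pderivE j k g : pderiv j k g =
  fun x => (partials (nseq k j) (re g) x +i* partials (nseq k j) (im g) x).
Proof. by apply/funext => x; rewrite /pderiv /mD -/(mlist _) mlist_pure. Qed.

Lemma re_pderiv j k g : re (pderiv j k g) = partials (nseq k j) (re g).
Proof. by rewrite pderivE. Qed.

Lemma im_pderiv j k g : im (pderiv j k g) = partials (nseq k j) (im g).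
Proof. by rewrite pderivE. Qed.

Lemma pderiv0 j g : pderiv j 0 g = g.
Proof. by rewrite pderivE; apply/funext => x; apply: complexP. Qed.

Lemma smooth_pderiv j k g : smooth (re g) -> smooth (im g) ->
  [/\ continuous (re (pderiv j k g)), continuous (im (pderiv j k g)),
   forall x, is_derive x (delta_mx 0 j : rV) (re (pderiv j k g)) (ReC (pderiv j k.+1 g x)) &
   forall x, is_derive x (delta_mx 0 j : rV) (im (pderiv j k g)) (ImC (pderiv j k.+1 g x))].
Proof.
move=> s1 s2; have [c1 d1] := s1 (nseq k j); have [c2 d2] := s2 (nseq k j).
rewrite re_pderiv im_pderiv; split => // x; rewrite pderivE /=; apply: DeriveDef => //.
Qed.

Lemma inverse_bound h z (C : R) : superexp h ->
  (forall t : T, cabs (h (rt t)) * expR (- dot (rt t) (map_mx (@complex.Im R) z)) <= C * Wgt t) ->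
  cabs (inverse h z) <= 2 * (\int[lebesgue_tuple R n]_t Wgt t) * C.
Proof.
move=> sh hC; apply: le_cint_Wgt; first exact: (superexp_wdom z sh).1.
by move=> t; rewrite cabsM cabs_cexp Re_icdot; exact: hC.
Qed.

Lemma cenorm_le_sum z : cenorm z <= \sum_j cabs (z 0 j).
Proof.
have S0 : 0 <= \sum_j cabs (z 0 j) by apply: sumr_ge0 => j _; exact: cabs_ge0.
rewrite /cenorm -[leRHS]ger0_norm// -sqrtr_sqr; apply: ler_wsqrtr.
suff [] : 0 <= \sum_j cabs (z 0 j) /\ \sum_j cabs (z 0 j) ^+ 2 <= (\sum_j cabs (z 0 j)) ^+ 2 by [].
elim: (index_enum _) => [|j s [IH0 IH]]; first by rewrite !big_nil expr0n.
rewrite !big_cons; have := cabs_ge0 (z 0 j); move: (cabs _) IH0 IH => a; nra.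
Qed.

(** The largest coordinate controls the norm up to a constant. *)
Lemma cenorm_pow_le z m : (1 + cenorm z) ^+ m <=
  n.+1%:R ^+ m * (1 + \sum_j cabs (z 0 j) ^+ m).
Proof.
pose M := \big[Num.max/1]_j cabs (z 0 j).
have Mj j : cabs (z 0 j) <= M by exact: (le_bigmax _ (fun j => cabs (z 0 j)) j).
have M1 : 1 <= M by exact: bigmax_ge_id.
have S0 : 0 <= \sum_j cabs (z 0 j) ^+ m.
  by apply: sumr_ge0 => j _; rewrite exprn_ge0 ?cabs_ge0.
have Mm : M ^+ m <= 1 + \sum_j cabs (z 0 j) ^+ m.
  have : M = 1 \/ exists j, M = cabs (z 0 j).
    rewrite /M; elim/big_ind: _ => [|a b Ha Hb|j _]; [by left| |by right; exists j].
    by case: (leP a b).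
  case=> [->|[j ->]]; first by rewrite expr1n lerDl.
  rewrite (bigD1 j)//= addrCA lerDl addr_ge0//; apply: sumr_ge0 => i _.
  by rewrite exprn_ge0 ?cabs_ge0.
apply: (@le_trans _ _ ((n.+1%:R * M) ^+ m)).
  have c0 := cenorm_ge0 z.
  have M0 : 0 <= M by exact: le_trans M1.
  apply: lerXn2r; rewrite ?nnegrE ?addr_ge0 ?mulr_ge0//.
  rewrite -natr1 mulrDl mul1r addrC lerD//; apply: (le_trans (cenorm_le_sum z)).
  apply: (@le_trans _ _ (\sum_(j < n) M)); first exact: ler_sum.
  by rewrite sumr_const card_ord mulr_natl.
by rewrite exprMn ler_wpM2l ?exprn_ge0.
Qed.

End PureDerivatives.

Section InverseEstimate.
Variables (R : realType) (n : nat) (phi : nat -> 'rV[R]_n -> R).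
Hypothesis n0 : (0 < n)%N.
Hypothesis wphi : forall nu, weight (phi nu).
Hypothesis cube : forall nu : nat, exists2 k : R, 0 < k &
     forall x xi : 'rV[R]_n, orthant x ->
       (forall i, 0 <= xi 0 i <= 1) -> phi nu (x + xi) <= phi nu.+1 x + k.
Hypothesis dbl : forall nu : nat, exists2 a : R, 0 < a &
     forall x, phi nu (2 *: x) <= phi nu.+1 x + a.
Local Open Scope complex_scope.
Local Notation RT := (measurableTypeR R).
Local Notation T := (n.-tuple RT).
Local Notation rV := ('rV[R]_n).
Local Notation cV := ('rV[R[i]]_n).
Implicit Types (f : cV -> R[i]^o) (g : rV -> R[i]^o) (x y eta : rV) (z : cV).

(** G_decay at the rate |B| + 1 in every coordinate. *)
Lemma superexp_pderiv nu g j k : G_ phi nu g -> superexp (pderiv j k g).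
Proof.
move=> Gg; have [s1 s2 _] := Gg; have [c1 c2 _ _] := smooth_pderiv j k s1 s2.
split; first exact: (scont_cmeas (continuous_scont c1 c2)).
move=> B; have [N N0 NE] := pG_fine k Gg.
pose B1 : R := `|B| + 1; have B10 : 0 < B1 by rewrite ltr_pwDr.
exists (3 ^+ n * N * expR (phi nu (2 *: const_mx B1))) => t.
have gN : (pG phi nu k g <= N%:E)%E by rewrite NE.
have := @G_decay R n phi nu k g N (rt t) (pure j k) (const_mx B1) N0 gN.
rewrite mlength_pure leqnn => /(_ isT) H.
apply: (le_trans (H _)); first by move=> i; rewrite mxE.
rewrite expRD mulrA ler_wpM2l ?mulr_ge0 ?exprn_ge0 ?expR_ge0// ler_expR lerN2.
rewrite /l1norm mulr_sumr; apply: ler_sum => i _; rewrite mxE mulrC ler_wpM2l//.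
by rewrite mxE /B1 (le_trans (ler_norm B))// lerDl.
Qed.

Lemma inverse_pderiv nu g j k z : G_ phi nu g ->
  inverse (pderiv j k g) z = (- ('i%C * z 0 j)) ^+ k * inverse g z.
Proof.
move=> Gg; have [s1 s2 _] := Gg.
elim: k => [|k IH]; first by rewrite pderiv0 expr0 mul1r.
have [_ _ d1 d2] := smooth_pderiv j k s1 s2.
have [c1 c2 _ _] := smooth_pderiv j k.+1 s1 s2.
rewrite (inverse_parts z (superexp_pderiv j k Gg) (superexp_pderiv j k.+1 Gg))//.
by rewrite IH exprS mulrA.
Qed.

Definition inversion g z : R[i]^o := ((2 * pi)%:C ^+ n)^-1 * inverse g z.

Lemma pi_pow_neq0 : (2 * pi)%:C ^+ n != 0 :> R[i].
Proof.
rewrite expf_neq0//; apply/eqP => E; have := pi_gt0 R.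
by have := cabs_real (2 * pi : R); rewrite E cabs0 ger0_norm ?mulr_ge0 ?pi_ge0//; lra.
Qed.

Lemma pure_le (j : 'I_n) k m : (k <= m)%N -> (mlength (pure j k) <= m)%N.
Proof. by rewrite mlength_pure. Qed.

(** G_nu is mapped into E_(nu+2): half of the loss of index pays for the
doubling of the argument, the other half for the unit of exponential decay
that makes the integral converge. *)
Lemma pE_inversion nu m : exists2 C : R, 0 <= C & forall g, G_ phi nu g ->
  (pE phi nu.+2 m (inversion g) <= C%:E * pG phi nu m g)%E.
Proof.
have [a a0 Ha] := dbl nu; have [k k0 Hk] := cube nu.+1.
pose I1 : R := \int[lebesgue_tuple R n]_t Wgt t.
have I10 : 0 <= I1 by exact: wgt_int_ge0.
pose c := cabs (((2 * pi)%:C ^+ n)^-1 : R[i]); have c0 : 0 <= c by exact: cabs_ge0.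
pose C1 := 2 * I1 * (3 ^+ n * expR (k + a) * 4 ^+ n).
have C10 : 0 <= C1 by rewrite !mulr_ge0 ?exprn_ge0 ?expR_ge0.
exists (c * (n.+1%:R ^+ m * (n.+1%:R * C1))).
  by rewrite !mulr_ge0 ?exprn_ge0.
move=> g Gg; have [N N0 NE] := pG_fine m Gg; rewrite NE -EFinM.
have gN : (pG phi nu m g <= N%:E)%E by rewrite NE.
apply/pE_le => z; pose eta : rV := map_mx (@complex.Im R) z.
have bound j l : (l <= m)%N ->
    cabs (inverse (pderiv j l g) z) <= C1 * N * expR (phi nu.+2 eta).
  move=> lm; have -> : C1 * N * expR (phi nu.+2 eta) =
    2 * I1 * (3 ^+ n * N * expR (k + a) * expR (phi nu.+2 eta) * 4 ^+ n) by rewrite /C1; ring.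
  apply: inverse_bound; first exact: superexp_pderiv Gg.
  move=> t; pose r : rV := map_mx Num.norm eta + const_mx 1.
  have r0 i : 0 < r 0 i by rewrite !mxE ltr_pwDr.
  have := @G_decay R n phi nu m g N (rt t) (pure j l) r N0 gN (pure_le j lm) r0.
  move=> H; apply: (le_trans (ler_wpM2r (expR_ge0 _) H)).
  have phir : phi nu (2 *: r) <= phi nu.+2 eta + k + a.
    apply: (le_trans (Ha r)); rewrite lerD2r.
    have [_ even _ _] := wphi nu.+2; rewrite (even eta); apply: Hk.
      by move=> i; rewrite mxE.
    by move=> i; rewrite mxE ler01 lexx.
  have sumr : - dot (rt t) eta - \sum_i `|rt t 0 i| * r 0 i <= - l1norm (rt t).
    rewrite /l1norm /dot -!sumrN -big_split /=; apply: ler_sum => i _.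
    rewrite [r 0 i]mxE [map_mx Num.norm eta 0 i]mxE [const_mx 1 0 i]mxE.
    have := ler_norm (- (rt t 0 i * eta 0 i)); rewrite normrN normrM; lra.
  rewrite -[leLHS]mulrA -expRD.
  have -> : 3 ^+ n * N * expR (k + a) * expR (phi nu.+2 eta) * 4 ^+ n * Wgt t =
     3 ^+ n * N * (expR (phi nu.+2 eta + k + a) * (4 ^+ n * Wgt t)).
    by rewrite -addrA [in RHS]expRD; ring.
  rewrite ler_wpM2l ?mulr_ge0 ?exprn_ge0//.
  apply: (@le_trans _ _ (expR (phi nu.+2 eta + k + a) * expR (- l1norm (rt t)))).
    by rewrite -expRD ler_expR; lra.
  by rewrite ler_wpM2l ?expR_ge0// expR_l1norm_Wgt.
have b0 j : cabs (z 0 j) ^+ m * cabs (inverse g z) <= C1 * N * expR (phi nu.+2 eta).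
  have := bound j m (leqnn m).
  by rewrite (inverse_pderiv j m z Gg) cabsM cabsX cabsN cabsM cabs_i mul1r.
have bb : cabs (inverse g z) <= C1 * N * expR (phi nu.+2 eta).
  by have := bound (Ordinal n0) 0%N (leq0n m); rewrite pderiv0.
rewrite /inversion cabsM -/c.
set A := cabs (inverse g z) in b0 bb *; set B := C1 * N * _ in b0 bb.
have A0 : 0 <= A by exact: cabs_ge0.
apply: (@le_trans _ _ (c * (n.+1%:R ^+ m * (n.+1%:R * B)))); last first.
  by rewrite le_eqVlt; apply/orP; left; apply/eqP; rewrite /B -/eta; ring.
rewrite -mulrA ler_wpM2l//.
apply: (le_trans (ler_wpM2l A0 (cenorm_pow_le z m))).
rewrite mulrCA ler_wpM2l ?exprn_ge0// mulrDr mulr1 -natr1 mulrDl mul1r addrC lerD//.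
rewrite mulr_sumr mulr_natl -[X in B *+ X]card_ord -sumr_const; apply: ler_sum => j _.
by rewrite mulrC.
Qed.

End InverseEstimate.

(** * Continuity on inductive limits and the isomorphism *)

Section IndlimContinuity.
Variables (K : numFieldType) (R : realFieldType) (V V' : lmodType K).
Variables (E : nat -> set V) (E' : nat -> set V').
Variables (p : nat -> nat -> V -> \bar R) (p' : nat -> nat -> V' -> \bar R).
Variable F : indlim E p -> indlim E' p'.
Hypothesis E_lin : forall (a : K) u v, (\bigcup_nu E nu) u -> (\bigcup_nu E nu) v ->
  (\bigcup_nu E nu) (a *: u + v).
Hypothesis F_lin : forall (a : K) (f g h : indlim E p),
  indlim_val h = a *: indlim_val f + indlim_val g ->
  indlim_val (F h) = a *: indlim_val (F f) + indlim_val (F g).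
Hypothesis F_bound : forall nu, exists nu', forall m, exists m0 (C : R), 0 <= C /\
  forall f, E nu (indlim_val f) -> E' nu' (indlim_val (F f)) /\
    (p' nu' m (indlim_val (F f)) <= C%:E * p nu m0 (indlim_val f))%E.

(** The preimage of an absolutely convex neighborhood of 0 is absolutely convex,
and it is a neighborhood of 0 as soon as its trace on each step is one. *)
Lemma indlim_continuous : continuous F.
Proof.
apply/continuousP => U oU; suff: indlim_open (F @^-1` U) by [].
move=> f Uf.
have [A' [cA' nA'] A'U] := oU _ Uf.
exists [set u | exists2 k, indlim_val k = u & A' (indlim_val (F k))]; last first.
  move=> g [k kE A'k]; apply: A'U.
  by rewrite (F_lin (a := 1) (f := k) (g := f))// ?scale1r ?addrK ?kE ?subrK.
split.
  move=> a b _ _ ab [k <- Ak] [l <- Al].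
  have z0 : (\bigcup_nu E nu) 0.
    by rewrite -(addNr (indlim_val k)) -scaleN1r; apply: E_lin; exact: indlim_valP.
  pose o : indlim E p := Indlim p z0.
  have Fo : indlim_val (F o) = 0.
    by rewrite (F_lin (a := -1) (f := o) (g := o)) ?scaleN1r ?addNr//= scaler0 addr0.
  pose bl : indlim E p := Indlim p (E_lin b (indlim_valP l) z0).
  pose h : indlim E p := Indlim p (E_lin a (indlim_valP k) (indlim_valP bl)).
  exists h; first by rewrite /= addr0.
  have Fbl : indlim_val (F bl) = b *: indlim_val (F l) by rewrite (F_lin (f := l) (g := o) (a := b) (h := bl))// Fo addr0.
  by rewrite (F_lin (a := a) (f := k) (g := bl) (h := h))// Fbl; exact: cA'.
move=> nu; have [nu' /choice[m0 /choice[C HC]]] := F_bound nu.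
have [s [e e0 He]] := nA' nu'.
have C0 m : 0 <= C m by exact: (HC m).1.
pose S := \sum_(m <- s) C m; have S0 : 0 <= S by apply: sumr_ge0.
have S1 : 0 < 1 + S by rewrite ltr_pwDl.
exists [seq m0 m | m <- s]; exists (e / (1 + S)); first by rewrite divr_gt0.
move=> u Eu Hu; have bu : (\bigcup_nu E nu) u by exists nu.
exists (Indlim p bu) => //; apply: He => [|m ms].
  exact: ((HC 0%N).2 (Indlim p bu) Eu).1.
have /= [_ pm] := (HC m).2 (Indlim p bu) Eu.
apply: (le_lt_trans pm).
apply: (@le_lt_trans _ _ ((C m)%:E * (e / (1 + S))%:E)%E).
  by rewrite lee_wpmul2l ?lee_fin//; apply/ltW/Hu/map_f.
rewrite -EFinM lte_fin mulrCA -[ltRHS]mulr1 ltr_pM2l// ltr_pdivrMr// mul1r.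
have : C m <= S by rewrite /S (big_rem m)//= lerDl sumr_ge0.
by move=> CS; rewrite (le_lt_trans CS)// ltrDr.
Qed.

End IndlimContinuity.

Section Isomorphism.
Variables (R : realType) (n : nat) (phi : nat -> 'rV[R]_n -> R).
Hypothesis n0 : (0 < n)%N.
Hypothesis wphi : forall nu, weight (phi nu).
Hypothesis log_gap : forall (nu : nat) (A : R), 0 < A -> exists2 c : R, 0 < c &
     forall x, phi nu x + A * ln (1 + enorm x) <= phi nu.+1 x + c.
Hypothesis cube : forall nu : nat, exists2 k : R, 0 < k &
     forall x xi : 'rV[R]_n, orthant x ->
       (forall i, 0 <= xi 0 i <= 1) -> phi nu (x + xi) <= phi nu.+1 x + k.
Hypothesis dbl : forall nu : nat, exists2 a : R, 0 < a &
     forall x, phi nu (2 *: x) <= phi nu.+1 x + a.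
Local Open Scope complex_scope.
Local Notation RT := (measurableTypeR R).
Local Notation T := (n.-tuple RT).
Local Notation rV := ('rV[R]_n).
Local Notation cV := ('rV[R[i]]_n).
Implicit Types (f : cV -> R[i]^o) (g : rV -> R[i]^o) (x y eta : rV) (z : cV).

Lemma E_succ nu f : E_ phi nu f -> E_ phi nu.+1 f.
Proof.
move=> Ef; split; first exact: Ef.1.
move=> m; have [P P0 PE] := pE_fine m Ef.
have [c c0 Hc] := log_gap nu ltr01.
apply: (@le_lt_trans _ _ (P * expR c)%:E); last exact: ltry.
apply/pE_le => z; have /pE_le/(_ z) H : (pE phi nu m f <= P%:E)%E by rewrite PE.
apply: (le_trans H); rewrite -mulrA ler_wpM2l// -expRD ler_expR.
apply: le_trans (_ : _ <= c + phi nu.+1 _); last by [].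
rewrite [leRHS]addrC; apply: le_trans (Hc _).
by rewrite lerDl mul1r ln_ge0// lerDl sqrtr_ge0.
Qed.

Lemma E_mono nu nu' f : (nu <= nu')%N -> E_ phi nu f -> E_ phi nu' f.
Proof.
move=> /subnK <-; elim: (nu' - nu)%N => // k IH Ef; rewrite addSn.
by apply: E_succ; exact: IH.
Qed.

Lemma E_linear nu (a : R[i]) f f' : E_ phi nu f -> E_ phi nu f' ->
  E_ phi nu (a *: f + f').
Proof.
move=> Ef Ef'; split.
  by move=> z; apply: differentiableD; [apply: differentiableZ; exact: Ef.1|exact: Ef'.1].
move=> m; have [P P0 PE] := pE_fine m Ef; have [P' P'0 PE'] := pE_fine m Ef'.
apply: (@le_lt_trans _ _ (cabs a * P + P')%:E); last exact: ltry.
apply/pE_le => z.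
have /pE_le/(_ z) H : (pE phi nu m f <= P%:E)%E by rewrite PE.
have /pE_le/(_ z) H' : (pE phi nu m f' <= P'%:E)%E by rewrite PE'.
have c0 := cenorm_ge0 z.
apply: (@le_trans _ _ ((cabs a * cabs (f z) + cabs (f' z)) * (1 + cenorm z) ^+ m)).
  apply: ler_wpM2r; first by rewrite exprn_ge0// addr_ge0.
  by apply: (le_trans (cabsD _ _)); rewrite lerD// cabsM.
rewrite mulrDl mulrDl -!mulrA lerD// ler_wpM2l ?cabs_ge0//.
Qed.

Lemma bigE_linear (a : R[i]) f f' : (\bigcup_nu E_ phi nu) f -> (\bigcup_nu E_ phi nu) f' ->
  (\bigcup_nu E_ phi nu) (a *: f + f').
Proof.
move=> [nu _ Ef] [nu' _ Ef']; exists (maxn nu nu'); first by [].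
by apply: E_linear; [apply: (E_mono _ Ef); exact: leq_maxl|apply: (E_mono _ Ef'); exact: leq_maxr].
Qed.

Lemma transform_G nu f : E_ phi nu f -> G_ phi nu (transform (on_reals f)).
Proof.
move=> Ef; have [s1 s2] := smooth_transform (E_rapid Ef); split => // m.
have [P P0 PE] := pE_fine (m + 2 * n) Ef.
by apply: (le_lt_trans (pG_transform wphi m Ef)); rewrite PE -EFinM ltry.
Qed.

Lemma transform_linear (a : R[i]) f f' : (\bigcup_nu E_ phi nu) f -> (\bigcup_nu E_ phi nu) f' ->
  transform (on_reals (a *: f + f')) =
  a *: (transform (on_reals f) : rV -> R[i]^o) + transform (on_reals f').
Proof.
move=> [nu _ Ef] [nu' _ Ef']; apply/funext => x.
have i1 := wdom_integrable (rapid_wdom x (E_rapid Ef)).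
have i2 := wdom_integrable (rapid_wdom x (E_rapid Ef')).
rewrite /transform; under eq_cint do rewrite /on_reals mulrDl -mulrA.
by rewrite cintD//; [rewrite cintM|exact: cintegrableM].
Qed.

Lemma inversion_E nu g : G_ phi nu g -> E_ phi nu.+2 (inversion g).
Proof.
move=> Gg; split.
  have sg : superexp g by have := superexp_pderiv (Ordinal n0) 0 Gg; rewrite pderiv0.
  rewrite (_ : inversion g = (((2 * pi)%:C ^+ n)^-1 : R[i]) *: (inverse g : cV -> R[i]^o)).
    2: by apply/funext => z; rewrite fctE /inversion.
  by move=> z; apply: differentiableZ; exact: entire_inverse.
move=> m; have [C C0 HC] := pE_inversion n0 wphi cube dbl nu m.
have [N N0 NE] := pG_fine m Gg.
by apply: (le_lt_trans (HC g Gg)); rewrite NE -EFinM ltry.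
Qed.

(** The integral defining the inverse transform at a point of the space through
i eta is the inversion integral of the restriction of f to this space. *)
Lemma inversion_transform nu f : E_ phi nu f -> inversion (transform (on_reals f)) = f.
Proof.
move=> Ef; apply/funext => z.
pose x0 : rV := map_mx (@complex.Re R) z; pose eta : rV := map_mx (@complex.Im R) z.
pose fe : rV -> R[i] := fun xi => f (\row_i (xi 0 i +i* eta 0 i)).
have zE : \row_i (x0 0 i +i* eta 0 i) = z.
  by apply/rowP => i; rewrite !mxE; case: (z 0 i).
have [P P0 PE] := pE_fine (2 * n) Ef.
have HP : forall z, cabs (f z) * (1 + cenorm z) ^+ (2 * n) <=
     P * expR (phi nu (map_mx (@complex.Im R) z)).
  by apply/pE_le; rewrite PE.
have mono eta' (theta : rV) : (forall i, `|theta 0 i| <= `|eta' 0 i|) -> phi nu theta <= phi nu eta'.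
  exact: weight_le.
have shift x : transform (on_reals f) x = (expR (dot x eta))%:C * transform fe x.
  exact: (transform_shift Ef.1 (E_bounds Ef) x (mono eta) HP).
have shift' x : transform fe x = (expR (- dot x eta))%:C * transform (on_reals f) x.
  by rewrite shift mulrA -rmorphM /= -expRD addNr expR0 mul1r.
pose I1 : R := \int[lebesgue_tuple R n]_t Wgt t.
have I10 : 0 <= I1 by exact: wgt_int_ge0.
(* shifting the domain of integration by eta - sgn x instead of eta leaves a factor
   exp (- |x_1| - ... - |x_n|); r dominates eta - sgn x whatever the signs of x *)
pose r : rV := map_mx Num.norm eta + const_mx 1.
have rE i : r 0 i = `|eta 0 i| + 1 by rewrite [LHS]mxE [X in X + _]mxE [X in _ + X]mxE.
have rapfe := rapid_cpt Ef.1 (E_bounds Ef) eta.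
have [_ /(_ 1%N)[C HC]] := rapfe.
have dec t : cabs (transform fe (rt t)) <= 2 * I1 * P * expR (phi nu r) * 4 ^+ n * Wgt t.
  pose sg : rV := \row_i - Num.sg (rt t 0 i); pose eta' := eta + sg.
  have sgE i : sg 0 i = - Num.sg (rt t 0 i) by rewrite mxE.
  have eta'E i : eta' 0 i = eta 0 i - Num.sg (rt t 0 i) by rewrite [LHS]mxE sgE.
  have H : cabs (transform (on_reals f) (rt t)) <=
      2 * I1 * (P * expR (phi nu eta' + dot (rt t) eta')).
    exact: (transform_bound (s := [::]) Ef.1 (rt t) (mono eta') HP).
  rewrite shift' cabsM cabs_real ger0_norm ?expR_ge0//.
  apply: (le_trans (ler_wpM2l (expR_ge0 _) H)).
  have le1 : phi nu eta' <= phi nu r.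
    apply: weight_le => // i; rewrite eta'E rE.
    rewrite [leRHS]ger0_norm ?addr_ge0//; apply: (le_trans (ler_normB _ _)).
    by rewrite lerD2l normr_sg; case: (_ != 0).
  have le2 : dot (rt t) eta' = dot (rt t) eta - l1norm (rt t).
    rewrite /dot /l1norm -sumrB; apply: eq_bigr => i _.
    by rewrite eta'E [`|_|]normrEsg; ring.
  rewrite le2 (_ : expR _ * _ = 2 * I1 * P * (expR (- dot (rt t) eta) *
    expR (phi nu eta' + (dot (rt t) eta - l1norm (rt t))))); last by ring.
  rewrite -expRD -!mulrA !ler_wpM2l//.
  apply: (@le_trans _ _ (expR (phi nu r) * expR (- l1norm (rt t)))).
    by rewrite -expRD ler_expR; lra.
  by rewrite ler_wpM2l ?expR_ge0// expR_l1norm_Wgt.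
have cfe : scont (fun t => fe (rt t)).
  have := scont_entire_cpt Ef.1 eta; congr scont; apply/funext => t.
  by rewrite /fe; congr f; apply/rowP => i; rewrite !mxE.
have feE : fe x0 = f z by rewrite /fe; congr f.
have feW t : cabs (fe (rt t)) <= C * Wgt t by rewrite -[Wgt t]expr1; exact: HC.
have key : itransform (transform fe) x0 = (2 * pi)%:C ^+ n * f z.
  by rewrite (transformK x0 cfe feW dec) feE.
rewrite /inversion (_ : inverse _ z = itransform (transform fe) x0).
  by rewrite key mulKf// pi_pow_neq0.
apply: eq_cint => t _; rewrite /cexp Re_icdot Im_icdot -/x0 -/eta shift.
rewrite (_ : dot x0 (rt t) = dot (rt t) x0); last first.
  by apply: eq_bigr => i _; rewrite mulrC.
rewrite mulrACA -rmorphM /= -expRD subrr expR0 mul1r //.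
Qed.

Lemma transform_inversion nu g : G_ phi nu g -> transform (on_reals (inversion g)) = g.
Proof.
move=> Gg; apply/funext => y; have Eg := inversion_E Gg.
have [_ /(_ 1%N)[C HC]] := E_rapid Eg.
have itE x : itransform g x = (2 * pi)%:C ^+ n * on_reals (inversion g) x.
  rewrite /on_reals /inversion mulVKf ?pi_pow_neq0//.
  apply: eq_cint => t _; rewrite cdot_real cexp_im; congr (_ * cis _).
  by apply: eq_bigr => i _; rewrite mulrC.
have sg := superexp_pderiv (Ordinal n0) 0 Gg; rewrite pderiv0 in sg.
have [C1 HC1] := superexp_wgt sg.
have [s1 s2 _] := Gg.
have [c1 _] := s1 [::]; have [c2 _] := s2 [::].
have itW t : cabs (itransform g (rt t)) <= cabs ((2 * pi)%:C ^+ n : R[i]) * C * Wgt t.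
  by rewrite itE cabsM -mulrA ler_wpM2l ?cabs_ge0// -[Wgt t]expr1.
have := itransformK y (continuous_scont c1 c2) HC1 itW.
rewrite (_ : transform (itransform g) y = (2 * pi)%:C ^+ n * transform (on_reals (inversion g)) y).
  by move/(mulfI (pi_pow_neq0 R n)).
rewrite /transform -cintM//; last exact: (wdom_integrable (rapid_wdom y (E_rapid Eg))).
by apply: eq_cint => t _; rewrite itE mulrA.
Qed.

Definition fourier_indlim (f : EPhi phi) : GPsi phi.
Proof.
exists (transform (on_reals (indlim_val f))).
by have [nu _ Ef] := indlim_valP f; exists nu; [by []|exact: transform_G].
Defined.

Definition inversion_indlim (g : GPsi phi) : EPhi phi.
Proof.
exists (inversion (indlim_val g)).
by have [nu _ Gg] := indlim_valP g; exists nu.+2; [by []|exact: inversion_E].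
Defined.

End Isomorphism.

Lemma indlim_val_inj (K : numFieldType) (R : realFieldType) (V : lmodType K)
  (E : nat -> set V) (p : nat -> nat -> V -> \bar R) : injective (@indlim_val K R V E p).
Proof.
by move=> [u uP] [v vP] /= uv; subst v; congr Indlim; exact: Prop_irrelevance.
Qed.

Theorem theorem3 (R : realType) (n : nat) (phi : nat -> 'rV[R]_n -> R) :
  (0 < n)%N ->
  (forall nu, weight (phi nu)) ->
  (forall (nu : nat) (A : R), 0 < A -> exists2 c : R, 0 < c &
     forall x, phi nu x + A * ln (1 + enorm x) <= phi nu.+1 x + c) ->
  (forall nu : nat, exists2 k : R, 0 < k &
     forall x xi : 'rV[R]_n, orthant x ->
       (forall i, 0 <= xi 0 i <= 1) -> phi nu (x + xi) <= phi nu.+1 x + k) ->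
  (forall nu : nat, exists2 a : R, 0 < a &
     forall x, phi nu (2 *: x) <= phi nu.+1 x + a) ->
  (forall nu : nat, exists2 l : R, 0 < l &
     forall x, 2 * phi nu x <= phi nu.+1 x + l) ->
  exists F : EPhi phi -> GPsi phi,
    (forall f x, indlim_val (F f) x = fourier (indlim_val f) x) /\
    tvs_isomorphism F.
Proof.
move=> n0 wphi log_gap cube dbl _.
pose F := fourier_indlim wphi; pose G := inversion_indlim n0 wphi cube dbl.
have Flin (a : R[i]) (f g h : EPhi phi) :
    indlim_val h = a *: indlim_val f + indlim_val g ->
    indlim_val (F h) = a *: indlim_val (F f) + indlim_val (F g).
  move=> hE; rewrite /F /= hE.
  by apply: transform_linear; exact: indlim_valP.
have FK : cancel F G.
  move=> f; apply: indlim_val_inj; have [nu _ Ef] := indlim_valP f.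
  exact: (inversion_transform wphi Ef).
have GK : cancel G F.
  move=> g; apply: indlim_val_inj; have [nu _ Gg] := indlim_valP g.
  exact: (transform_inversion n0 wphi cube dbl Gg).
(* the union of the G_nu inherits its stability under linear combinations, and G
   its linearity, from the bijection with E(Phi) *)
have comb (a : R[i]) (g g' : GPsi phi) : exists2 e : EPhi phi,
    indlim_val e = a *: indlim_val (G g) + indlim_val (G g') &
    indlim_val (F e) = a *: indlim_val g + indlim_val g'.
  have eP := bigE_linear log_gap a (indlim_valP (G g)) (indlim_valP (G g')).
  exists (Indlim _ eP); first by [].
  by rewrite (Flin a (G g) (G g'))// !GK.
exists F; split; first by [].
split; first exact: Flin.
  apply: (indlim_continuous (bigE_linear log_gap) Flin) => nu; exists nu => m.
  exists (m + 2 * n)%N, (2 * (\int[lebesgue_tuple R n]_t Wgt t)); split.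
    by rewrite mulr_ge0 ?wgt_int_ge0.
  move=> f Ef; split; first exact: (transform_G wphi Ef).
  exact: (pG_transform wphi m Ef).
exists G; split => //; apply: indlim_continuous.
- move=> a u v Gu Gv.
  have [e _ Fe] := comb a (Indlim _ Gu) (Indlim _ Gv).
  have := indlim_valP (F e); by rewrite Fe.
- move=> a f g h hE; have [e eE Fe] := comb a f g.
  by rewrite -eE; congr indlim_val; rewrite -[e in RHS]FK; congr G; apply: indlim_val_inj; rewrite hE Fe.
- move=> nu; exists nu.+2 => m; have [C C0 HC] := pE_inversion n0 wphi cube dbl nu m.
  exists m, C; split; [by []|move=> g Gg]; split; first exact: (inversion_E n0 wphi cube dbl Gg).
  exact: HC.
Qed.
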